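(* Assume the following. (1) There exist non-random $D_n>\sqrt2$ and non-random $\overline\theta_S\in\mathbb R^{|S|}$ with $\mathbf F_{n,\overline\theta_S}$ nonsingular such that, with $\mathbb P_0^{(n)}$-probability at least $1-p^{-1}$, for all $S\in\mathscr S_{s_{\max}}$, $D_n^{-1}\mathbf I_{|S|}\preceq \mathbf F_{n,\hat\theta_S}\mathbf F_{n,\overline\theta_S}^{-1}\preceq D_n\mathbf I_{|S|}$ and $\|\mathbf F_{n,\overline\theta_S}^{1/2}(\hat\theta_S-\overline\theta_S)\|_2^2\le D_n|S|\log p$. Moreover $\mathbf F_{n,\theta^*_{S_0}}$ is nonsingular and $\zeta_{n,S_0}^2s_0\log p=o(1)$. (2) $\log\big([\max_{i}b''(x_i^\top\theta_0)]\vee\|\mathbf X_{S_0}\|_\infty\vee\rho_{\min,S_0}^{-1}\vee\rho_{\max,S_0}\big)=O(\log p)$ and $s_0\log p=o(n)$; there are constants $A_5,A_6>0$, $A_7\ge0$ with $p^{-A_5}\le\lambda\le A_6p^{-A_7}$; $\alpha\in(0,1)$; $A_6p^{-A_7}<A_4$; and $\log_p(D_n)=o(1)$. Then there exists a constant $K_{\rm Hel}>0$ such that, for sufficiently large $n$, $$\mathbb E\,\Pi_\alpha^n\{\theta:H_n(\theta,\theta_0)>K_{\rm Hel}\,\epsilon_n\}\le 2(s_0\log p)^{-1}+4p^{-1}+2p^{-s_0},\qquad \epsilon_n=\Big(\frac{s_0\log p}{n}\Big)^{1/2}.$$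
   Context: Asymptotics are as $n\to\infty$; $p,\mathbf X,\theta_0,s_{\max},w_n,\lambda,D_n$ may depend on $n$, quantities called constants do not. $p\ge n^{c}$ for some constant $c>0$. The covariates $x_1,\dots,x_n\in\mathbb R^p$ are non-random; $\mathbf X=(x_{ij})\in\mathbb R^{n\times p}$ has rows $x_i^\top$. Model: $p_\theta(y\mid x)=\exp\{y\,x^\top\theta-b(x^\top\theta)+k(y)\}$ (density w.r.t. a dominating measure $\mu$) with $b,k$ known, $b$ strictly convex and three times differentiable; $C_{\rm dev}\ge1$ is a constant depending only on $b$ with $\sup_{|y|\le1/2}b''(x+y)\le C_{\rm dev}b''(x)$ for all $x\in\mathbb R$. $Y_1,\dots,Y_n$ are independent, $Y_i$ with density/mass function $p_{\theta_0}(\cdot\mid x_i)$ for a true $\theta_0\in\mathbb R^p\setminus\{0\}$; $\mathbb P_0^{(n)},\mathbb E$ are the corresponding probability and expectation. Mean Hellinger distance: $H_n(\theta_1,\theta_2)=\{n^{-1}\sum_{i=1}^n\int(\sqrt{p_{\theta_1}(y\mid x_i)}-\sqrt{p_{\theta_2}(y\mid x_i)})^2d\mu(y)\}^{1/2}$. $S_\theta=\{j:\theta_j\ne0\}$, $S_0=S_{\theta_0}$, $s_0=|S_0|$, $[p]=\{1,\dots,p\}$, $\mathscr S_s=\{S\subset[p]:|S|\le s\}$. For $S\subseteq[p]$: $x_{i,S}=(x_{ij})_{j\in S}$, $\mathbf X_S$ is the submatrix of columns in $S$; for $\theta_S\in\mathbb R^{|S|}$, $L_{n,\theta_S}=\sum_i\{Y_ix_{i,S}^\top\theta_S-b(x_{i,S}^\top\theta_S)+k(Y_i)\}$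 ($L_{n,\theta}$ is the case $S=[p]$); $\hat\theta_S=\arg\max L_{n,\theta_S}$ (MLE), $\theta_S^*=\arg\max\mathbb E L_{n,\theta_S}$; $\mathbf F_{n,\theta_S}=\sum_ib''(x_{i,S}^\top\theta_S)x_{i,S}x_{i,S}^\top$; $\zeta_{n,S}=\max_i\|\mathbf F_{n,\theta_S^*}^{-1/2}x_{i,S}\|_2$; $\rho_{\min,S},\rho_{\max,S}$ are the smallest and largest eigenvalues of $\mathbf F_{n,\theta_S^*}$. $\|\mathbf A\|_\infty=\max_i\sum_j|a_{ij}|$. The relation $D_n^{-1}\mathbf I\preceq\mathbf F\mathbf G^{-1}\preceq D_n\mathbf I$ is read as $D_n^{-1}\mathbf G\preceq\mathbf F\preceq D_n\mathbf G$ in the positive semidefinite order. Prior: $s_{\max}$ is an integer with $s_0\le s_{\max}\le\operatorname{rank}(\mathbf X)$; $w_n$ is a probability mass function on $\{0,\dots,s_{\max}\}$ and $A_1,\dots,A_4>0$ are constants with $A_1p^{-A_3}w_n(s-1)\le w_n(s)\le A_2p^{-A_4}w_n(s-1)$ for $1\le s\le s_{\max}$; $\pi_n(S)=w_n(|S|)\binom{p}{|S|}^{-1}$; for $\lambda>0$, $g_S$ is the density of $\mathcal N(\hat\theta_S,\{\lambda\mathbf F_{n,\hat\theta_S}\}^{-1})$ on $\mathbb R^{|S|}$. The (data-dependent) prior is $\Pi_n(d\theta)=\sum_S\pi_n(S)g_S(\theta_S)\,d\theta_S\times\delta_0(d\theta_{S^c})$ and the $\alpha$-fractional posterior is $\Pi_\alpha^n(\mathcal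 A)=\int_{\mathcal A}e^{\alpha L_{n,\theta}}\Pi_n(d\theta)\big/\int e^{\alpha L_{n,\theta}}\Pi_n(d\theta)$. *)

(* Defs.v *)
From HB Require Import structures.
From mathcomp Require Import all_boot all_order all_algebra.
From mathcomp Require Import all_classical all_reals all_analysis.

Set Implicit Arguments.
Unset Strict Implicit.
Unset Printing Implicit Defensive.

Import Order.TTheory GRing.Theory Num.Theory.
Import numFieldNormedType.Exports.

Local Open Scope classical_set_scope.
Local Open Scope ring_scope.

Section LinearAlgebra.
Context {R : realType}.

Definition norm2 k (v : 'cV[R]_k) : R := Num.sqrt (\sum_i v i 0 ^+ 2).

Definition mxnorm_inf m k (A : 'M[R]_(m, k)) : R :=
  \big[Num.max/0]_(i < m) \sum_(j < k) `|A i j|.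

Definition quadform k (A : 'M[R]_k) (v : 'cV[R]_k) : R :=
  (v^T *m A *m v) 0 0.

Definition psdmx k (A : 'M[R]_k) : Prop :=
  A^T = A /\ forall v, 0 <= quadform A v.

Definition loewner_le k (A B : 'M[R]_k) : Prop := psdmx (B - A).

(* The square root of a positive semidefinite matrix exists and is unique;
   junk value 0 otherwise. *)
Definition sqrtmx k (A : 'M[R]_k) : 'M[R]_k :=
  xget 0 [set B | psdmx B /\ B *m B = A].

Definition eigval_min k (A : 'M[R]_k) : R := inf [set a | eigenvalue A a].
Definition eigval_max k (A : 'M[R]_k) : R := sup [set a | eigenvalue A a].

Definition argmax_set k disp (T : porderType disp) (f : 'cV[R]_k -> T) :
  set 'cV[R]_k := [set t | forall t', (f t' <= f t)%O].

(* Junk value 0 when no maximiser exists. *)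
Definition argmax k disp (T : porderType disp) (f : 'cV[R]_k -> T) :
  'cV[R]_k := xget 0 (argmax_set f).

End LinearAlgebra.

Section LebesgueTuple.
Context {R : realType}.
Local Notation RB := (measurableTypeR R).

Definition tcons m (xt : RB * m.-tuple RB) : m.+1.-tuple RB :=
  [tuple of xt.1 :: xt.2].

Lemma measurable_tcons m : measurable_fun [set: RB * m.-tuple RB] (@tcons m).
Proof. exact: measurable_cons. Qed.

Definition tuncons m (t : m.+1.-tuple RB) : RB * m.-tuple RB :=
  (thead t, [tuple of behead t]).

Lemma tconsK m : cancel (@tcons m) (@tuncons m).
Proof. by case=> x t; congr pair; apply: val_inj. Qed.

Lemma measurable_tuncons m : measurable_fun [set: m.+1.-tuple RB] (@tuncons m).
Proof.
apply: measurable_fun_pair; last exact: measurable_behead.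
exact: (@measurable_tnth _ RB m.+1 ord0).
Qed.

Section step.
Variables (m : nat) (nu : {sigma_finite_measure set (m.-tuple RB) -> \bar R}).

Definition lebesgue_tuple_step : set (m.+1.-tuple RB) -> \bar R :=
  pushforward (@lebesgue_measure R \x nu)%E (@tcons m).

Let image_measure :=
  measure_function_pushforward__canonical__measure_function_Measure
    (@lebesgue_measure R \x nu)%E (@measurable_tcons m).

Let step0 : lebesgue_tuple_step set0 = 0%E.
Proof. exact: (measure0 image_measure). Qed.

Let step_ge0 A : (0 <= lebesgue_tuple_step A)%E.
Proof. exact: (measure_ge0 image_measure). Qed.

Let step_sigma_additive : semi_sigma_additive lebesgue_tuple_step.
Proof. exact: (@measure_semi_sigma_additive _ _ _ image_measure). Qed.

HB.instance Definition _ := isMeasure.Build _ _ _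
  lebesgue_tuple_step step0 step_ge0 step_sigma_additive.

Let step_sigma_finite : sigma_finite setT lebesgue_tuple_step.
Proof.
have /sigma_finiteP[F [TF ndF Foo]] := sigma_finiteT (@lebesgue_measure R).
have /sigma_finiteP[G [TG ndG Goo]] := sigma_finiteT nu.
exists (fun i => @tuncons m @^-1` (F i `*` G i)).
  apply/esym; rewrite -subTset => t _.
  have [i _ Fi] : (\bigcup_i F i) (tuncons t).1 by rewrite -TF.
  have [j _ Gj] : (\bigcup_i G i) (tuncons t).2 by rewrite -TG.
  exists (maxn i j) => //; split.
  - by apply: (subsetPset _ _ (ndF _ _ _)) Fi; exact: leq_maxl.
  - by apply: (subsetPset _ _ (ndG _ _ _)) Gj; exact: leq_maxr.
move=> i; have [mF Fi] := Foo i; have [mG Gi] := Goo i; split.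
  rewrite -[X in measurable X]setTI; apply: measurable_tuncons => //.
  exact: measurableX.
rewrite /lebesgue_tuple_step /pushforward -comp_preimage.
rewrite (_ : _ \o _ = id) ?preimage_id; last first.
  by apply/funext => x; exact: tconsK.
by rewrite product_measure1E// lte_mul_pinfty// ge0_fin_numE.
Qed.

HB.instance Definition _ := Measure_isSigmaFinite.Build _ _ _
  lebesgue_tuple_step step_sigma_finite.

End step.

Fixpoint lebesgue_tuple m : {sigma_finite_measure set (m.-tuple RB) -> \bar R} :=
  match m with
  | 0 => \d_([tuple] : 0.-tuple RB)
  | m'.+1 => lebesgue_tuple_step (lebesgue_tuple m')
  end.

Definition lebesgue_int m (f : 'cV[R]_m -> \bar R) : \bar R :=
  (\int[lebesgue_tuple m]_t f (\col_i tnth t i))%E.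

End LebesgueTuple.

Section GLM.
Context {R : realType}.

Definition strictly_convex (f : R -> R) : Prop :=
  forall x y t : R, x != y -> 0 < t -> t < 1 ->
    f (t * x + (1 - t) * y) < t * f x + (1 - t) * f y.

(* p_theta(y | x) with eta := x^T theta. *)
Definition glm_density (b k : R -> R) (eta y : R) : R :=
  expR (y * eta - b eta + k y).

Definition linpred n q (X : 'M[R]_(n, q)) (t : 'cV[R]_q) (i : 'I_n) : R :=
  (X *m t) i 0.

Definition loglik n q (b k : R -> R) (X : 'M[R]_(n, q)) (y : 'I_n -> R)
    (t : 'cV[R]_q) : R :=
  \sum_i (y i * linpred X t i - b (linpred X t i) + k (y i)).

Definition fisher n q (b : R -> R) (X : 'M[R]_(n, q)) (t : 'cV[R]_q) : 'M[R]_q :=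
  \sum_i derive1n 2 b (linpred X t i) *: ((row i X)^T *m row i X).

Definition hellinger n q (mu : {measure set R -> \bar R}) (b k : R -> R)
    (X : 'M[R]_(n, q)) (t1 t2 : 'cV[R]_q) : R :=
  Num.sqrt (n%:R^-1 * \sum_i \int[mu]_y
    (Num.sqrt (glm_density b k (linpred X t1 i) y) -
     Num.sqrt (glm_density b k (linpred X t2 i) y)) ^+ 2).

Definition supp q (t : 'cV[R]_q) : {set 'I_q} := finset (fun j => t j 0 != 0).

Definition subcols n q (S : {set 'I_q}) (X : 'M[R]_(n, q)) : 'M[R]_(n, #|S|) :=
  colsub (fun j : 'I_#|S| => enum_val j) X.

(* The vector of R^q equal to t on S and to 0 off S. *)
Definition extend q (S : {set 'I_q}) (t : 'cV[R]_#|S|) : 'cV[R]_q :=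
  \col_j \sum_(l < #|S| | enum_val l == j) t l 0.

Definition mle_set n q (b k : R -> R) (X : 'M[R]_(n, q)) (y : 'I_n -> R)
    (S : {set 'I_q}) : set 'cV[R]_#|S| :=
  argmax_set (loglik b k (subcols S X) y).

Definition mle n q (b k : R -> R) (X : 'M[R]_(n, q)) (y : 'I_n -> R)
    (S : {set 'I_q}) : 'cV[R]_#|S| :=
  argmax (loglik b k (subcols S X) y).

(* theta*_S; meaningful when the expected log-likelihood is finite. *)
Definition expected_mle n q d (T : measurableType d) (P : probability T R)
    (Y : 'I_n -> T -> R) (b k : R -> R) (X : 'M[R]_(n, q)) (S : {set 'I_q}) :
    'cV[R]_#|S| :=
  argmax (fun t => 'E_P[fun om => loglik b k (subcols S X) (Y ^~ om) t])%E.

(* zeta_{n,S} when X stands for X_S and t for theta*_S. *)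
Definition zeta n q (b : R -> R) (X : 'M[R]_(n, q)) (t : 'cV[R]_q) : R :=
  \big[Num.max/0]_i norm2 (invmx (sqrtmx (fisher b X t)) *m (row i X)^T).

Definition normal_density q (m : 'cV[R]_q) (V : 'M[R]_q) (t : 'cV[R]_q) : R :=
  (Num.sqrt ((2 * pi) ^+ q * \det V))^-1 *
  expR (- (quadform (invmx V) (t - m) / 2)).

Definition slab n q (b k : R -> R) (X : 'M[R]_(n, q)) (y : 'I_n -> R) (lam : R)
    (S : {set 'I_q}) : 'cV[R]_#|S| -> R :=
  let m := mle b k X y S in
  normal_density m (invmx (lam *: fisher b (subcols S X) m)).
Arguments slab {n q} b k X y lam S _.

Definition model_prior q (w : nat -> R) (S : {set 'I_q}) : R :=
  w #|S| / 'C(q, #|S|)%:R.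

(* The integral of f against the empirical prior Pi_n; w is a probability mass
   function on {0, ..., smax}. *)
Definition prior_int n q (b k : R -> R) (X : 'M[R]_(n, q)) (y : 'I_n -> R)
    (smax : nat) (w : nat -> R) (lam : R) (f : 'cV[R]_q -> \bar R) : \bar R :=
  (\sum_(S : {set 'I_q} | (#|S| <= smax)%N) (model_prior w S)%:E *
     lebesgue_int (fun t : 'cV[R]_#|S| =>
       f (extend t) * (slab b k X y lam S t)%:E))%E.

(* When X has full column rank on every S with #|S| <= smax, both integrals below
   are finite and the denominator is positive, so that fine loses nothing. *)
Definition frac_posterior n q (b k : R -> R) (X : 'M[R]_(n, q)) (y : 'I_n -> R)
    (smax : nat) (w : nat -> R) (lam alpha : R) (A : set 'cV[R]_q) : R :=
  let lik t := expR (alpha * loglik b k X y t) in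
  fine (prior_int b k X y smax w lam (fun t => (\1_A t * lik t)%:E)) /
  fine (prior_int b k X y smax w lam (fun t => (lik t)%:E)).

Definition mutually_independent n d (T : measurableType d) (P : probability T R)
    (Y : 'I_n -> T -> R) : Prop :=
  forall (J : {set 'I_n}) (B : 'I_n -> set R),
    (forall i, measurable (B i)) ->
    P (\bigcap_(i in [set` J]) Y i @^-1` B i) =
    (\prod_(i in J) P (Y i @^-1` B i))%E.

End GLM.

Arguments mle_set {R n q} b k X y S _.
Arguments slab {R n q} b k X y lam S _.

(* Main.v *)
Require Import Defs.
From HB Require Import structures.
From mathcomp Require Import all_boot all_order all_algebra.
From mathcomp Require Import all_classical all_reals all_analysis.
From mathcomp Require Import measurable_realfun ring lra.

Set Implicit Arguments.
Unset Strict Implicit.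
Unset Printing Implicit Defensive.

Import Order.TTheory GRing.Theory Num.Theory.
Import numFieldNormedType.Exports.

Local Open Scope classical_set_scope.
Local Open Scope ring_scope.

(** The fractional posterior mass of a set is a ratio of two integrals against
    the prior, and the two are handled quite differently: the numerator in
    expectation, the denominator on an event of high probability.

    Numerator.  The likelihood ratio against the truth, to the power [alpha],
    splits ([loglik_tilt]) as a [tilt], which has expectation one under the truth
    because the model is exponential ([integral_tilt]), times [expR (- J)], where
    [J] sums the gaps in Jensen's inequality for [b], at weight [alpha], between
    the two linear predictors.  These gaps dominate, up to [min alpha (1 - alpha)], those at weight one half
    ([jensen_gap_ge]), and the latter bound the squared Hellinger distance
    ([hellinger_sq_le]).  So outside a Hellinger ball of radius [r] the ratio is
    at most [expR (- min alpha (1 - alpha) * n * r ^ 2)] times the tilt.  The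
    prior depends on the data, so the tilt cannot be integrated out at once;
    but where the maximum likelihood estimators are under control the slab on
    [S] is at most [kap ^ #|S|] times a fixed Gaussian density
    ([normal_density_dominated], [slab_le_envelope]).  Against these fixed
    densities Tonelli's theorem applies, and what remains is the sum of the
    [model_prior w S * kap ^ #|S|], a geometric series because the prior ratio
    [p ^ (- A4)] beats [kap]: the latter is [p ^ (lam / 2)] up to a small power of
    [p], and [lam < A4]
    ([sum_model_prior], [integral_env]).

    Denominator.  Only the true support [S0] is kept.  A Chernoff bound for the
    score in each direction of an orthonormal frame of the Fisher form
    ([score_event]), with concavity of the log-likelihood ([mle_close]), puts the
    estimator close enough to the truth for the Fisher forms at the two points
    to be comparable.  On a Fisher ellipsoid around the estimator the likelihood
    is then at least the true one times a Gaussian factor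
    ([loglik_ellipsoid]), so the denominator is at least the true likelihood
    times a constant ([denominator_ge], [restricted_gaussian_mass]) which,
    compared with [w 0], is at least a fixed power of [p ^ (- #|S0|)]
    ([denominator_const_ge]).  A radius with [n * r ^ 2] a large multiple of
    [#|S0| * ln p] therefore wins ([far_term_le]), and the two exceptional events
    account for the other terms of the bound. *)

(** * Scalar convexity and second-order bounds *)

Section ConvexFunction.
Context {R : realType}.
Implicit Types b f g h : R -> R.

Lemma is_derive_continuous f g : (forall x : R, is_derive x 1 f (g x)) ->
  continuous f.
Proof.
by move=> df x; apply/differentiable_continuous/derivable1_diffP; case: (df x).
Qed.

Lemma mean_value0 f g (u : R) : (forall x : R, is_derive x 1 f (g x)) ->
  exists2 t, 0 <= t <= 1 & f u - f 0 = g (t * u) * u.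
Proof.
move=> df; have cf := is_derive_continuous df.
have [u0|u0|->] := ltgtP u 0.
- have [|c + E] := @MVT R f g u 0 u0 (fun x _ => df x).
    by apply: continuous_subspaceT.
  rewrite in_itv/= => /andP[uc c0]; exists (c / u).
    by rewrite ler_ndivlMr// ler_ndivrMr// mul0r mul1r !ltW.
  by rewrite divfK ?lt_eqF//; lra.
- have [|c + E] := @MVT R f g 0 u u0 (fun x _ => df x).
    by apply: continuous_subspaceT.
  rewrite in_itv/= => /andP[c0 cu]; exists (c / u).
    by rewrite ler_pdivlMr// ler_pdivrMr// mul0r mul1r !ltW.
  by rewrite divfK ?gt_eqF//; lra.
- by exists 0; rewrite ?lexx ?ler01// subrr mulr0.
Qed.

(** Stated with [h] controlled only up to [`|u|], since the bounds on second
    derivatives below are local. *)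
Lemma second_order_ge0 f g h (u : R) :
    (forall x : R, is_derive x 1 f (g x)) -> (forall x : R, is_derive x 1 g (h x)) ->
    f 0 = 0 -> g 0 = 0 -> (forall x, `|x| <= `|u| -> 0 <= h x) ->
  0 <= f u.
Proof.
move=> df dg f0 g0 h0.
have [t /andP[t0 t1]] := mean_value0 u df; rewrite f0 subr0 => ->.
have [s /andP[s0 s1]] := mean_value0 (t * u) dg; rewrite g0 subr0 => ->.
rewrite -mulrA; apply: mulr_ge0; last first.
  by rewrite -mulrA mulr_ge0// -expr2 sqr_ge0.
apply: h0; rewrite !normrM mulrA ler_piMl// (ger0_norm s0) (ger0_norm t0).
by rewrite mulr_ile1.
Qed.

(** The Bregman divergence of [b], with [b1] standing for its derivative. *)
Definition bregman b b1 eta u := b (eta + u) - b eta - b1 eta * u.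

Definition jensen_gap b (a eta d : R) :=
  a * b (eta + d) + (1 - a) * b eta - b (eta + a * d).

Section TwiceDifferentiable.
Variables (b b1 b2 : R -> R) (C : R).
Hypothesis db : forall x : R, is_derive x 1 b (b1 x).
Hypothesis db1 : forall x : R, is_derive x 1 b1 (b2 x).
Hypothesis bC : forall x y : R, `|y| <= 2^-1 -> b2 (x + y) <= C * b2 x.
Hypothesis cb : strictly_convex b.
Hypothesis C1 : 1 <= C.

Lemma is_derive_shift f g (e x : R) : (forall x : R, is_derive x 1 f (g x)) ->
  is_derive x 1 (fun x => f (e + x)) (g (e + x)).
Proof.
move=> df; have h1 : is_derive x 1 (fun x : R => e + x) 1.
  rewrite -[X in is_derive _ _ _ X]add0r; exact: is_deriveD.
have := @is_derive1_comp _ f (fun x : R => e + x) x _ _ (df _) h1.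
by rewrite mulr1.
Qed.

Lemma is_derive_eq_ext f (x u v : R) : u = v -> is_derive x 1 f u -> is_derive x 1 f v.
Proof. by move=> ->. Qed.

(** One computation for the upper and the lower bound on the divergence: [s] is
    [-1] for the former and [1] for the latter. *)
Lemma bregman_combination_ge0 (s c : R) eta u :
  (forall x, `|x| <= `|u| -> 0 <= s * b2 (eta + x) + c) ->
  0 <= s * bregman b b1 eta u + c * u ^+ 2 / 2.
Proof.
move=> h0.
pose f x := s * bregman b b1 eta x + c * x ^+ 2 / 2.
pose g x := s * (b1 (eta + x) - b1 eta) + c * x.
apply: (@second_order_ge0 f g (fun x => s * b2 (eta + x) + c)) => //.
- move=> x; have d1 := is_derive_shift eta x db.
  have -> : f = (s *: ((fun x => b (eta + x)) - cst (b eta)) +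
      ((c / 2) *: (id * id) + (- (s * b1 eta)) *: id)).
    by apply/funext => y /=; rewrite !fctE /= /GRing.scale/= /f /bregman; lra.
  have := is_deriveD (is_deriveZ s (is_deriveB d1 (is_derive_cst (b eta) x 1)))
    (is_deriveD (is_deriveZ (c / 2) (is_deriveM (is_derive_id x 1) (is_derive_id x 1)))
      (is_deriveZ (- (s * b1 eta)) (is_derive_id x 1))).
  by apply: is_derive_eq_ext; rewrite /g /GRing.scale/=; lra.
- move=> x; have d1 := is_derive_shift eta x db1.
  have -> : g = (s *: ((fun x => b1 (eta + x)) - cst (b1 eta)) + (c *: id)).
    by apply/funext => y /=; rewrite /g !fctE /= /GRing.scale/=; lra.
  have := is_deriveD (is_deriveZ s (is_deriveB d1 (is_derive_cst (b1 eta) x 1)))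
      (is_deriveZ c (is_derive_id x 1)).
  by apply: is_derive_eq_ext; rewrite /GRing.scale/=; lra.
- by rewrite /f /bregman addr0; lra.
- by rewrite /g addr0; lra.
Qed.

(** If [b2 x] were negative then, by the comparison [bC], [b2] would be negative on
    the whole interval of radius one half around [x], and [b] would be concave
    there. *)
Lemma b2_ge0 (x : R) : 0 <= b2 x.
Proof.
rewrite leNgt; apply/negP => b0.
have H (u : R) : `|u| <= 2^-1 -> bregman b b1 x u <= 0.
  move=> hu; have := @bregman_combination_ge0 (-1) 0 x u.
  rewrite !mul0r addr0 mulN1r oppr_ge0; apply => y yu.
  rewrite addr0 mulN1r oppr_ge0; apply: le_trans (bC _ (le_trans yu hu)) _.
  by apply: mulr_ge0_le0; [exact: le_trans C1|exact: ltW].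
have h1 : `|2^-1| <= 2^-1 :> R by rewrite ger0_norm.
have h2 : `|- 2^-1| <= 2^-1 :> R by rewrite normrN.
have := H _ h1; have := H _ h2; rewrite /bregman.
have := @cb (x + 2^-1) (x - 2^-1) 2^-1.
have -> : 2^-1 * (x + 2^-1) + (1 - 2^-1) * (x - 2^-1) = x by lra.
have /[swap]/[apply] : x + 2^-1 != x - 2^-1 by apply/eqP; lra.
have -> : 0 < 2^-1 :> R by rewrite invr_gt0.
have -> : 2^-1 < 1 :> R by lra.
move=> /(_ isT isT); rewrite -[(x - _)]/(x + - 2^-1); lra.
Qed.

Lemma bregman_le (eta u : R) : `|u| <= 2^-1 ->
  bregman b b1 eta u <= C * b2 eta * u ^+ 2 / 2.
Proof.
move=> hu.
have := @bregman_combination_ge0 (-1) (C * b2 eta) eta u.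
suff h x : `|x| <= `|u| -> 0 <= -1 * b2 (eta + x) + C * b2 eta.
  by move=> /(_ h); lra.
by move=> xu; have := bC eta (le_trans xu hu); lra.
Qed.

Lemma bregman_ge (eta u : R) : `|u| <= 2^-1 ->
  C^-1 * b2 eta * u ^+ 2 / 2 <= bregman b b1 eta u.
Proof.
move=> hu.
have := @bregman_combination_ge0 1 (- (C^-1 * b2 eta)) eta u.
suff h x : `|x| <= `|u| -> 0 <= 1 * b2 (eta + x) + - (C^-1 * b2 eta).
  by move=> /(_ h); lra.
move=> xu; have := @bC (eta + x) (- x); rewrite normrN addrK => /(_ (le_trans xu hu)).
rewrite -ler_pdivrMl ?(lt_le_trans _ C1)//; lra.
Qed.

Lemma b2_comparable (eta u : R) : `|u| <= 2^-1 ->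
  b2 eta <= C * b2 (eta + u).
Proof. by move=> hu; have := @bC (eta + u) (- u); rewrite normrN addrK; exact. Qed.

End TwiceDifferentiable.

Section Convexity.
Variables (b : R -> R).
Hypothesis cb : strictly_convex b.

Lemma convex_le x y t : 0 <= t <= 1 ->
  b (t * x + (1 - t) * y) <= t * b x + (1 - t) * b y.
Proof.
move=> /andP[]; rewrite le_eqVlt => /predU1P[<-|t0].
  by rewrite !mul0r !add0r subr0 !mul1r.
rewrite le_eqVlt => /predU1P[->|t1]; first by rewrite subrr !mul0r !addr0 !mul1r.
have [->|xy] := eqVneq x y; first by rewrite -!mulrDl [t + _]addrC subrK !mul1r.
exact/ltW/cb.
Qed.

(** The gap is concave in the weight and vanishes at the weights 0 and 1. *)
Lemma jensen_gap_ge a eta d : 0 < a < 1 ->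
  2 * Num.min a (1 - a) * jensen_gap b 2^-1 eta d <= jensen_gap b a eta d.
Proof.
move=> /andP[a0 a1]; rewrite /jensen_gap.
have [aa|aa] := leP a (1 - a).
- have := @convex_le (eta + 2^-1 * d) eta (2 * a).
  have -> : 2 * a * (eta + 2^-1 * d) + (1 - 2 * a) * eta = eta + a * d by lra.
  have -> : 0 <= 2 * a <= 1 by apply/andP; split; lra.
  move=> /(_ isT); lra.
- have := @convex_le (eta + 2^-1 * d) (eta + d) (2 * (1 - a)).
  have -> : 2 * (1 - a) * (eta + 2^-1 * d) + (1 - 2 * (1 - a)) * (eta + d) = eta + a * d by lra.
  have -> : 0 <= 2 * (1 - a) <= 1 by apply/andP; split; lra.
  move=> /(_ isT); lra.
Qed.

End Convexity.
End ConvexFunction.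

(** * Quadratic forms and square roots of matrices *)

Section QuadraticForms.
Context {R : realType}.

Definition bilform k (A : 'M[R]_k) (u v : 'cV[R]_k) : R := (u^T *m A *m v) 0 0.

Lemma bilformDl k (A : 'M[R]_k) u v w :
  bilform A (u + v) w = bilform A u w + bilform A v w.
Proof. by rewrite /bilform linearD/= !mulmxDl mxE. Qed.

Lemma bilformDr k (A : 'M[R]_k) u v w :
  bilform A w (u + v) = bilform A w u + bilform A w v.
Proof. by rewrite /bilform mulmxDr mxE. Qed.

Lemma bilformZl k (A : 'M[R]_k) a u w : bilform A (a *: u) w = a * bilform A u w.
Proof. by rewrite /bilform linearZ/= -!scalemxAl mxE. Qed.

Lemma bilformZr k (A : 'M[R]_k) a u w : bilform A w (a *: u) = a * bilform A w u.
Proof. by rewrite /bilform -!scalemxAr mxE. Qed.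

Lemma bilformNr k (A : 'M[R]_k) u w : bilform A w (- u) = - bilform A w u.
Proof. by rewrite -scaleN1r bilformZr mulN1r. Qed.

Lemma bilformC k (A : 'M[R]_k) u v : A^T = A -> bilform A u v = bilform A v u.
Proof.
move=> sA; rewrite /bilform -[in RHS](trmxK (v^T *m A *m u)) [in RHS]mxE.
by rewrite !trmx_mul sA trmxK mulmxA.
Qed.

Lemma quadformE k (A : 'M[R]_k) v : quadform A v = bilform A v v. Proof. by []. Qed.

Lemma quadformD k (A : 'M[R]_k) u v : A^T = A ->
  quadform A (u + v) = quadform A u + 2 * bilform A u v + quadform A v.
Proof.
move=> sA; rewrite !quadformE !bilformDl !bilformDr (bilformC v u)//; lra.
Qed.

Lemma quadformZ k (A : 'M[R]_k) a v : quadform A (a *: v) = a ^+ 2 * quadform A v.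
Proof. by rewrite !quadformE bilformZl bilformZr mulrA expr2. Qed.

Lemma quadformN k (A : 'M[R]_k) v : quadform A (- v) = quadform A v.
Proof. by rewrite -scaleN1r quadformZ sqrrN expr1n mul1r. Qed.

Lemma quadform_scale k (A : 'M[R]_k) a v : quadform (a *: A) v = a * quadform A v.
Proof. by rewrite /quadform -scalemxAr -scalemxAl mxE. Qed.

Lemma quadform_add k (A B : 'M[R]_k) v :
  quadform (A + B) v = quadform A v + quadform B v.
Proof. by rewrite /quadform mulmxDr mulmxDl mxE. Qed.

Lemma quadform_opp k (A : 'M[R]_k) v : quadform (- A) v = - quadform A v.
Proof. by rewrite /quadform mulmxN mulNmx mxE. Qed.

Lemma quadform0 k (A : 'M[R]_k) : quadform A 0 = 0.
Proof. by rewrite /quadform mulmx0 mxE. Qed.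

Lemma dotE k (u v : 'cV[R]_k) : (u^T *m v) 0 0 = \sum_i u i 0 * v i 0.
Proof. by rewrite mxE; apply: eq_bigr => i _; rewrite mxE. Qed.

Lemma norm2_sq k (v : 'cV[R]_k) : norm2 v ^+ 2 = (v^T *m v) 0 0.
Proof.
rewrite sqr_sqrtr ?sumr_ge0// => [|i _]; last exact: sqr_ge0.
by rewrite dotE; apply: eq_bigr => i _; rewrite expr2.
Qed.

Lemma norm2_ge0 k (v : 'cV[R]_k) : 0 <= norm2 v.
Proof. exact: sqrtr_ge0. Qed.

Lemma dot_eq0 k (v : 'cV[R]_k) : ((v^T *m v) 0 0 == 0) = (v == 0).
Proof.
rewrite dotE; apply/eqP/eqP => [/eqP|->]; last first.
  by rewrite big1// => i _; rewrite mxE mul0r.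
rewrite psumr_eq0 => [/allP h|i _]; last by rewrite -expr2 sqr_ge0.
apply/colP => i; have := h i; rewrite mem_index_enum => /(_ isT)/=.
by rewrite -expr2 sqrf_eq0 mxE => /eqP.
Qed.

Lemma dot_ge0 k (v : 'cV[R]_k) : 0 <= (v^T *m v) 0 0.
Proof. by rewrite -norm2_sq sqr_ge0. Qed.

(** The sum of the squares [(T * a i - P * b i) ^ 2] is non-negative, [P] being the
    inner product and [T] the squared norm of [b]. *)
Lemma cauchy_schwarz_sum (I : finType) (a b : I -> R) :
  (\sum_i a i * b i) ^+ 2 <= (\sum_i a i ^+ 2) * (\sum_i b i ^+ 2).
Proof.
set S := \sum_i a i ^+ 2; set T := \sum_i b i ^+ 2; set P := \sum_i _.
have T0 : 0 <= T by apply: sumr_ge0 => i _; exact: sqr_ge0.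
have H : 0 <= \sum_i (T * a i - P * b i) ^+ 2.
  by apply: sumr_ge0 => i _; exact: sqr_ge0.
have E : \sum_i (T * a i - P * b i) ^+ 2 = T * (S * T - P ^+ 2).
  transitivity (\sum_i (T ^+ 2 * a i ^+ 2 - 2 * T * P * (a i * b i) +
      P ^+ 2 * b i ^+ 2)); first by apply: eq_bigr => i _; ring.
  by rewrite big_split/= sumrB -!mulr_sumr -/S -/P -/T; ring.
move: H; rewrite E; have [T1|T1|T1] := ltgtP 0 T.
- by rewrite pmulr_rge0// subr_ge0.
- by move: T0; rewrite leNgt T1.
- have b0 i : b i = 0.
    move/esym/eqP: T1; rewrite psumr_eq0 => [/allP h|j _]; last exact: sqr_ge0.
    by have := h i; rewrite mem_index_enum sqrf_eq0 => /(_ isT)/eqP.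
  by move=> _; rewrite /P big1 ?expr0n/= -?T1 ?mulr0// => i _; rewrite b0 mulr0.
Qed.

(** Otherwise the form would become negative at [v] moved slightly along
    [- M *m v]. *)
Lemma psdmx_null k (M : 'M[R]_k) v : psdmx M -> quadform M v = 0 -> M *m v = 0.
Proof.
move=> [sM M0] v0; set w := M *m v.
have E : bilform M v w = (w^T *m w) 0 0.
  by rewrite /bilform /w trmx_mul sM.
apply/eqP; rewrite -dot_eq0 -E eq_le.
have a0 : 0 <= bilform M v w by rewrite E dot_ge0.
rewrite a0 andbT leNgt; apply/negP => a1.
have Q0 := M0 w.
have := M0 (v + (- (bilform M v w / (quadform M w + 1))) *: w).
rewrite quadformD// quadformZ v0 bilformZr.
set a := bilform M v w in a1 *; set Q := quadform M w in Q0 *.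
have Q1 : 0 < Q + 1 by lra.
have -> : 0 + 2 * (- (a / (Q + 1)) * a) + (- (a / (Q + 1))) ^+ 2 * Q =
  - (a ^+ 2 / (Q + 1) ^+ 2 * (Q + 2)) by field; rewrite gt_eqF.
rewrite oppr_ge0 leNgt => /negP; apply.
by rewrite mulr_gt0// ?divr_gt0 ?exprn_gt0//; lra.
Qed.

Lemma psdmx_eq0 k (M : 'M[R]_k) : psdmx M -> (forall v, quadform M v = 0) -> M = 0.
Proof.
move=> pM h; apply/matrixP => i j.
have := psdmx_null pM (h (delta_mx j 0)).
by move/colP/(_ i); rewrite -colE !mxE.
Qed.

Lemma quadform_sum k (A : 'M[R]_k) v :
  quadform A v = \sum_i \sum_j A i j * v i 0 * v j 0.
Proof.
rewrite /quadform -mulmxA mxE; apply: eq_bigr => i _; rewrite !mxE mulr_sumr.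
by apply: eq_bigr => j _; rewrite mulrCA mulrA.
Qed.

Lemma continuous_sum (T : topologicalType) (I : Type) (r : seq I) (F : I -> T -> R) :
  (forall i, continuous (F i)) -> continuous (fun x => \sum_(i <- r) F i x).
Proof.
move=> cF x; elim: r => [|i r IH].
  under [X in continuous_at _ X]eq_fun do rewrite big_nil.
  exact: cvg_cst.
under [X in continuous_at _ X]eq_fun do rewrite big_cons.
by apply: continuousD IH; exact: cF.
Qed.

(** The maximum of the Rayleigh quotient over the unit sphere is attained, by
    compactness, and at a maximiser [v] the positive semidefinite form
    [l%:M - A] vanishes. *)
Lemma psdmx_eigenvector k (A : 'M[R]_k) : psdmx A -> A != 0 ->
  exists (v : 'cV[R]_k) (l : R), [/\ 0 < l, (v^T *m v) 0 0 = 1 & A *m v = l *: v].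
Proof.
move=> pA A0; have [sA qA] := pA.
have [w0 w1] : exists w, 0 < quadform A w.
  apply: contrapT => /forallNP h; move/eqP: A0; apply; apply: psdmx_eq0 => // v.
  by apply/eqP; rewrite eq_le qA andbT leNgt; exact/negP/h.
pose nrm (u : 'rV[R]_k) := \sum_j u 0 j ^+ 2.
have nrmE (v : 'cV[R]_k) : nrm v^T = (v^T *m v) 0 0.
  by rewrite dotE; apply: eq_bigr => j _; rewrite mxE expr2.
pose S := [set u | nrm u = 1].
have wn : 0 < (w0^T *m w0) 0 0.
  rewrite lt_def dot_ge0 andbT dot_eq0; apply/eqP => w00.
  by move: w1; rewrite w00 quadform0 ltxx.
pose c := (norm2 w0)^-1.
have c0 : 0 < c by rewrite invr_gt0 lt_def norm2_ge0 andbT -sqrf_eq0 norm2_sq gt_eqF.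
have norm_cv : c ^+ 2 * (w0^T *m w0) 0 0 = 1.
  by rewrite /c exprVn norm2_sq mulVf// gt_eqF.
have dotZ a (v : 'cV[R]_k) : ((a *: v)^T *m (a *: v)) 0 0 = a ^+ 2 * (v^T *m v) 0 0.
  by rewrite -scalemxAr mxE [(a *: v)^T]linearZ/= -scalemxAl mxE mulrA expr2.
have cn : continuous nrm.
  apply: continuous_sum => j u; under [X in continuous_at _ X]eq_fun do rewrite expr2.
  by apply: continuousM; exact: coord_continuous.
have S0 : S !=set0 by exists (c *: w0)^T; rewrite /S/= nrmE dotZ.
have cS : compact S.
  pose C := [set u : 'rV[R]_k | forall j, `[-1, 1]%classic (u ord0 j)].
  have cC : compact C.
    by apply: (@rV_compact R k (fun=> `[-1, 1]%classic)) => j; exact: segment_compact.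
  apply: (subclosed_compact _ cC).
    apply: (@closed_comp _ _ nrm [set 1]); first by move=> u _; exact: cn.
    exact: closed_eq.
  move=> u Su j; rewrite /= in_itv/= -ler_norml -(@ler_sqr _ `|_|)// ?nnegrE//.
  rewrite expr1n real_normK ?num_real// -Su /nrm (bigD1 j)//= lerDl.
  by apply: sumr_ge0 => i _; exact: sqr_ge0.
have [] := @EVT_max_rV R k (fun u => quadform A u^T) S S0 cS.
  apply: continuous_subspaceT.
  under [X in continuous X]eq_fun do rewrite quadform_sum.
  apply: continuous_sum => i; apply: continuous_sum => j u.
  have ct l : continuous (fun u : 'rV[R]_k => u^T l 0).
    by move=> z; under [X in continuous_at _ X]eq_fun do rewrite mxE; exact: coord_continuous.
  apply: (@continuousM R _ (fun u : 'rV[R]_k => A i j * u^T i 0) (fun u => u^T j 0)).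
    apply: (@continuousM R _ (fun=> A i j) (fun u => u^T i 0)); last exact: ct.
    exact: cst_continuous.
  exact: ct.
move=> u; rewrite inE => uS umax.
pose v := u^T; pose l := quadform A v.
have vv : (v^T *m v) 0 0 = 1 by rewrite -nrmE /v trmxK.
have lmax w : quadform A w <= l * (w^T *m w) 0 0.
  have [->|/eqP wn0] := eqVneq w 0; first by rewrite quadform0 mulmx0 mxE mulr0.
  have ww : 0 < (w^T *m w) 0 0 by rewrite lt_def dot_ge0 dot_eq0 andbT; exact/eqP.
  have := umax ((norm2 w)^-1 *: w)^T; rewrite trmxK inE/= /S/= nrmE dotZ.
  rewrite exprVn norm2_sq mulVf ?gt_eqF// => /(_ erefl).
  by rewrite quadformZ exprVn norm2_sq ler_pdivrMl// mulrC.
exists v, l; split => //.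
- have := lt_le_trans w1 (lmax w0); by rewrite pmulr_lgt0.
- have qM w : quadform (l%:M - A) w = l * (w^T *m w) 0 0 - quadform A w.
    rewrite quadform_add quadform_opp; congr (_ - _).
    by rewrite /quadform mul_mx_scalar -scalemxAl mxE.
  have : (l%:M - A) *m v = 0.
    apply: psdmx_null; last by rewrite qM vv mulr1 /l subrr.
    split; first by rewrite linearB/= tr_scalar_mx sA.
    by move=> w; rewrite qM subr_ge0.
  by rewrite mulmxBl mul_scalar_mx => /eqP; rewrite subr_eq0 => /eqP ->.
Qed.

(** Induction on the rank: removing the component of [A] along an eigenvector of
    positive eigenvalue lowers the rank and keeps [A] positive semidefinite. *)
Lemma psdmx_sqrt k (A : 'M[R]_k) : psdmx A -> exists B, psdmx B /\ B *m B = A.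
Proof.
have [r] := ubnP (\rank A); elim: r A => // r IH A; rewrite ltnS => rA pA.
have [->|A0] := eqVneq A 0.
  exists 0; rewrite mulmx0; split => //; split; first exact: trmx0.
  by move=> v; rewrite /quadform mulmx0 mul0mx mxE.
have [v [l [l0 vv Av]]] := psdmx_eigenvector pA A0.
have [sA qA] := pA.
have vvM : v^T *m v = 1%:M by apply/matrixP => i j; rewrite !ord1 vv mxE.
have vA : v^T *m A = l *: v^T by rewrite -{1}sA -trmx_mul Av linearZ.
pose V := v *m v^T.
have sV : V^T = V by rewrite /V trmx_mul trmxK.
have qV w : quadform V w = (v^T *m w) 0 0 ^+ 2.
  rewrite /quadform /V mulmxA -mulmxA mxE big_ord1 expr2; congr (_ * _).
  by rewrite -[in LHS](trmxK (w^T *m v)) mxE trmx_mul trmxK.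
pose A' := A - l *: V.
have A'v : A' *m v = 0.
  by rewrite mulmxBl Av -scalemxAl /V -mulmxA vvM mulmx1 subrr.
have pA' : psdmx A'.
  split; first by rewrite linearB linearZ/= sA sV.
  move=> w; have := qA (w - (v^T *m w) 0 0 *: v).
  set c := (v^T *m w) 0 0.
  rewrite quadformD// quadformN quadformZ bilformNr bilformZr.
  rewrite bilformC// /bilform vA -scalemxAl mxE -/c.
  rewrite {2}/quadform vA -scalemxAl mxE vv.
  by rewrite quadform_add quadform_opp quadform_scale qV -/c; lra.
have vE : v^T = l^-1 *: (v^T *m A) by rewrite vA scalerA mulVf ?scale1r// gt_eqF.
have A'A : (A' < A)%MS.
  rewrite ltmxE; apply/andP; split.
    have -> : A' = (1%:M - V) *m A.
      by rewrite mulmxBl mul1mx /V -mulmxA vA -scalemxAr.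
    exact: submxMl.
  apply/negP => AA'; have : (v^T <= A')%MS.
    by apply: submx_trans AA'; rewrite vE; apply/scalemx_sub/submxMl.
  move/submxP => [W VW]; have := vv; rewrite VW -mulmxA A'v mulmx0 mxE => /eqP.
  by rewrite eq_sym oner_eq0.
have [B' [pB' BB']] := IH A' (leq_trans (rank_ltmx A'A) rA) pA'.
have [sB' qB'] := pB'.
have B'v : B' *m v = 0.
  apply/eqP; rewrite -dot_eq0 trmx_mul sB' mulmxA -(mulmxA v^T) BB' -mulmxA A'v.
  by rewrite mulmx0 mxE.
have vB' : v^T *m B' = 0 by rewrite -sB' -trmx_mul B'v trmx0.
exists (B' + Num.sqrt l *: V); split; [split|].
- by rewrite linearD linearZ/= sB' sV.
- move=> w; rewrite quadform_add quadform_scale qV addr_ge0//.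
  by rewrite mulr_ge0 ?sqrtr_ge0 ?sqr_ge0.
- rewrite mulmxDl !mulmxDr BB' -scalemxAr -scalemxAl -scalemxAr -scalemxAl.
  rewrite {1}/V (mulmxA B') B'v mul0mx {1}/V -(mulmxA v) vB' mulmx0 !scaler0.
  rewrite addr0 add0r scalerA -expr2 sqr_sqrtr ?ltW//.
  by rewrite /V mulmxA -(mulmxA v) vvM mulmx1 subrK.
Qed.

Lemma sqrtmxP k (A : 'M[R]_k) : psdmx A ->
  psdmx (sqrtmx A) /\ sqrtmx A *m sqrtmx A = A.
Proof. by move=> /psdmx_sqrt ex; exact: (@xgetPex _ 0 [set B | psdmx B /\ B *m B = A] ex). Qed.

Lemma norm2_sqrtmx k (A : 'M[R]_k) v : psdmx A ->
  norm2 (sqrtmx A *m v) ^+ 2 = quadform A v.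
Proof.
move=> /sqrtmxP[[sB _] BB]; rewrite norm2_sq trmx_mul sB mulmxA -(mulmxA v^T) BB.
by [].
Qed.

Lemma sqrtmx_unit k (A : 'M[R]_k) : psdmx A -> A \in unitmx ->
  sqrtmx A \in unitmx.
Proof. by move=> /sqrtmxP[_ BB]; rewrite -{1}BB unitmx_mul => /andP[]. Qed.

(** Cauchy-Schwarz in the geometry of [A]: this is how the leverages
    [norm2 (invmx (sqrtmx A) *m x)] bound the linear predictor. *)
Lemma dot_le_leverage k (A : 'M[R]_k) x v : psdmx A -> A \in unitmx ->
  (x^T *m v) 0 0 ^+ 2 <= norm2 (invmx (sqrtmx A) *m x) ^+ 2 * quadform A v.
Proof.
move=> pA uA; have [[sB _] BB] := sqrtmxP pA; have uB := sqrtmx_unit pA uA.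
have -> : x^T *m v = (invmx (sqrtmx A) *m x)^T *m (sqrtmx A *m v).
  by rewrite trmx_mul trmx_inv sB -mulmxA (mulmxA (invmx _)) mulVmx// mul1mx.
rewrite -norm2_sqrtmx// dotE.
rewrite !sqr_sqrtr ?sumr_ge0// => [|i _|i _]; rewrite ?sqr_ge0//.
exact: cauchy_schwarz_sum.
Qed.

Lemma quadform_gt0 k (A : 'M[R]_k) v : psdmx A -> A \in unitmx -> v != 0 ->
  0 < quadform A v.
Proof.
move=> pA uA v0; rewrite lt_def pA.2 andbT; apply: contraNneq v0 => q0.
by rewrite -[v](mulKmx uA) (psdmx_null pA q0) mulmx0.
Qed.

Lemma psdmx_scale k (A : 'M[R]_k) a : 0 <= a -> psdmx A -> psdmx (a *: A).
Proof.
move=> a0 [sA qA]; split; first by rewrite linearZ/= sA.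
by move=> v; rewrite quadform_scale mulr_ge0.
Qed.

Lemma loewner_quadform k (A B : 'M[R]_k) v : loewner_le A B ->
  quadform A v <= quadform B v.
Proof. by move=> [_ /(_ v)]; rewrite quadform_add quadform_opp subr_ge0. Qed.

Lemma pd_unitmx k (A : 'M[R]_k) :
  (forall v, v != 0 -> 0 < quadform A v) -> A \in unitmx.
Proof.
move=> h; rewrite -unitmx_tr -row_free_unit -kermx_eq0; apply/rowV0P => u /sub_kermxP u0.
apply: contrapT => /eqP un0.
have : 0 < quadform A u^T by apply: h; rewrite trmx_eq0.
by rewrite /quadform trmxK -[A]trmxK -mulmxA -trmx_mul u0 trmx0 mulmx0 mxE ltxx.
Qed.

(** Equivalent to non-negativity of the form at [u - 2 *: v]. *)
Lemma quadform_half k (A : 'M[R]_k) u v : psdmx A ->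
  quadform A u / 2 - quadform A v <= quadform A (u - v).
Proof.
move=> [sA qA]; have := qA (u - 2 *: v).
rewrite !quadformD// !quadformN quadformZ !bilformNr !bilformZr.
by move: (quadform A u) (quadform A v) (bilform A u v) => a b c; lra.
Qed.

End QuadraticForms.

Section Fisher.
Context {R : realType}.
Variables (n : nat) (b : R -> R).

Lemma quadform_fisher q (X : 'M[R]_(n, q)) t v :
  quadform (fisher b X t) v =
  \sum_i derive1n 2 b (linpred X t i) * linpred X v i ^+ 2.
Proof.
rewrite /quadform /fisher mulmx_sumr mulmx_suml summxE; apply: eq_bigr => i _.
rewrite -scalemxAr -scalemxAl mxE; congr (_ * _).
have E : row i X *m v = (linpred X v i)%:M.
  by apply/matrixP => r s; rewrite !ord1 -row_mul mxE [RHS]mxE eqxx mulr1n.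
have E' : v^T *m (row i X)^T = (linpred X v i)%:M.
  by rewrite -trmx_mul E tr_scalar_mx.
by rewrite mulmxA E' -mulmxA E mul_scalar_mx !mxE eqxx mulr1n expr2.
Qed.

Lemma psdmx_fisher q (X : 'M[R]_(n, q)) t :
  (forall x, 0 <= derive1n 2 b x) -> psdmx (fisher b X t).
Proof.
move=> b0; split; last first.
  by move=> v; rewrite quadform_fisher sumr_ge0// => i _; rewrite mulr_ge0 ?sqr_ge0.
rewrite /fisher linear_sum/=; apply: eq_bigr => i _.
by rewrite linearZ/= trmx_mul trmxK.
Qed.

Lemma linpredD q (X : 'M[R]_(n, q)) u v i : linpred X (u + v) i = linpred X u i + linpred X v i.
Proof. by rewrite /linpred mulmxDr mxE. Qed.

Lemma linpredZ q (X : 'M[R]_(n, q)) a v i : linpred X (a *: v) i = a * linpred X v i.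
Proof. by rewrite /linpred -scalemxAr mxE. Qed.

Lemma linpredN q (X : 'M[R]_(n, q)) v i : linpred X (- v) i = - linpred X v i.
Proof. by rewrite /linpred mulmxN mxE. Qed.

Lemma linpred_row q (X : 'M[R]_(n, q)) v i : linpred X v i = ((row i X)^T^T *m v) 0 0.
Proof. by rewrite trmxK -row_mul mxE. Qed.

End Fisher.

(** * Gaussian integrals in several variables *)

Section GaussianIntegral.
Context {R : realType}.
Local Notation RB := (measurableTypeR R).

Definition vec_of_tuple k (t : k.-tuple RB) : 'cV[R]_k := \col_i tnth t i.

Lemma lebesgue_intE k (f : 'cV[R]_k -> \bar R) :
  lebesgue_int f = (\int[lebesgue_tuple k]_t f (vec_of_tuple t))%E.
Proof. by []. Qed.

Lemma integral_lebesgue_tupleS m (f : m.+1.-tuple RB -> \bar R) :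
  measurable_fun [set: m.+1.-tuple RB] f -> (forall t, 0 <= f t)%E ->
  (\int[lebesgue_tuple m.+1]_t f t =
   \int[lebesgue_tuple m]_t \int[lebesgue_measure]_x f (tcons (x, t)))%E.
Proof.
move=> mf f0.
transitivity (\int[lebesgue_measure \x lebesgue_tuple m]_z f (tcons z))%E.
  have := @ge0_integral_pushforward _ _ _ _ R (@tcons R m) (@measurable_tcons R m)
    (lebesgue_measure \x lebesgue_tuple m)%E setT f measurableT.
  rewrite preimage_setT; apply => //.
have mft : measurable_fun setT (fun z : RB * m.-tuple RB => f (tcons z)).
  by apply: measurableT_comp => //; exact: measurable_tcons.
by rewrite (fubini_tonelli2 _ mft).
Qed.

Lemma vec_of_tcons m (x : R) (t : m.-tuple RB) :
  vec_of_tuple (tcons (x, t)) = col_mx x%:M (vec_of_tuple t) :> 'cV[R]_(1 + m).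
Proof.
apply/colP => i; rewrite [LHS]mxE [RHS]mxE.
case: splitP => j ij; rewrite !mxE.
  by rewrite (_ : i = ord0) ?tnth0 ?ord1 ?eqxx ?mulr1n//; apply: val_inj; rewrite /= ij ord1.
rewrite (_ : i = lift ord0 j); last by apply: val_inj.
by rewrite /= tnthS; congr (tnth _ _); apply: val_inj.
Qed.

Lemma measurable_vec_coord k j : measurable_fun setT (fun t : k.-tuple RB => vec_of_tuple t j 0).
Proof.
under [X in measurable_fun _ X]eq_fun do rewrite mxE.
exact: (@measurable_tnth _ RB k j).
Qed.

Lemma measurable_quadform k (A : 'M[R]_k) m :
  measurable_fun setT (fun t : k.-tuple RB => quadform A (vec_of_tuple t - m)).
Proof.
under [X in measurable_fun _ X]eq_fun do rewrite quadform_sum.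
have mc j : measurable_fun setT (fun t : k.-tuple RB => (vec_of_tuple t - m) j 0).
  under [X in measurable_fun _ X]eq_fun do rewrite mxE.
  by apply: measurable_funD; [exact: measurable_vec_coord|exact: measurable_cst].
apply: measurable_sum => i; apply: measurable_sum => j.
by apply: measurable_funM => //; apply: measurable_funM => //; exact: measurable_cst.
Qed.

Lemma measurable_exp_quadform k (A : 'M[R]_k) m (c : R) :
  measurable_fun setT (fun t : k.-tuple RB => expR (- (c * quadform A (vec_of_tuple t - m)))).
Proof.
apply: measurableT_comp => //; apply: measurableT_comp => //.
by apply: measurable_funM => //; exact: measurable_quadform.
Qed.

Lemma gaussian_integral1 (a c : R) : 0 < a ->
  (\int[lebesgue_measure]_x (expR (- (2^-1 * (a * (x - c) ^+ 2))))%:E =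
   (Num.sqrt (2 * pi / a))%:E)%E.
Proof.
move=> a0; have s0 : Num.sqrt a^-1 != 0 by rewrite gt_eqF// sqrtr_gt0 invr_gt0.
have s2 : Num.sqrt a^-1 ^+ 2 = a^-1 by rewrite sqr_sqrtr// invr_ge0 ltW.
have := integral_normal_pdf c (Num.sqrt a^-1).
rewrite normal_pdfE//; set p := normal_peak _.
have p0 : 0 < p by exact: normal_peak_gt0.
have pE : Num.sqrt (2 * pi / a) = p^-1.
  by rewrite /p /normal_peak invrK s2; congr Num.sqrt; rewrite -mulr_natl; ring.
move=> I1.
have -> : (fun x : R => (expR (- (2^-1 * (a * (x - c) ^+ 2))))%:E) =
    (fun x => (p^-1)%:E * (p * normal_fun c (Num.sqrt a^-1) x)%:E)%E.
  apply/funext => x; rewrite -EFinM mulKf ?gt_eqF//; congr (expR _)%:E.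
  rewrite s2 -mulr_natr; field; exact/lt0r_neq0.
rewrite ge0_integralZl//=.
- by rewrite I1 mule1 pE.
- apply/measurable_EFinP; apply: measurable_funM; first exact: measurable_cst.
  exact: measurable_normal_fun.
- by move=> x _; rewrite lee_fin mulr_ge0 ?expR_ge0// ltW.
- by rewrite lee_fin invr_ge0 ltW.
Qed.

Section Schur.
Variables (m : nat) (A : 'M[R]_(1 + m)).
Hypothesis sA : A^T = A.
Hypothesis pA : forall v, v != 0 -> 0 < quadform A v.

Let a := ulsubmx A 0 0.
Let B := ursubmx A.
Definition schur_complement : 'M[R]_m := drsubmx A - a^-1 *: (B^T *m B).
Local Notation S := schur_complement.

Let AE : A = block_mx a%:M B B^T (drsubmx A).
Proof.
rewrite -[LHS]submxK; congr block_mx.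
  by apply/matrixP => i j; rewrite !ord1 [RHS]mxE eqxx mulr1n.
by rewrite -[in LHS]sA trmx_ursub.
Qed.

Lemma quadform_schur x v : a != 0 ->
  quadform A (col_mx x%:M v) = a * (x + (B *m v) 0 0 / a) ^+ 2 + quadform S v.
Proof.
move=> a0.
have bE : B *m v = ((B *m v) 0 0)%:M.
  by apply/matrixP => i j; rewrite !ord1 [RHS]mxE eqxx mulr1n.
have bE' : v^T *m B^T = ((B *m v) 0 0)%:M by rewrite -trmx_mul {1}bE tr_scalar_mx.
set beta := (B *m v) 0 0 in bE bE' *.
have -> : quadform S v = quadform (drsubmx A) v - a^-1 * beta ^+ 2.
  rewrite quadform_add quadform_opp quadform_scale; congr (_ - _ * _).
  rewrite /quadform mulmxA bE' -mulmxA bE -scalar_mxM mxE eqxx mulr1n expr2.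
  by [].
rewrite /quadform {1}AE tr_col_mx tr_scalar_mx mul_row_block mul_row_col.
rewrite !mulmxDl bE' -(mulmxA x%:M B) bE -!scalar_mxM.
move: (v^T *m drsubmx A *m v) => Q.
by rewrite !mxE !eqxx !mulr1n; field.
Qed.

Lemma schur_pivot_gt0 : 0 < a.
Proof.
pose v : 'cV[R]_(1 + m) := delta_mx 0 0.
have : 0 < quadform A v.
  by apply: pA; apply/eqP => /colP/(_ 0)/eqP; rewrite !mxE eqxx oner_eq0.
rewrite /quadform trmx_delta -rowE -colE !mxE /a !mxE.
by rewrite (_ : lshift m 0 = 0 :> 'I_(1 + m))//; apply: val_inj.
Qed.

Lemma schur_sym : S^T = S.
Proof.
rewrite /schur_complement linearB linearZ/= trmx_mul trmxK; congr (_ - _).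
by rewrite trmx_drsub sA.
Qed.

Lemma schur_pd v : v != 0 -> 0 < quadform S v.
Proof.
move=> v0; have a0 := lt0r_neq0 schur_pivot_gt0.
have : 0 < quadform A (col_mx (- ((B *m v) 0 0 / a))%:M v).
  apply: pA; apply: contraNneq v0 => /eqP; rewrite col_mx_eq0 => /andP[_ /eqP ->].
  by [].
by rewrite quadform_schur// addNr expr0n mulr0 add0r.
Qed.

Lemma det_schur : \det A = a * \det S.
Proof.
have a0 := lt0r_neq0 schur_pivot_gt0.
have -> : A = block_mx 1%:M 0 (a^-1 *: B^T) 1%:M *m block_mx a%:M B 0 S.
  rewrite mulmx_block !mul1mx !mul0mx !addr0 [LHS]AE; congr block_mx.
    by rewrite -scalemxAl mul_mx_scalar scalerA mulVf// scale1r.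
  by rewrite /schur_complement -scalemxAl addrC subrK.
by rewrite det_mulmx det_lblock det_ublock !det1 !mul1r det_scalar1.
Qed.

End Schur.

(** Induction on the dimension: integrating out the first coordinate completes a
    square and leaves the form of the Schur complement.  Positivity of the
    determinant comes out of the same induction. *)
Theorem gaussian_integral k (A : 'M[R]_k) m :
  A^T = A -> (forall v, v != 0 -> 0 < quadform A v) ->
  0 < \det A /\
  lebesgue_int (fun t => (expR (- (2^-1 * quadform A (t - m))))%:E) =
    (Num.sqrt ((2 * pi) ^+ k / \det A))%:E.
Proof.
elim: k A m => [|k IH] A m sA pA.
  rewrite det_mx00 expr0 divr1 sqrtr1; split => //.
  rewrite lebesgue_intE/= integral_dirac//=.
    by rewrite diracT mul1e flatmx0 quadform_sum big_ord0 mulr0 oppr0 expR0.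
  by apply/measurable_EFinP; exact: measurable_exp_quadform.
have sAA : (A : 'M[R]_(1 + k))^T = A := sA.
have pAA : forall v : 'cV[R]_(1 + k), v != 0 -> 0 < quadform (A : 'M[R]_(1 + k)) v := pA.
have a0 := schur_pivot_gt0 pAA; set a := _ 0 0 in a0.
have [dS IS] := IH _ (dsubmx (m : 'cV[R]_(1 + k))) (schur_sym sAA) (schur_pd sAA pAA).
rewrite (det_schur sAA pAA) -/a; split; first exact: mulr_gt0.
rewrite lebesgue_intE integral_lebesgue_tupleS; last 2 first.
- by apply/measurable_EFinP; exact: measurable_exp_quadform.
- by move=> t; rewrite lee_fin expR_ge0.
set S := schur_complement _ in dS IS *.
pose m1 := dsubmx (m : 'cV[R]_(1 + k)).
pose m0 := usubmx (m : 'cV[R]_(1 + k)) 0 0.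
pose G (t : k.-tuple RB) := expR (- (2^-1 * quadform S (vec_of_tuple t - m1))).
pose c (t : k.-tuple RB) := m0 - (ursubmx (A : 'M[R]_(1 + k)) *m (vec_of_tuple t - m1)) 0 0 / a.
have E x t : expR (- (2^-1 * quadform A (vec_of_tuple (tcons (x, t)) - m))) =
    G t * expR (- (2^-1 * (a * (x - c t) ^+ 2))).
  rewrite -expRD; congr expR.
  have -> : vec_of_tuple (tcons (x, t)) - m =
      col_mx (x - m0)%:M (vec_of_tuple t - m1) :> 'cV[R]_(1 + k).
    have mE : m = col_mx m0%:M m1 :> 'cV[R]_(1 + k).
      rewrite -[LHS](@vsubmxK _ 1 k 1); congr col_mx.
      by apply/matrixP => i j; rewrite !ord1 [RHS]mxE eqxx mulr1n.
    rewrite vec_of_tcons {1}mE.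
    rewrite -[LHS]/((col_mx x%:M (vec_of_tuple t) : 'cV[R]_(1 + k)) - col_mx m0%:M m1).
    by rewrite opp_col_mx add_col_mx raddfB.
  rewrite (@quadform_schur _ _ sAA) ?gt_eqF// -/a -/S.
  have -> : x - m0 + (ursubmx (A : 'M[R]_(1 + k)) *m (vec_of_tuple t - m1)) 0 0 / a = x - c t.
    by rewrite /c opprB; ring.
  by ring.
transitivity (\int[lebesgue_tuple k]_t ((Num.sqrt (2 * pi / a))%:E * (G t)%:E))%E.
  apply: eq_integral => t _.
  under eq_integral => x _ do rewrite E EFinM.
  rewrite ge0_integralZl//=.
  - by rewrite gaussian_integral1// muleC.
  - apply/measurable_EFinP; apply: measurableT_comp => //.
    apply: measurableT_comp => //; apply: measurable_funM; first exact: measurable_cst.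
    apply: measurable_funM; first exact: measurable_cst.
    by apply: measurable_funX; exact: measurable_funB.
  - by rewrite lee_fin expR_ge0.
rewrite ge0_integralZl//=.
- rewrite [X in (_ * X)%E]IS -EFinM -sqrtrM ?divr_ge0 ?mulr_ge0 ?pi_ge0 ?(ltW a0)//.
  by congr (Num.sqrt _)%:E; rewrite exprS; field; rewrite !gt_eqF.
- by apply/measurable_EFinP; exact: measurable_exp_quadform.
- by move=> t _; rewrite lee_fin expR_ge0.
Qed.

Lemma pd_det_gt0 k (A : 'M[R]_k) : psdmx A -> A \in unitmx -> 0 < \det A.
Proof.
move=> pA uA; have [] := @gaussian_integral k A 0 pA.1 => // v v0.
exact: quadform_gt0.
Qed.

Lemma lebesgue_int_gaussian k (A : 'M[R]_k) m : psdmx A -> A \in unitmx ->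
  lebesgue_int (fun t => (expR (- (2^-1 * quadform A (t - m))))%:E) =
    (Num.sqrt ((2 * pi) ^+ k / \det A))%:E.
Proof.
move=> pA uA; have [] := @gaussian_integral k A m pA.1 => // v v0.
exact: quadform_gt0.
Qed.

(** Determinants are monotone because Gaussian integrals are antitone. *)
Lemma det_le k (A B : 'M[R]_k) : psdmx A -> A \in unitmx -> psdmx B -> B \in unitmx ->
  (forall v, quadform A v <= quadform B v) -> \det A <= \det B.
Proof.
move=> pA uA pB uB AB; have dA := pd_det_gt0 pA uA; have dB := pd_det_gt0 pB uB.
have : (lebesgue_int (fun t => (expR (- (2^-1 * quadform B (t - 0))))%:E) <=
        lebesgue_int (fun t => (expR (- (2^-1 * quadform A (t - 0))))%:E))%E.
  apply: ge0_le_integral => //=.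
  - by apply/measurable_EFinP; exact: measurable_exp_quadform.
  - by apply/measurable_EFinP; exact: measurable_exp_quadform.
  - by move=> t _; rewrite lee_fin ler_expR lerN2 ler_pM2l// invr_gt0.
rewrite !lebesgue_int_gaussian// lee_fin ler_sqrt; last first.
  by rewrite divr_ge0 ?exprn_ge0 ?mulr_ge0 ?pi_ge0 ?ltW.
rewrite ler_pM2l ?exprn_gt0 ?mulr_gt0 ?pi_gt0//.
by rewrite lef_pV2.
Qed.

Lemma gauss_const_gt0 k (d : R) : 0 < d -> 0 < Num.sqrt ((2 * pi) ^+ k / d).
Proof. by move=> d0; rewrite sqrtr_gt0 divr_gt0 ?exprn_gt0 ?mulr_gt0 ?pi_gt0. Qed.

Lemma normal_density_precision k (A : 'M[R]_k) m t : A \in unitmx ->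
  normal_density m (invmx A) t =
  (Num.sqrt ((2 * pi) ^+ k / \det A))^-1 * expR (- (2^-1 * quadform A (t - m))).
Proof. by move=> uA; rewrite /normal_density det_inv invmxK [2^-1 * _]mulrC. Qed.

Lemma normal_density_ge0 k (V : 'M[R]_k) m t : 0 <= normal_density m V t.
Proof. by rewrite mulr_ge0 ?expR_ge0// invr_ge0 sqrtr_ge0. Qed.

Lemma measurable_normal_density k (A : 'M[R]_k) m : A \in unitmx ->
  measurable_fun setT (fun t : k.-tuple RB => normal_density m (invmx A) (vec_of_tuple t)).
Proof.
move=> uA; under [X in measurable_fun _ X]eq_fun do rewrite normal_density_precision//.
by apply: measurable_funM => //; exact: measurable_exp_quadform.
Qed.

Lemma lebesgue_int_normal_density k (A : 'M[R]_k) m : psdmx A -> A \in unitmx ->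
  lebesgue_int (fun t => (normal_density m (invmx A) t)%:E) = 1%E.
Proof.
move=> pA uA; have dA := pd_det_gt0 pA uA; have N0 := gauss_const_gt0 k dA.
rewrite lebesgue_intE.
under eq_integral do rewrite normal_density_precision// EFinM.
rewrite ge0_integralZl//=.
- by rewrite [X in (_ * X)%E]lebesgue_int_gaussian// -EFinM mulVf ?gt_eqF.
- by apply/measurable_EFinP; exact: measurable_exp_quadform.
Qed.

Lemma scale_unitmx k (A : 'M[R]_k) a : a != 0 -> A \in unitmx -> a *: A \in unitmx.
Proof. by move=> a0 uA; rewrite unitmxZ// unitfE. Qed.

(** A Gaussian with a nearby centre and a comparable precision is dominated by
    a fixed Gaussian of smaller precision.  The factor [(Num.sqrt 2 * D) ^+ k] is
    the price of the normalising constants and [expR (lam * kap / 2)] that of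
    the shift of the centre. *)
Lemma normal_density_dominated k (F G : 'M[R]_k) (D lam kap : R) m m' t :
    psdmx F -> F \in unitmx -> psdmx G -> G \in unitmx -> 0 < D -> 0 < lam ->
    (forall v, D^-1 * quadform G v <= quadform F v) ->
    (forall v, quadform F v <= D * quadform G v) ->
    quadform G (m - m') <= D * kap ->
  normal_density m (invmx (lam *: F)) t <=
  (Num.sqrt 2 * D) ^+ k * expR (lam * kap / 2) *
    normal_density m' (invmx ((lam / (2 * D)) *: G)) t.
Proof.
move=> pF uF pG uG D0 l0 GF FG mm.
have l1 : 0 < lam / (2 * D) by rewrite divr_gt0 ?mulr_gt0.
rewrite !normal_density_precision; [|exact: scale_unitmx (lt0r_neq0 _) _..].
have uF' := scale_unitmx (lt0r_neq0 l0) uF; have uG' := scale_unitmx (lt0r_neq0 l1) uG.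
have pF' := psdmx_scale (ltW l0) pF; have pG' := psdmx_scale (ltW l1) pG.
have dF := pd_det_gt0 pF' uF'; have dG := pd_det_gt0 pG' uG'.
rewrite mulrACA; apply: ler_pM; rewrite ?expR_ge0 ?invr_ge0 ?sqrtr_ge0//.
  have -> : (Num.sqrt 2 * D) ^+ k = Num.sqrt ((2 * D ^+ 2) ^+ k).
    have -> : 2 * D ^+ 2 = (Num.sqrt 2 * D) ^+ 2 by rewrite exprMn sqr_sqrtr.
    by rewrite exprAC sqrtr_sqr ger0_norm// exprn_ge0// mulr_ge0 ?sqrtr_ge0 ?ltW.
  have sV (x : R) : 0 < x -> (Num.sqrt x)^-1 = Num.sqrt x^-1 by move=> x0; rewrite sqrtrV// ltW.
  have P0 : 0 < (2 * pi) ^+ k :> R by rewrite exprn_gt0// mulr_gt0 ?pi_gt0.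
  rewrite !sV ?divr_gt0// !invf_div -sqrtrM; last first.
    by rewrite exprn_ge0// mulr_ge0 ?sqr_ge0.
  rewrite ler_sqrt; last first.
    by rewrite mulr_ge0 ?divr_ge0 ?(ltW P0) ?(ltW dG)// exprn_ge0// mulr_ge0 ?sqr_ge0.
  rewrite mulrA ler_pM2r ?invr_gt0//.
  have -> : (2 * D ^+ 2) ^+ k * \det ((lam / (2 * D)) *: G) = \det ((lam * D) *: G).
    rewrite !detZ mulrA -exprMn; congr (_ ^+ k * _); field; exact: lt0r_neq0.
  have lD : 0 < lam * D by rewrite mulr_gt0.
  apply: det_le => //; [exact: psdmx_scale (ltW lD) pG|exact: scale_unitmx (lt0r_neq0 lD) uG|].
  by move=> v; rewrite !quadform_scale -mulrA ler_pM2l.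
rewrite -expRD ler_expR !quadform_scale.
have H1 := GF (t - m); have H2 := quadform_half (t - m') (m - m') pG.
have E : t - m' - (m - m') = t - m by rewrite opprB addrA subrK.
rewrite E in H2; move: (quadform F (t - m)) (quadform G (t - m)) (quadform G (t - m'))
  (quadform G (m - m')) mm H1 H2 => f g g' h mm H1 H2.
have : lam * (D^-1 * (g' / 2 - h)) <= lam * f.
  rewrite ler_pM2l//; apply: le_trans H1; rewrite ler_pM2l// invr_gt0//.
have : lam * (D^-1 * h) <= lam * kap by rewrite ler_pM2l// ler_pdivrMl.
have -> : lam / (2 * D) * g' = lam * (D^-1 * (g' / 2)) by field; exact: lt0r_neq0.
rewrite mulrBr mulrBr; move: (lam * (D^-1 * _)) (lam * (D^-1 * _)) (lam * f) (lam * kap).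
by move=> x y z w; lra.
Qed.

(** Without the truncation the integral is the square root of a ratio of two
    determinants.  The truncation costs at most half of it: outside the
    ellipsoid half of the exponent is larger than [2 * k], and the Gaussian
    integral with the other half is [Num.sqrt (2 ^+ k)] times larger. *)
Lemma restricted_gaussian_mass k (A : 'M[R]_k) m (lam beta : R) :
    psdmx A -> A \in unitmx -> (0 < k)%N -> 0 < lam -> 0 < beta ->
  ((2^-1 * Num.sqrt ((lam / (lam + 2 * beta)) ^+ k))%:E <=
   lebesgue_int (fun t => (normal_density m (invmx (lam *: A)) t *
     (if quadform A (t - m) <= 4 * k%:R / beta
      then expR (- (beta * quadform A (t - m))) else 0))%:E))%E.
Proof.
move=> pA uA k0 l0 b0.
pose c := lam / 2 + beta.
have c0 : 0 < c by rewrite addr_gt0// divr_gt0.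
pose r := 4 * k%:R / beta.
pose I := Num.sqrt ((2 * pi) ^+ k / \det ((2 * c) *: A)).
have dA := pd_det_gt0 pA uA.
have cc0 : 0 < 2 * c by rewrite mulr_gt0.
have E1 : lebesgue_int (fun t => (expR (- (c * quadform A (t - m))))%:E) = I%:E.
  rewrite -(lebesgue_int_gaussian m (psdmx_scale (ltW cc0) pA) (scale_unitmx (lt0r_neq0 cc0) uA)).
  apply: eq_integral => t _; congr (expR _)%:E; rewrite quadform_scale; lra.
have E2 : lebesgue_int (fun t => (expR (- (c / 2 * quadform A (t - m))))%:E) =
    (Num.sqrt (2 ^+ k) * I)%:E.
  rewrite /I -sqrtrM ?exprn_ge0// !detZ.
  have -> : 2 ^+ k * ((2 * pi) ^+ k / ((2 * c) ^+ k * \det A)) = (2 * pi) ^+ k / \det (c *: A).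
    rewrite detZ [(2 * c) ^+ k]exprMn; field.
    by rewrite !expf_neq0 ?pnatr_eq0 ?lt0r_neq0.
  rewrite -(lebesgue_int_gaussian m (psdmx_scale (ltW c0) pA) (scale_unitmx (lt0r_neq0 c0) uA)).
  apply: eq_integral => t _; congr (expR _)%:E; rewrite quadform_scale; lra.
have I0 : 0 < I.
  by apply: gauss_const_gt0; rewrite detZ mulr_gt0// exprn_gt0.
pose trunc (t : 'cV[R]_k) :=
  if quadform A (t - m) <= r then expR (- (c * quadform A (t - m))) else 0.
have mtrunc : measurable_fun setT (fun t : k.-tuple RB => trunc (vec_of_tuple t)).
  apply: measurable_fun_ifT => //; last exact: measurable_exp_quadform.
  by apply: measurable_fun_ler => //; exact: measurable_quadform.
have trunc0 t : 0 <= trunc t by rewrite /trunc; case: ifP => // _; rewrite expR_ge0.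
(* outside the ellipsoid c * quadform is at least 2 * k plus its own half *)
have T1 : (I%:E <= lebesgue_int (fun t => (trunc t)%:E) + (I / 2)%:E)%E.
  apply: (@le_trans _ _ (lebesgue_int (fun t => (trunc t)%:E) +
      (expR (- (2 * k%:R)))%:E * (Num.sqrt (2 ^+ k) * I)%:E)%E).
    rewrite -E1 -E2 !lebesgue_intE -ge0_integralZl//=; last first.
      by apply/measurable_EFinP; exact: measurable_exp_quadform.
    rewrite -ge0_integralD//=; last 3 first.
    - by move=> t _; rewrite lee_fin.
    - exact/measurable_EFinP.
    - under [X in measurable_fun _ X]eq_fun do rewrite -EFinM.
      by apply/measurable_EFinP; apply: measurable_funM => //; exact: measurable_exp_quadform.
    apply: ge0_le_integral => //=.
    - by apply/measurable_EFinP; exact: measurable_exp_quadform.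
    - under [X in measurable_fun _ X]eq_fun do rewrite -EFinM -EFinD.
      apply/measurable_EFinP; apply: measurable_funD => //.
      by apply: measurable_funM => //; exact: measurable_exp_quadform.
    - move=> t _; rewrite -EFinM -EFinD lee_fin /trunc.
      have [qr|qr] := leP (quadform A (vec_of_tuple t - m)) r.
        by rewrite lerDl mulr_ge0 ?expR_ge0.
      rewrite add0r -expRD ler_expR.
      have : c * r / 2 <= c / 2 * quadform A (vec_of_tuple t - m).
        by rewrite mulrAC ler_pM2l ?divr_gt0// ltW.
      have : 2 * k%:R <= c * r / 2.
        rewrite /r /c; have -> : (lam / 2 + beta) * (4 * k%:R / beta) / 2 =
          2 * k%:R + lam * k%:R / beta by field; exact: lt0r_neq0.
        by rewrite lerDl divr_ge0 ?mulr_ge0 ?(ltW l0) ?(ltW b0).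
      move: (quadform A _) => q; lra.
  apply: leeD2l; rewrite -EFinM lee_fin mulrA mulrC ler_pM2l//.
  have -> : 2 * k%:R = k%:R * 2 :> R by rewrite mulrC.
  rewrite expRN expRM_natl -exprVn -expRN.
  apply: (@le_trans _ _ (expR (- 2) ^+ k * 2 ^+ k)).
    apply: ler_wpM2l; first by rewrite exprn_ge0 ?expR_ge0.
    have h1 : 1 <= 2 ^+ k :> R by apply: exprn_ege1; lra.
    rewrite -[leRHS]ger0_norm ?(le_trans ler01)// -sqrtr_sqr ler_sqrt ?sqr_ge0//.
    by rewrite expr2 ler_peMr// (le_trans ler01).
  rewrite -exprMn.
  have e2 : expR (- 2) * 2 <= 2^-1 :> R.
    have e1 : 2 <= expR 1 :> R by have := expR_ge1Dx (1 : R); rewrite -natr1.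
    have : 4 <= expR 2 :> R.
      have -> : expR 2 = expR 1 * expR 1 :> R by rewrite -expRD.
      by have := ler_pM _ _ e1 e1; rewrite -natrM; apply.
    rewrite expRN => h; rewrite mulrC ler_pdivrMr ?expR_gt0//; lra.
  rewrite -(prednK k0) exprS; apply: (@le_trans _ _ (expR (- 2) * 2 * 1)).
    apply: ler_wpM2l; first by rewrite mulr_ge0 ?expR_ge0.
    by apply: exprn_ile1; [rewrite mulr_ge0 ?expR_ge0|apply: le_trans e2 _; lra].
  by rewrite mulr1.
have {}T1 : ((I / 2)%:E <= lebesgue_int (fun t => (trunc t)%:E))%E.
  by move: T1; rewrite {1}(splitr I) EFinD leeD2rE.
pose N := (Num.sqrt ((2 * pi) ^+ k / \det (lam *: A)))^-1.
have dl : 0 < \det (lam *: A) by rewrite detZ mulr_gt0 ?exprn_gt0.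
have N0 : 0 < N by rewrite invr_gt0 gauss_const_gt0.
have -> : 2^-1 * Num.sqrt ((lam / (lam + 2 * beta)) ^+ k) = N * (I / 2).
  rewrite [RHS]mulrA [RHS]mulrC; congr (_ * _).
  rewrite /N /I -sqrtrV ?divr_ge0 ?exprn_ge0 ?mulr_ge0 ?pi_ge0 ?ltW//.
  rewrite -sqrtrM ?invr_ge0 ?divr_ge0 ?exprn_ge0 ?mulr_ge0 ?pi_ge0 ?ltW//.
  congr Num.sqrt; rewrite !detZ /c.
  have -> : 2 * (lam / 2 + beta) = lam + 2 * beta by field.
  rewrite exprMn exprVn; field.
  by rewrite !expf_neq0 ?pnatr_eq0 ?lt0r_neq0 ?addr_gt0 ?mulr_gt0 ?pi_gt0.
rewrite EFinM; apply: (@le_trans _ _ (N%:E * lebesgue_int (fun t => (trunc t)%:E))%E).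
  by rewrite lee_pmul2l.
rewrite !lebesgue_intE -ge0_integralZl//=; last 3 first.
- exact/measurable_EFinP.
- by move=> t _; rewrite lee_fin.
- by rewrite lee_fin ltW.
rewrite le_eqVlt; apply/orP; left; apply/eqP; apply: eq_integral => t _.
rewrite -EFinM normal_density_precision ?scale_unitmx ?lt0r_neq0// /trunc -/r -/N.
case: ifP => _; last by rewrite !mulr0.
rewrite -mulrA -expRD quadform_scale; congr (_ * expR _)%:E.
by rewrite /c; move: (quadform _ _) => q; lra.
Qed.

End GaussianIntegral.

(** * Moment generating functions of independent observations *)

Section Transfer.
Context {R : realType} {d1 d2 : measure_display}
  {T1 : measurableType d1} {T2 : measurableType d2}.
Variables (m1 : {measure set T1 -> \bar R}) (m2 : {measure set T2 -> \bar R}).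
Variables (Y1 Z1 : T1 -> R) (Y2 Z2 : T2 -> R).
Hypotheses (mY1 : measurable_fun setT Y1) (mZ1 : measurable_fun setT Z1).
Hypotheses (mY2 : measurable_fun setT Y2) (mZ2 : measurable_fun setT Z2).
Hypotheses (Z1_ge0 : forall x, 0 <= Z1 x) (Z2_ge0 : forall x, 0 <= Z2 x).

Import HBNNSimple.

Let sfun_expand d (T : measurableType d) (m : {measure set T -> \bar R})
    (Y Z : T -> R) (g : {nnsfun R >-> R}) :
    measurable_fun setT Y -> measurable_fun setT Z -> (forall x, 0 <= Z x) ->
  (\int[m]_x (Z x * g (Y x))%:E =
   \sum_(r \in range g) (r%:E * \int[m]_x (Z x * \1_(g @^-1` [set r]) (Y x))%:E))%E.
Proof.
move=> mY mZ Z0.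
have mind r : measurable_fun setT (fun x => Z x * \1_(g @^-1` [set r]) (Y x)).
  by apply: measurable_funM => //; apply: measurableT_comp => //; exact: measurable_indic.
under eq_integral => x _.
  rewrite fimfunE EFinM -fsumEFin// ge0_mule_fsumr; last first.
    by move=> r; rewrite lee_fin; exact: nnfun_muleindic_ge0.
  over.
rewrite ge0_integral_fsum//.
- apply: eq_fsbigr => r rg; rewrite -ge0_integralZl//.
  + by apply: eq_integral => x _; rewrite -!EFinM mulrCA.
  + exact/measurable_EFinP.
  + by move=> x _; rewrite lee_fin mulr_ge0.
  + by move: rg; rewrite inE => -[x _ <-]; rewrite lee_fin.
- move=> r; under [X in measurable_fun _ X]eq_fun do rewrite -EFinM mulrCA.
  by apply/measurable_EFinP; apply: measurable_funM.
- by move=> r x _; rewrite mule_ge0 ?lee_fin ?Z0//; exact: nnfun_muleindic_ge0.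
Qed.

(** Two weighted laws that agree on events give all non-negative functions the
    same expectation.  The weights allow one observation at a time to be
    replaced inside a product. *)
Lemma integral_transfer (f : R -> R) :
    (forall B : set R, measurable B ->
      \int[m1]_x (Z1 x * \1_B (Y1 x))%:E = \int[m2]_x (Z2 x * \1_B (Y2 x))%:E)%E ->
    measurable_fun setT f -> (forall y, 0 <= f y) ->
  (\int[m1]_x (Z1 x * f (Y1 x))%:E = \int[m2]_x (Z2 x * f (Y2 x))%:E)%E.
Proof.
move=> H mf f0.
have mEf : measurable_fun setT (EFin \o f) by exact/measurable_EFinP.
have Ef0 y : setT y -> (0 <= (EFin \o f) y)%E by move=> _; rewrite lee_fin.
pose g := nnsfun_approx measurableT mEf.
have lim d (T : measurableType d) (m : {measure set T -> \bar R}) (Y Z : T -> R) :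
    measurable_fun setT Y -> measurable_fun setT Z -> (forall x, 0 <= Z x) ->
    (\int[m]_x (Z x * f (Y x))%:E = limn (fun n => \int[m]_x (Z x * g n (Y x))%:E))%E.
  move=> mY mZ Z0; rewrite -monotone_convergence//.
  - apply: eq_integral => x _; apply/esym/cvg_lim => //.
    under eq_fun do rewrite EFinM.
    rewrite EFinM; apply: cvgeZl => //.
    exact: (cvg_nnsfun_approx measurableT mEf Ef0 (x := Y x) Logic.I).
  - move=> n; apply/measurable_EFinP; apply: measurable_funM => //.
    by apply: measurableT_comp.
  - by move=> n x _; rewrite lee_fin mulr_ge0.
  - move=> x _ a c ac; rewrite lee_fin ler_wpM2l//.
    by have /lefP/(_ (Y x)) := nd_nnsfun_approx measurableT mEf ac.
rewrite (lim _ _ m1 _ _ mY1 mZ1 Z1_ge0) (lim _ _ m2 _ _ mY2 mZ2 Z2_ge0).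
congr (limn _); apply/funext => n.
rewrite !sfun_expand//; apply: eq_fsbigr => r _; rewrite H//.
Qed.

End Transfer.

Section GlmLaw.
Context {R : realType} {d : measure_display} {T : measurableType d} {n : nat}.
Variables (mu : {measure set R -> \bar R}) (b k : R -> R).
Hypothesis mk : measurable_fun setT k.
Hypothesis dens1 : forall eta : R, (\int[mu]_y (glm_density b k eta y)%:E = 1)%E.
Variables (P : probability T R) (Y : 'I_n -> {RV P >-> R}) (eta : 'I_n -> R).
Hypothesis law : forall (i : 'I_n) (B : set R), measurable B ->
  distribution P (Y i) B = (\int[mu]_(y in B) (glm_density b k (eta i) y)%:E)%E.
Hypothesis indep : mutually_independent P (fun i => Y i : T -> R).

Lemma measurable_Y i : measurable_fun setT (Y i : T -> R).
Proof. exact: measurable_funPT. Qed.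

Lemma measurable_glm_density e : measurable_fun setT (glm_density b k e).
Proof.
apply: measurableT_comp => //; apply: measurable_funD => //.
by apply: measurable_funB => //; apply: measurable_funM.
Qed.

(** The tilted density is again a member of the family, up to a constant. *)
Lemma glm_mgf i (u : R) :
  (\int[P]_om (expR (u * Y i om))%:E = (expR (b (eta i + u) - b (eta i)))%:E)%E.
Proof.
transitivity (\int[mu]_y (glm_density b k (eta i) y * expR (u * y))%:E)%E.
  transitivity (\int[P]_om (cst 1 om * expR (u * Y i om))%:E)%E.
    by apply: eq_integral => om _; rewrite mul1r.
  apply: (@integral_transfer R _ _ _ _ P mu (Y i) (cst 1) id
    (glm_density b k (eta i)) _ _ _ _ _ _ (fun y => expR (u * y))) => //.
  - exact: measurable_glm_density.
  - by move=> y; exact: expR_ge0.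
  - move=> B mB; under eq_integral do rewrite mul1r.
    rewrite integral_indic ?setIT//; last first.
      by rewrite -[X in measurable X]setTI; exact: measurable_Y.
    transitivity (\int[mu]_(y in B) (glm_density b k (eta i) y)%:E)%E; first exact: law.
    rewrite [LHS]integral_mkcond; apply: eq_integral => y _.
    by rewrite patchE indicE; case: ifPn; rewrite ?mulr1 ?mulr0.
  - by apply: measurableT_comp => //; exact: measurable_funM.
under eq_integral => y _.
  have -> : glm_density b k (eta i) y * expR (u * y) =
      expR (b (eta i + u) - b (eta i)) * glm_density b k (eta i + u) y.
    by rewrite /glm_density -!expRD; congr expR; ring.
  rewrite EFinM; over.
rewrite ge0_integralZl//; last 2 first.
- by apply/measurable_EFinP; exact: measurable_glm_density.
- by move=> y _; rewrite lee_fin expR_ge0.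
by rewrite dens1 mule1.
Qed.

(** Independence is given for events only.  The functions [f i] replace the
    indicators one index at a time, each step being an instance of
    [integral_transfer] in which the remaining factors are the weight. *)
Lemma expectation_prod_indep (f : 'I_n -> R -> R) (c : 'I_n -> R) :
    (forall i, measurable_fun setT (f i)) -> (forall i y, 0 <= f i y) ->
    (forall i, \int[P]_om (f i (Y i om))%:E = (c i)%:E)%E ->
  (\int[P]_om (\prod_i f i (Y i om))%:E = (\prod_i c i)%:E)%E.
Proof.
move=> mf f0 fc.
have c0 i : 0 <= c i.
  by rewrite -lee_fin -fc; apply: integral_ge0 => om _; rewrite lee_fin.
(* functions on the indices of s, indicators on the others *)
pose g (s : seq 'I_n) (B : 'I_n -> set R) i y := if i \in s then f i y else \1_(B i) y.
pose e (s : seq 'I_n) (B : 'I_n -> set R) i := if i \in s then c i else fine (P (Y i @^-1` B i)).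
have mYB i (B : set R) : measurable B -> measurable (Y i @^-1` B).
  by move=> mB; rewrite -[X in measurable X]setTI; exact: measurable_Y.
have mg s B i : (forall i, measurable (B i)) -> measurable_fun setT (g s B i).
  by move=> mB; rewrite /g; case: (i \in s); [exact: mf|exact: measurable_indic].
have g0 s B i y : 0 <= g s B i y by rewrite /g; case: ifP.
have key s B : uniq s -> (forall i, measurable (B i)) ->
    (\int[P]_om (\prod_i g s B i (Y i om))%:E = (\prod_i e s B i)%:E)%E.
  elim: s B => [|j s IH] B.
    move=> _ mB; rewrite /g /e/=.
    transitivity (P (\bigcap_(i in [set` [set: 'I_n]%SET]) Y i @^-1` B i)).
      rewrite -[X in _ = P X]setIT -integral_indic//; last first.
        by apply: fin_bigcap_measurable => // i _; exact: mYB.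
      apply: eq_integral => om _; congr EFin.
      rewrite [RHS]indicE.
      case: (boolP [forall i, Y i om \in B i]) => [/forallP h|/forallPn [i hi]].
        rewrite big1; last by move=> i _; rewrite indicE h.
        by rewrite mem_set// => i _ /=; have := h i; rewrite inE.
      rewrite (bigD1 i)//= indicE (negbTE hi) mul0r memNset// => /(_ i).
      rewrite /= finset.in_setT => /(_ isT) hB; move: hi; rewrite notin_setE; exact.
    transitivity (\prod_(i in [set: 'I_n]%SET) P (Y i @^-1` B i))%E; first exact: indep.
    rewrite (big_morph EFin (@EFinM R) (erefl 1%:E)); apply: eq_big => [i|i _].
      by rewrite finset.in_setT.
    by rewrite fineK// fin_num_measure//; exact: mYB.
  move=> /= /andP[js us] mB.
  pose C := \prod_(i | i != j) e s B i.
  pose Z om := \prod_(i | i != j) g s B i (Y i om).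
  have gE om : \prod_i g (j :: s) B i (Y i om) = Z om * f j (Y j om).
    rewrite (bigD1 j)//= mulrC; congr (_ * _); last by rewrite /g inE eqxx.
    by apply: eq_bigr => i ij; rewrite /g inE (negbTE ij).
  have mZ : measurable_fun setT Z.
    have -> : Z = fun om => \prod_i (if i != j then g s B i (Y i om) else 1).
      by apply/funext => om; rewrite /Z big_mkcond.
    apply: measurable_prod => i _; case: (i != j) => //.
    by apply: measurableT_comp (measurable_Y i); exact: mg.
  have Z0 om : 0 <= Z om by apply: prodr_ge0.
  have e0 i : 0 <= e s B i by rewrite /e; case: ifP => // _; rewrite fine_ge0.
  have C0 : 0 <= C by apply: prodr_ge0.
  under eq_integral do rewrite gE.
  rewrite (@integral_transfer R _ _ _ _ P P (Y j) Z (Y j) (cst C))//.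
  - under eq_integral do rewrite EFinM.
    rewrite /cst/= ge0_integralZl//=; last 2 first.
    - by apply/measurable_EFinP; apply: measurableT_comp (measurable_Y j).
    - by move=> om _; rewrite lee_fin.
    rewrite fc -EFinM; congr EFin.
    rewrite [RHS](bigD1 j)//= mulrC; congr (_ * _); first by rewrite /e inE eqxx.
    by apply: eq_bigr => i ij; rewrite /e inE (negbTE ij).
  - move=> A mA; pose B' i := if i == j then A else B i.
    have mB' i : measurable (B' i) by rewrite /B'; case: ifP.
    have -> : (\int[P]_x (Z x * \1_A (Y j x))%:E = \int[P]_om (\prod_i g s B' i (Y i om))%:E)%E.
      apply: eq_integral => om _; congr EFin; rewrite [RHS](bigD1 j)//= mulrC.
      congr (_ * _); first by rewrite /g (negbTE js) /B' eqxx.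
      by apply: eq_bigr => i ij; rewrite /g /B' (negbTE ij).
    rewrite IH//.
    under eq_integral do rewrite EFinM.
    rewrite /cst/= ge0_integralZl//=; last first.
      by apply/measurable_EFinP; apply: measurableT_comp (measurable_Y j); exact: measurable_indic.
    rewrite integral_indic ?setIT//; last exact: mYB.
    rewrite (bigD1 j)//= EFinM muleC; congr (_ * _)%E.
      by congr EFin; apply: eq_bigr => i ij; rewrite /e /B' (negbTE ij).
    by rewrite /e (negbTE js) /B' eqxx fineK// fin_num_measure//; exact: mYB.
have := key (enum 'I_n) (fun=> setT) (enum_uniq _) (fun=> measurableT).
rewrite /g /e => {}key.
transitivity (\int[P]_om (\prod_i
    (if i \in enum 'I_n then f i (Y i om) else \1_setT (Y i om)))%:E)%E.
  by apply: eq_integral => om _; congr EFin; apply: eq_bigr => i _; rewrite mem_enum.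
rewrite key; congr EFin; apply: eq_bigr => i _; by rewrite mem_enum.
Qed.

Lemma glm_joint_mgf (u : 'I_n -> R) :
  (\int[P]_om (expR (\sum_i u i * Y i om))%:E =
   (expR (\sum_i (b (eta i + u i) - b (eta i))))%:E)%E.
Proof.
rewrite expR_sum -(@expectation_prod_indep (fun i y => expR (u i * y)))//.
- by apply: eq_integral => om _; rewrite expR_sum.
- by move=> i; apply: measurableT_comp => //; exact: measurable_funM.
- by move=> i; exact: glm_mgf.
Qed.

End GlmLaw.

(** * Likelihood of a generalised linear model *)

Section Supports.
Context {R : realType}.

Lemma linpred_extend n q (X : 'M[R]_(n, q)) (S : {set 'I_q}) t i :
  linpred X (extend t) i = linpred (subcols S X) t i.
Proof.
rewrite /linpred !mxE.
under eq_bigr => j _ do rewrite mxE big_mkcond mulr_sumr.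
rewrite exchange_big; apply: eq_bigr => l _.
rewrite (bigD1 (enum_val l))//= eqxx big1 ?addr0; first by rewrite mxE.
by move=> j; rewrite eq_sym => /negbTE ->; rewrite mulr0.
Qed.

Definition restrict q (S : {set 'I_q}) (t : 'cV[R]_q) : 'cV[R]_#|S| :=
  \col_l t (enum_val l) 0.

Lemma extend_restrict q (t : 'cV[R]_q) : extend (restrict (supp t) t) = t.
Proof.
apply/colP => j; rewrite mxE.
have [js|js] := boolP (j \in supp t).
  rewrite (bigD1 (enum_rank_in js j))/=; last by rewrite enum_rankK_in.
  rewrite mxE enum_rankK_in// big1 ?addr0// => l /andP[/eqP lj /negP[]].
  by apply/eqP/enum_val_inj; rewrite enum_rankK_in.
rewrite big1; first by move: js; rewrite finset.in_set negbK => /eqP.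
by move=> l /eqP lj; move: js; rewrite -lj enum_valP.
Qed.

Lemma linpred_restrict n q (X : 'M[R]_(n, q)) (t : 'cV[R]_q) i :
  linpred (subcols (supp t) X) (restrict (supp t) t) i = linpred X t i.
Proof. by rewrite -linpred_extend extend_restrict. Qed.

Lemma loglik_extend n q b k (X : 'M[R]_(n, q)) (S : {set 'I_q}) y t :
  loglik b k X y (extend t) = loglik b k (subcols S X) y t.
Proof. by apply: eq_bigr => i _; rewrite linpred_extend. Qed.

End Supports.

Section Likelihood.
Context {R : realType} {n q : nat}.
Variables (b b1 b2 k : R -> R) (C : R).
Hypothesis db : forall x : R, is_derive x 1 b (b1 x).
Hypothesis db1 : forall x : R, is_derive x 1 b1 (b2 x).
Hypothesis b2E : derive1n 2 b = b2.
Hypothesis bC : forall x y : R, `|y| <= 2^-1 -> b2 (x + y) <= C * b2 x.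
Hypothesis cb : strictly_convex b.
Hypothesis C1 : 1 <= C.
Variables (X : 'M[R]_(n, q)) (y : 'I_n -> R).
Local Notation L := (loglik b k X y).

Let C0 : 0 < C. Proof. exact: lt_le_trans C1. Qed.
Let b2_ge0' := b2_ge0 db db1 bC cb C1.

(** The derivative of the log-likelihood at [t] in the direction [u]. *)
Definition score t u := \sum_i (y i - b1 (linpred X t i)) * linpred X u i.

Lemma loglikD t u : L (t + u) - L t =
  score t u - \sum_i bregman b b1 (linpred X t i) (linpred X u i).
Proof.
rewrite /loglik /score -!sumrB; apply: eq_bigr => i _.
by rewrite linpredD /bregman; ring.
Qed.

Lemma quadform_fisherE t v :
  quadform (fisher b X t) v = \sum_i b2 (linpred X t i) * linpred X v i ^+ 2.
Proof. by rewrite quadform_fisher b2E. Qed.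

Lemma fisher_psd t : psdmx (fisher b X t).
Proof. by apply: psdmx_fisher => x; rewrite b2E. Qed.

Lemma loglik_le_quadratic t u : (forall i, `|linpred X u i| <= 2^-1) ->
  L (t + u) - L t <= score t u - C^-1 * quadform (fisher b X t) u / 2.
Proof.
move=> hu; rewrite loglikD lerD2l lerN2 quadform_fisherE mulr_sumr mulr_suml.
by apply: ler_sum => i _; rewrite mulrA (bregman_ge db db1 bC).
Qed.

Lemma loglik_ge_quadratic t u : (forall i, `|linpred X u i| <= 2^-1) ->
  score t u - C * quadform (fisher b X t) u / 2 <= L (t + u) - L t.
Proof.
move=> hu; rewrite loglikD lerD2l lerN2 quadform_fisherE mulr_sumr mulr_suml.
by apply: ler_sum => i _; rewrite mulrA (bregman_le db db1 bC).
Qed.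

Lemma loglik_concave t u a : 0 <= a <= 1 -> L t <= L (t + u) ->
  L t <= L (t + a *: u).
Proof.
move=> a01 tu; have : a * L (t + u) + (1 - a) * L t <= L (t + a *: u).
  rewrite /loglik !mulr_sumr -big_split/=; apply: ler_sum => i _.
  rewrite !linpredD linpredZ.
  have := convex_le cb (linpred X t i + linpred X u i) (linpred X t i) a01.
  have -> : a * (linpred X t i + linpred X u i) + (1 - a) * linpred X t i =
    linpred X t i + a * linpred X u i by ring.
  move: (b _) (b _) (b _) (k _) => x z w kk; lra.
have /andP[a0 a1] := a01.
have : a * L t <= a * L (t + u) by rewrite ler_wpM2l.
move: (L _) (L _) (L _) tu => x z w; lra.
Qed.

Lemma fisher_comparable t u v : (forall i, `|linpred X u i| <= 2^-1) ->
  quadform (fisher b X t) v <= C * quadform (fisher b X (t + u)) v.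
Proof.
move=> hu; rewrite [leLHS]quadform_fisherE [X in _ <= _ * X]quadform_fisherE.
rewrite mulr_sumr; apply: ler_sum => i _.
rewrite linpredD [leRHS]mulrA ler_wpM2r ?sqr_ge0//.
exact: b2_comparable.
Qed.

(** If the maximiser were outside the ellipsoid, concavity would give a point of its
    boundary where the log-likelihood is no lower than at the centre; the
    quadratic upper bound, which is available there, excludes this. *)
Lemma mle_in_ellipsoid t u (z s r : R) :
    L t <= L (t + u) ->
    (forall v, score t v <= s * Num.sqrt (quadform (fisher b X t) v)) ->
    (forall v i, linpred X v i ^+ 2 <= z ^+ 2 * quadform (fisher b X t) v) ->
    0 <= z -> 0 < r -> z * r <= 2^-1 -> 2 * C * s < r ->
  quadform (fisher b X t) u <= r ^+ 2.
Proof.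
move=> tu hs hz z0 r0 zr sr; rewrite leNgt; apply/negP => qr.
set Q := quadform _ u in qr.
have Q0 : 0 < Q by apply: le_lt_trans qr; exact: sqr_ge0.
have sQ0 : 0 < Num.sqrt Q by rewrite sqrtr_gt0.
have rQ : r < Num.sqrt Q.
  by rewrite -[r]ger0_norm ?ltW// -sqrtr_sqr ltr_sqrt.
pose a := r / Num.sqrt Q.
have a01 : 0 <= a <= 1.
  by rewrite divr_ge0 ?(ltW r0) ?sqrtr_ge0//= ler_pdivrMr// mul1r ltW.
(* a *: u is where the segment to the maximiser leaves the ellipsoid *)
have Qv : quadform (fisher b X t) (a *: u) = r ^+ 2.
  by rewrite quadformZ -/Q /a exprMn exprVn sqr_sqrtr ?(ltW Q0)// divfK// gt_eqF.
have hv i : `|linpred X (a *: u) i| <= 2^-1.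
  apply: le_trans zr; rewrite -ler_sqr ?nnegrE ?mulr_ge0 ?(ltW r0)//.
  by rewrite real_normK ?num_real// exprMn -Qv.
have := loglik_le_quadratic t hv; rewrite Qv.
have := hs (a *: u); rewrite Qv sqrtr_sqr ger0_norm ?(ltW r0)//.
have := loglik_concave a01 tu.
have : r * (2 * C * s) < r * r by rewrite ltr_pM2l.
have -> : r * (2 * C * s) = 2 * (C * (s * r)) by ring.
move=> h1 h2 h3 h4.
have h5 : C^-1 * r ^+ 2 / 2 <= s * r by move: (L _) (L _) h2 h4 => ? ? ? ?; lra.
have : C * (C^-1 * r ^+ 2 / 2) <= C * (s * r) by rewrite ler_pM2l.
have -> : C * (C^-1 * r ^+ 2 / 2) = r ^+ 2 / 2 by field; exact: lt0r_neq0.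
by rewrite expr2; move: (r * r) (C * _) h1 => ? ? ? ?; lra.
Qed.

(** The score at the maximiser need not be known to vanish: comparing with the
    point [t - u] bounds it by the quadratic term. *)
Lemma loglik_near_mle t u : (forall t', L t' <= L t) ->
    (forall i, `|linpred X u i| <= 2^-1) ->
  L t - C * quadform (fisher b X t) u <= L (t + u).
Proof.
move=> ht hu.
have hNu i : `|linpred X (- u) i| <= 2^-1 by rewrite linpredN normrN.
have := loglik_ge_quadratic t hNu; have := loglik_ge_quadratic t hu; have := ht (t - u).
rewrite quadformN.
have -> : score t (- u) = - score t u.
  by rewrite /score -sumrN; apply: eq_bigr => i _; rewrite linpredN mulrN.
move: (score t u) (L (t - u)) (L t) (L (t + u)) (C * _) => ? ? ? ? ?; lra.
Qed.

Lemma score_sum t (I : finType) (c : I -> R) (V : I -> 'cV[R]_q) :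
  score t (\sum_j c j *: V j) = \sum_j c j * score t (V j).
Proof.
rewrite /score; under [RHS]eq_bigr do rewrite mulr_sumr.
rewrite exchange_big/=; apply: eq_bigr => i _.
rewrite /linpred mulmx_sumr summxE mulr_sumr; apply: eq_bigr => j _.
by rewrite (linpredZ X (c j) (V j) i : (X *m _) i 0 = _) /linpred; ring.
Qed.

(** The columns of [F ^ (- 1 / 2)], an orthonormal basis for the form [F]. *)
Definition fisher_frame t j := col j (invmx (sqrtmx (fisher b X t))).

Lemma quadform_frame t j : fisher b X t \in unitmx ->
  quadform (fisher b X t) (fisher_frame t j) = 1.
Proof.
move=> uF; rewrite -norm2_sqrtmx; last exact: fisher_psd.
rewrite /fisher_frame colE mulmxA mulmxV ?mul1mx ?sqrtmx_unit//; last exact: fisher_psd.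
rewrite norm2_sq dotE (bigD1 j)//= !mxE eqxx mulr1 big1 ?addr0// => i ij.
by rewrite !mxE (negbTE ij) mul0r.
Qed.

(** Expanding [v] in the frame reduces a supremum over directions to [q] scalar
    bounds, at the cost of a factor [Num.sqrt q%:R]. *)
Lemma score_le_frame t (s : R) : fisher b X t \in unitmx -> 0 <= s ->
    (forall j, `|score t (fisher_frame t j)| <= s) ->
  forall v, score t v <= s * Num.sqrt q%:R * Num.sqrt (quadform (fisher b X t) v).
Proof.
move=> uF s0 hs v; have pF := fisher_psd t; set B := sqrtmx (fisher b X t).
pose c := B *m v.
have vE : v = \sum_j c j 0 *: fisher_frame t j.
  rewrite -[LHS](mulKmx (sqrtmx_unit pF uF)) -/B -/c.
  apply/colP => i; rewrite mxE summxE; apply: eq_bigr => j _.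
  by rewrite !mxE mulrC.
rewrite {1}vE score_sum -norm2_sqrtmx// -/B -/c.
have cE : norm2 c ^+ 2 = \sum_j `|c j 0| ^+ 2.
  by rewrite norm2_sq dotE; apply: eq_bigr => j _; rewrite real_normK ?num_real.
have := @cauchy_schwarz_sum R 'I_q (fun j => `|c j 0|) (fun=> 1).
rewrite -cE; under [X in X ^+ 2 <= _]eq_bigr do rewrite mulr1.
under [X in _ <= _ * X]eq_bigr do rewrite expr1n.
rewrite sumr_const card_ord => cs.
have {}cs : \sum_j `|c j 0| <= Num.sqrt q%:R * norm2 c.
  rewrite -ler_sqr ?nnegrE ?sumr_ge0 ?mulr_ge0 ?sqrtr_ge0//.
  by rewrite exprMn sqr_sqrtr// mulrC.
apply: (@le_trans _ _ (\sum_j `|c j 0| * s)).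
  apply: ler_sum => j _; apply: le_trans (ler_norm _) _.
  by rewrite normrM ler_wpM2l.
rewrite -mulr_suml mulrC -mulrA ler_wpM2l// sqrtr_sqr ger0_norm ?norm2_ge0//.
Qed.

End Likelihood.

(** * Expected likelihood and tails of the score *)

Section GlmMoments.
Context {R : realType} {d : measure_display} {T : measurableType d} {n : nat}.
Variables (mu : {measure set R -> \bar R}) (b b1 b2 k : R -> R) (C : R).
Hypothesis mk : measurable_fun setT k.
Hypothesis dens1 : forall eta : R, (\int[mu]_y (glm_density b k eta y)%:E = 1)%E.
Hypothesis db : forall x : R, is_derive x 1 b (b1 x).
Hypothesis db1 : forall x : R, is_derive x 1 b1 (b2 x).
Hypothesis b2E : derive1n 2 b = b2.
Hypothesis bC : forall x y : R, `|y| <= 2^-1 -> b2 (x + y) <= C * b2 x.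
Hypothesis cb : strictly_convex b.
Hypothesis C1 : 1 <= C.
Variables (P : probability T R) (Y : 'I_n -> {RV P >-> R}) (eta : 'I_n -> R).
Hypothesis law : forall (i : 'I_n) (B : set R), measurable B ->
  distribution P (Y i) B = (\int[mu]_(y in B) (glm_density b k (eta i) y)%:E)%E.
Hypothesis indep : mutually_independent P (fun i => Y i : T -> R).

Let mgfE i u := glm_mgf mk dens1 law i u.
Let joint_mgfE u := glm_joint_mgf mk dens1 law indep u.
Let mY i := measurable_Y Y i.

Lemma measurable_exp_affine i (u c : R) :
  measurable_fun setT (fun om => expR (u * Y i om - c)).
Proof.
apply: measurableT_comp => //; apply: measurable_funB => //.
exact: measurable_funM.
Qed.

Lemma integral_exp_affine i (u c : R) :
  (\int[P]_om (expR (u * Y i om - c))%:E = (expR (b (eta i + u) - b (eta i) - c))%:E)%E.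
Proof.
under eq_integral do rewrite expRD mulrC EFinM.
rewrite ge0_integralZl//=.
- by rewrite mgfE -EFinM -expRD addrC.
- by apply/measurable_EFinP; apply: measurableT_comp => //; exact: measurable_funM.
Qed.

Lemma integrable_exp_affine i (u c : R) :
  P.-integrable setT (fun om => (expR (u * Y i om - c))%:E).
Proof.
apply/integrableP; split; first by apply/measurable_EFinP; exact: measurable_exp_affine.
under eq_integral do rewrite gee0_abs ?lee_fin ?expR_ge0//.
by rewrite integral_exp_affine ltry.
Qed.

Lemma integrable_Y i : P.-integrable setT (fun om => (Y i om)%:E).
Proof.
apply: (@le_integrable _ _ _ _ _ _ _
  (fun om => ((expR (1 * Y i om - 0))%:E + (expR (-1 * Y i om - 0))%:E)%E)) => //.
- exact/measurable_EFinP.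
- move=> om _; rewrite -EFinD lee_fin [leRHS]ger0_norm ?addr_ge0 ?expR_ge0// !subr0 mul1r mulN1r.
  have := expR_ge1Dx (Y i om); have := expR_ge1Dx (- Y i om).
  have := expR_ge0 (Y i om); have := expR_ge0 (- Y i om).
  by case: (ger0P (Y i om)) => _; lra.
- by apply: integrableD => //; exact: integrable_exp_affine.
Qed.

Definition mean i := fine (\int[P]_om (Y i om)%:E).

Lemma meanE i : (\int[P]_om (Y i om)%:E = (mean i)%:E)%E.
Proof.
rewrite /mean fineK//; apply: integrable_fin_num => //; exact: integrable_Y.
Qed.

Lemma integral_probability_cst (r : R) : (\int[P]_om r%:E = r%:E)%E.
Proof. by have := expectation_cst P r; rewrite unlock. Qed.

(** Integrate the inequality [1 + x <= expR x] at [x = h * Y i - c], with [c] the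
    cumulant that makes the right-hand side integrate to one. *)
Lemma mean_le i (h : R) : mean i * h <= b (eta i + h) - b (eta i).
Proof.
set c := b (eta i + h) - b (eta i).
have i1 : P.-integrable setT (fun om => (h * Y i om)%:E).
  under eq_fun do rewrite EFinM.
  by apply: integrableZl => //; exact: integrable_Y.
have i2 : P.-integrable setT (fun _ : T => (1 - c)%:E).
  by apply/finite_measure_integrable_cst.
have : (\int[P]_om ((h * Y i om)%:E + (1 - c)%:E) <=
        \int[P]_om (expR (h * Y i om - c))%:E)%E.
  apply: le_integral => //; first exact: integrableD.
    exact: integrable_exp_affine.
  move=> om _; rewrite -EFinD lee_fin.
  by have := expR_ge1Dx (h * Y i om - c); move: (expR _) => E; lra.
rewrite integral_exp_affine -/c subrr expR0 integralD//.
rewrite (_ : \int[P]_x (h * Y i x)%:E = (h * mean i)%:E)%E; last first.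
  under eq_integral do rewrite EFinM.
  by rewrite integralZl//; [rewrite meanE|exact: integrable_Y].
rewrite integral_probability_cst -EFinD lee_fin; lra.
Qed.

Lemma mean_lt i (h : R) : h != 0 -> mean i * h < b (eta i + h) - b (eta i).
Proof.
move=> h0; have := mean_le i (h / 2).
have := @cb (eta i + h) (eta i) 2^-1.
have -> : 2^-1 * (eta i + h) + (1 - 2^-1) * eta i = eta i + h / 2 by field.
have -> : eta i + h != eta i by apply/eqP => /eqP; rewrite addrC -subr_eq0 addrK; exact/negP.
have -> : 0 < 2^-1 :> R by rewrite invr_gt0.
have -> : 2^-1 < 1 :> R by lra.
move=> /(_ isT isT isT).
move: (b _) (b _) (b _) (mean i) => x z w m; lra.
Qed.

Hypothesis intk : forall i, P.-integrable setT (fun om => (k (Y i om))%:E).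

Lemma expectation_loglik q (X : 'M[R]_(n, q)) t :
  ('E_P[fun om => loglik b k X (Y ^~ om) t] =
   (\sum_i (mean i * linpred X t i - b (linpred X t i) +
     fine (\int[P]_om (k (Y i om))%:E)))%:E)%E.
Proof.
rewrite unlock /=.
under eq_integral do rewrite /loglik -sumEFin.
have i1 i : P.-integrable setT (fun om => (linpred X t i * Y i om)%:E).
  under eq_fun do rewrite EFinM.
  by apply: integrableZl => //; exact: integrable_Y.
have i2 i : P.-integrable setT (fun _ : T => (- b (linpred X t i))%:E).
  by apply/finite_measure_integrable_cst.
have i12 i := integrableD measurableT (i1 i) (i2 i).
have e i om : (Y i om * linpred X t i - b (linpred X t i) + k (Y i om))%:E =
  ((linpred X t i * Y i om)%:E + (- b (linpred X t i))%:E + (k (Y i om))%:E)%E.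
  by rewrite -!EFinD mulrC.
under eq_integral do under eq_bigr do rewrite e.
rewrite integral_sum//; last by move=> i; exact: integrableD.
rewrite -sumEFin; apply: eq_bigr => i _.
rewrite integralD// integralD// integral_probability_cst.
rewrite [X in (X + _ + _)%E](_ : _ = (linpred X t i * mean i)%:E); last first.
  under eq_integral do rewrite EFinM.
  by rewrite integralZl//; [rewrite meanE|exact: integrable_Y].
rewrite -[X in (_ + X)%E]fineK; last exact: integrable_fin_num.
by rewrite -!EFinD mulrC.
Qed.

(** The true parameter, restricted to its support, maximises each summand of the
    expected log-likelihood, and by strict convexity a summand is maximal only
    at the true linear predictor.  The maximiser itself need not be unique. *)
Lemma expected_mle_linpred q (X : 'M[R]_(n, q)) (theta : 'cV[R]_q) :
    (forall i, eta i = linpred X theta i) ->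
  forall i, linpred (subcols (supp theta) X)
    (expected_mle P (fun i => Y i : T -> R) b k X (supp theta)) i = eta i.
Proof.
move=> etaE; set S := supp theta; set XS := subcols S X.
set ts := expected_mle _ _ _ _ _ _.
pose f (t : 'cV[R]_#|S|) := ('E_P[fun om => loglik b k XS (Y ^~ om) t])%E.
pose g (t : 'cV[R]_#|S|) i := mean i * linpred XS t i - b (linpred XS t i).
have fE t : f t = (\sum_i (g t i + fine (\int[P]_om (k (Y i om))%:E)))%:E.
  exact: expectation_loglik.
pose t0 := restrict S theta.
have t0E i : linpred XS t0 i = eta i by rewrite linpred_restrict etaE.
have gle t i : g t i <= g t0 i ?= iff (linpred XS t i == eta i).
  apply/leifP; rewrite /g t0E; case: eqVneq => [->//|ne].
  have := @mean_lt i (linpred XS t i - eta i); rewrite subr_eq0 => /(_ ne).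
  rewrite [eta i + (_ - _)]addrC subrK mulrBr; lra.
have t0max : argmax_set f t0.
  move=> t; rewrite !fE lee_fin; apply: ler_sum => i _; rewrite lerD2r.
  exact: gle.
have : argmax_set f ts by exact: (@xgetPex _ 0 _ (ex_intro _ t0 t0max)).
move=> /(_ t0); rewrite !fE lee_fin => h i.
have gs : forall i, true -> g ts i <= g t0 i ?= iff (linpred XS ts i == eta i).
  by move=> j _; exact: gle.
have [_ E] := leif_sum gs.
have /forallP/(_ i)/= /eqP // : [forall (j | true), linpred XS ts j == eta j].
rewrite -E eq_le; apply/andP; split.
  by apply: ler_sum => j _; exact: gle.
by move: h; rewrite !big_split/= lerD2r.
Qed.

(** Chernoff's bound: the cumulant function of the score is a sum of Bregman
    divergences of [b], hence at most quadratic for small [tau]. *)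
Lemma chernoff_score (v : 'I_n -> R) (tau a : R) :
    0 < tau -> (forall i, `|tau * v i| <= 2^-1) -> \sum_i b2 (eta i) * v i ^+ 2 = 1 ->
  (P [set om | a <= \sum_i v i * (Y i om - b1 (eta i))]%R <=
   (expR (C * tau ^+ 2 / 2 - tau * a))%:E)%E.
Proof.
move=> tau0 hv v1; set A := [set om | _].
pose S om := \sum_i v i * (Y i om - b1 (eta i)).
have mS : measurable_fun setT S.
  apply: measurable_sum => i; apply: measurable_funM => //.
  by apply: measurable_funB.
have mA : measurable A.
  by rewrite -[A]setTI; apply: measurable_fun_le => //; exact: measurable_cst.
pose c := \sum_i tau * v i * b1 (eta i) + tau * a.
have SE om : tau * (S om - a) = \sum_i (tau * v i) * Y i om - c.
  rewrite /S /c mulrBr mulr_sumr opprD addrA -sumrB; congr (_ - _).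
  by apply: eq_bigr => i _; ring.
have mE : measurable_fun setT (fun om => expR (tau * (S om - a))).
  apply: measurableT_comp => //; apply: measurable_funM => //.
  exact: measurable_funB.
rewrite -[P A]mul1e -[A]setIT -integral_indic//.
apply: (@le_trans _ _ (\int[P]_om (expR (tau * (S om - a)))%:E)%E).
  rewrite mul1e; apply: ge0_le_integral => //.
  - exact/measurable_EFinP/measurable_indic.
  - exact/measurable_EFinP.
  - move=> om _; rewrite lee_fin indicE; case: (boolP (om \in A)) => [|_]; last exact: expR_ge0.
    rewrite inE /A/= -/(S om) => h; apply: le_trans (expR_ge1Dx _).
    by rewrite lerDl mulr_ge0 ?subr_ge0// ltW.
under eq_integral do rewrite SE expRD mulrC EFinM.
rewrite ge0_integralZl//=; last first.
  apply/measurable_EFinP; apply: measurableT_comp => //.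
  by apply: measurable_sum => i; exact: measurable_funM.
rewrite joint_mgfE -EFinM -expRD lee_fin ler_expR.
rewrite (_ : - c + _ = \sum_i (b (eta i + tau * v i) - b (eta i)) -
  \sum_i tau * v i * b1 (eta i) - tau * a); last by rewrite /c; ring.
rewrite lerD2r -sumrB.
apply: (@le_trans _ _ (\sum_i C * b2 (eta i) * (tau * v i) ^+ 2 / 2)).
  apply: ler_sum => i _.
  have := bregman_le db db1 bC (eta i) (hv i); rewrite /bregman; lra.
have -> : \sum_i C * b2 (eta i) * (tau * v i) ^+ 2 / 2 =
    C * tau ^+ 2 / 2 * \sum_i b2 (eta i) * v i ^+ 2.
  by rewrite mulr_sumr; apply: eq_bigr => i _; rewrite exprMn; ring.
by rewrite v1 mulr1.
Qed.

End GlmMoments.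

(** * Fractional posteriors and model weights *)

Section NonMeasurable.
Context {R : realType}.

(** The posterior mass is not known to be a measurable function of the data: the
    estimators are chosen among maximisers without any regularity.  Integrals of
    non-negative functions are lower integrals, which remain monotone. *)
Lemma le_lower_integral d (T : measurableType d) (m : {measure set T -> \bar R})
    (f g : T -> \bar R) :
  (forall x, 0 <= f x)%E -> (forall x, f x <= g x)%E ->
  (\int[m]_x f x <= \int[m]_x g x)%E.
Proof.
move=> f0 fg; have g0 x : (0 <= g x)%E by exact: le_trans (fg x).
rewrite !ge0_integralTE//; apply: le_ereal_sup => _ [h hf <-].
by exists h => // x; exact: le_trans (fg x).
Qed.

Lemma le_lebesgue_int k (f g : 'cV[R]_k -> \bar R) :
  (forall x, 0 <= f x)%E -> (forall x, f x <= g x)%E ->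
  (lebesgue_int f <= lebesgue_int g)%E.
Proof. by move=> f0 fg; apply: le_lower_integral. Qed.

Lemma lebesgue_int_ge0 k (f : 'cV[R]_k -> \bar R) :
  (forall x, 0 <= f x)%E -> (0 <= lebesgue_int f)%E.
Proof. by move=> f0; apply: integral_ge0. Qed.

Lemma probability_bigU d (T : measurableType d) (P : probability T R) (I : eqType)
    (s : seq I) (A : I -> set T) (c : R) :
  (forall i, measurable (A i)) -> (forall i, P (A i) <= c%:E)%E ->
  (P (\big[setU/set0]_(i <- s) A i) <= ((size s)%:R * c)%:E)%E.
Proof.
move=> mA Ac; elim: s => [|i s IH]; first by rewrite big_nil measure0 mul0r.
rewrite big_cons; apply: le_trans (measureU2 _ _ _) _ => //.
  exact: bigsetU_measurable.
by rewrite /= -natr1 mulrDl mul1r addrC EFinD leeD.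
Qed.

End NonMeasurable.

Section Posterior.
Context {R : realType} {n p : nat}.
Variables (b k : R -> R) (X : 'M[R]_(n, p)) (y : 'I_n -> R).
Variables (smax : nat) (w : nat -> R) (lam alpha : R).
Hypothesis w0 : forall s, (s <= smax)%N -> 0 <= w s.
Local Notation pint := (prior_int b k X y smax w lam).

Lemma model_prior_ge0 (S : {set 'I_p}) : (#|S| <= smax)%N -> 0 <= model_prior w S.
Proof. by move=> hS; rewrite divr_ge0 ?w0. Qed.

Lemma slab_ge0 S t : 0 <= slab b k X y lam S t.
Proof. exact: normal_density_ge0. Qed.

Lemma le_prior_int f g : (forall t, 0 <= f t)%E -> (forall t, f t <= g t)%E ->
  (pint f <= pint g)%E.
Proof.
move=> f0 fg; apply: lee_sum => S hS; apply: lee_wpmul2l.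
  by rewrite lee_fin model_prior_ge0.
apply: le_lebesgue_int => t; first by rewrite mule_ge0 ?lee_fin ?slab_ge0.
by rewrite lee_wpmul2r ?lee_fin ?slab_ge0.
Qed.

Lemma prior_int_ge0 f : (forall t, 0 <= f t)%E -> (0 <= pint f)%E.
Proof.
move=> f0; apply: sume_ge0 => S hS; rewrite mule_ge0 ?lee_fin ?model_prior_ge0//.
by apply: lebesgue_int_ge0 => t; rewrite mule_ge0 ?lee_fin ?slab_ge0.
Qed.

Let num A := pint (fun t => (\1_A t * expR (alpha * loglik b k X y t))%:E).
Let den := pint (fun t => (expR (alpha * loglik b k X y t))%:E).

Let num0 A : (0 <= num A)%E.
Proof. by apply: prior_int_ge0 => t; rewrite lee_fin mulr_ge0 ?expR_ge0. Qed.

Let den0 : (0 <= den)%E.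
Proof. by apply: prior_int_ge0 => t; rewrite lee_fin expR_ge0. Qed.

Let num_den A : (num A <= den)%E.
Proof.
apply: le_prior_int => t; first by rewrite lee_fin mulr_ge0 ?expR_ge0.
by rewrite lee_fin ler_piMl ?expR_ge0//.
Qed.

Lemma frac_posterior_ge0 A : 0 <= frac_posterior b k X y smax w lam alpha A.
Proof.
by rewrite /frac_posterior; apply: divr_ge0; apply: fine_ge0; [exact: num0|exact: den0].
Qed.

Lemma frac_posterior_le1 A : frac_posterior b k X y smax w lam alpha A <= 1.
Proof.
rewrite /frac_posterior -/(num A) -/den.
have [->|dn] := eqVneq den +oo%E; first by rewrite invr0 mulr0.
have df : den \is a fin_num by rewrite ge0_fin_numE// ltey.
have [->|d0] := eqVneq (fine den) 0; first by rewrite invr0 mulr0.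
rewrite ler_pdivrMr ?mul1r; last by rewrite lt_def d0 fine_ge0.
by apply: fine_le => //; rewrite ge0_fin_numE//; apply: le_lt_trans (num_den A) _; rewrite ltey.
Qed.

(** When the normalising constant is infinite its real part is 0 by convention, and
    so is the posterior mass. *)
Lemma frac_posterior_le A (N : \bar R) (dl : R) : 0 < dl ->
    (num A <= N)%E -> (dl%:E <= den)%E ->
  ((frac_posterior b k X y smax w lam alpha A)%:E <= (dl^-1)%:E * N)%E.
Proof.
move=> dl0 nN dd; have N0 : (0 <= N)%E := le_trans (num0 A) nN.
rewrite /frac_posterior -/(num A) -/den.
have [->|dn] := eqVneq den +oo%E.
  by rewrite invr0 mulr0 mule_ge0// lee_fin invr_ge0 ltW.
have df : den \is a fin_num by rewrite ge0_fin_numE// ltey.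
have fd : dl <= fine den by rewrite -lee_fin fineK.
have nf : num A \is a fin_num.
  by rewrite ge0_fin_numE//; apply: le_lt_trans (num_den A) _; rewrite ltey.
rewrite mulrC EFinM fineK//; apply: lee_pmul => //.
  by rewrite lee_fin invr_ge0 fine_ge0.
by rewrite lee_fin lef_pV2// posrE// (lt_le_trans dl0).
Qed.

End Posterior.

Section ModelPrior.
Context {R : realType} {p : nat}.
Variables (smax : nat) (w : nat -> R) (rho kap : R).
Hypothesis w0 : forall s, (s <= smax)%N -> 0 <= w s.
Hypothesis rho0 : 0 <= rho.
Hypothesis kap0 : 0 <= kap.
Hypothesis rk : rho * kap <= 2^-1.
Hypothesis wr : forall s, (1 <= s <= smax)%N -> w s <= rho * w s.-1.

Lemma weight_geometric s : (s <= smax)%N -> w s * kap ^+ s <= w 0 * 2^-1 ^+ s.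
Proof.
elim: s => [|s IH] hs; first by rewrite !expr0.
have ws := w0 (ltnW hs); have h := wr (s := s.+1); rewrite /= hs in h.
rewrite exprS; apply: (@le_trans _ _ (rho * w s * (kap * kap ^+ s))).
  by rewrite ler_wpM2r ?h// mulr_ge0 ?exprn_ge0.
have -> : rho * w s * (kap * kap ^+ s) = rho * kap * (w s * kap ^+ s) by ring.
rewrite exprS [leRHS]mulrCA; apply: ler_pM => //; rewrite ?mulr_ge0 ?exprn_ge0//.
exact/IH/ltnW.
Qed.

(** Summing over the models of a given size cancels the binomial coefficient and
    leaves the geometric series of [weight_geometric]. *)
Lemma sum_model_prior :
  \sum_(S : {set 'I_p} | (#|S| <= smax)%N) model_prior w S * kap ^+ #|S| <= 2 * w 0.
Proof.
rewrite (partition_big (fun S : {set 'I_p} => inord #|S| : 'I_smax.+1) xpredT)//=.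
apply: (@le_trans _ _ (\sum_(s < smax.+1) w 0 * 2^-1 ^+ s)).
  apply: ler_sum => s _; have hs : (s <= smax)%N by rewrite -ltnS.
  rewrite (eq_bigl (fun S : {set 'I_p} => #|S| == s)); last first.
    move=> S; apply/andP/eqP => [[Ss /eqP <-]|Ss]; first by rewrite inordK.
    by rewrite Ss hs inord_val.
  rewrite (eq_bigr (fun=> w s / 'C(p, s)%:R * kap ^+ s)); last first.
    by move=> S /eqP Ss; rewrite /model_prior Ss.
  rewrite sumr_const.
  have -> : #|[pred S : {set 'I_p} | #|S| == s]| = 'C(p, s).
    have := card_draws 'I_p s; rewrite card_ord => <-; apply: eq_card => S.
    by rewrite !inE.
  apply: le_trans (weight_geometric hs).
  have [->|c0] := posnP 'C(p, s); first by rewrite mulr0n mulr_ge0 ?exprn_ge0 ?w0.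
  by rewrite -[leLHS]mulr_natr [_ * kap ^+ s]mulrC -mulrA divfK 1?mulrC// pnatr_eq0 -lt0n.
rewrite -mulr_sumr mulrC ler_wpM2r ?w0//.
have -> : \sum_(s < smax.+1) 2^-1 ^+ s = 2 - 2 * 2^-1 ^+ smax.+1 :> R.
  elim: smax => [|m IH]; first by rewrite big_ord1 expr1 expr0; field.
  by rewrite big_ord_recr/= IH [X in _ = _ - 2 * X]exprS; field.
by rewrite gerBl mulr_ge0 ?exprn_ge0.
Qed.

End ModelPrior.

(** * Hellinger distance *)

Section Hellinger.
Context {R : realType}.
Variables (mu : {measure set R -> \bar R}) (b k : R -> R).
Hypothesis mk : measurable_fun setT k.
Hypothesis dens1 : forall eta : R, (\int[mu]_y (glm_density b k eta y)%:E = 1)%E.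

Lemma sqrt_expR (x : R) : Num.sqrt (expR x) = expR (x / 2).
Proof.
have -> : expR x = expR (x / 2) ^+ 2 by rewrite -expRM_natl; congr expR; field.
by rewrite sqrtr_sqr ger0_norm ?expR_ge0.
Qed.

(** The geometric mean of two densities of the family is, up to the factor
    [expR (- J)], the density at the midpoint, so the integral is
    [2 * (1 - expR (- J))]. *)
Lemma hellinger_integral_le (eta h : R) :
  \int[mu]_y (Num.sqrt (glm_density b k (eta + h) y) -
     Num.sqrt (glm_density b k eta y)) ^+ 2 <= 2 * jensen_gap b 2^-1 eta h.
Proof.
set J := jensen_gap _ _ _ _.
pose sq y := (Num.sqrt (glm_density b k (eta + h) y) - Num.sqrt (glm_density b k eta y)) ^+ 2.
have md e : measurable_fun setT (glm_density b k e) by exact: measurable_glm_density.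
have msq : measurable_fun setT sq.
  have ms e : measurable_fun setT (fun y => Num.sqrt (glm_density b k e y)).
    rewrite (_ : (fun y => _) = fun y => expR ((y * e - b e + k y) / 2)); last first.
      by apply/funext => y; rewrite /glm_density sqrt_expR.
    apply: measurableT_comp => //; apply: measurable_funM => //.
    by apply: measurable_funD => //; apply: measurable_funB => //; exact: measurable_funM.
  by apply: measurable_funX; exact: measurable_funB.
have E y : sq y + 2 * expR (- J) * glm_density b k (eta + 2^-1 * h) y =
    glm_density b k (eta + h) y + glm_density b k eta y.
  have d0 e : 0 <= glm_density b k e y by exact: expR_ge0.
  rewrite /sq sqrrB !sqr_sqrtr//.
  rewrite -(mulrA 2); have -> : expR (- J) * glm_density b k (eta + 2^-1 * h) y =
      Num.sqrt (glm_density b k (eta + h) y) * Num.sqrt (glm_density b k eta y).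
    rewrite /glm_density !sqrt_expR -!expRD; congr expR.
    by rewrite /J /jensen_gap; field.
  ring.
have I2 : (\int[mu]_y (sq y)%:E + (2 * expR (- J))%:E = 2%:E)%E.
  have -> : (2 * expR (- J))%:E =
      (\int[mu]_y (2 * expR (- J) * glm_density b k (eta + 2^-1 * h) y)%:E)%E.
    under eq_integral do rewrite EFinM.
    rewrite ge0_integralZl//=.
    - by rewrite dens1 mule1.
    - exact/measurable_EFinP.
    - by move=> y _; rewrite lee_fin expR_ge0.
  rewrite -ge0_integralD//=.
  - under eq_integral do rewrite -EFinD E EFinD.
    rewrite ge0_integralD//=.
    + by rewrite !dens1 -EFinD.
    + by move=> y _; rewrite lee_fin expR_ge0.
    + exact/measurable_EFinP.
    + by move=> y _; rewrite lee_fin expR_ge0.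
    + exact/measurable_EFinP.
  - by move=> y _; rewrite lee_fin sqr_ge0.
  - exact/measurable_EFinP.
  - by move=> y _; rewrite lee_fin mulr_ge0 ?mulr_ge0 ?expR_ge0.
  - by apply/measurable_EFinP; exact: measurable_funM.
have -> : \int[mu]_y sq y = 2 - 2 * expR (- J).
  rewrite /Rintegral; have fI : (\int[mu]_y (sq y)%:E)%E \is a fin_num.
    rewrite ge0_fin_numE; last by apply: integral_ge0 => y _; rewrite lee_fin sqr_ge0.
    apply: (@le_lt_trans _ _ 2%:E); last exact: ltry.
    by rewrite -I2 leeDl// lee_fin mulr_ge0 ?expR_ge0.
  move: I2; rewrite -{1}(fineK fI) -EFinD => -[]; lra.
have := expR_ge1Dx (- J); lra.
Qed.

End Hellinger.

Lemma hellinger_sq_le {R : realType} {n p : nat} (mu : {measure set R -> \bar R})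
    (b k : R -> R) (X : 'M[R]_(n, p)) t t0 :
    measurable_fun setT k ->
    (forall eta : R, (\int[mu]_y (glm_density b k eta y)%:E = 1)%E) ->
  hellinger mu b k X t t0 ^+ 2 <=
    n%:R^-1 * \sum_i 2 * jensen_gap b 2^-1 (linpred X t0 i) (linpred X t i - linpred X t0 i).
Proof.
move=> mk d1; have R0 i : 0 <= \int[mu]_y (Num.sqrt (glm_density b k (linpred X t i) y) -
     Num.sqrt (glm_density b k (linpred X t0 i) y)) ^+ 2.
  by apply: fine_ge0; apply: integral_ge0 => y _; rewrite lee_fin sqr_ge0.
rewrite /hellinger sqr_sqrtr; last by rewrite mulr_ge0 ?invr_ge0 ?sumr_ge0.
rewrite ler_wpM2l ?invr_ge0//; apply: ler_sum => i _.
have := hellinger_integral_le mk d1 (linpred X t0 i) (linpred X t i - linpred X t0 i).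
by rewrite [_ + (_ - _)]addrC subrK.
Qed.

(** * Tilted likelihood ratios *)

Section Tilting.
Context {R : realType} {n p : nat}.
Variables (b k : R -> R) (X : 'M[R]_(n, p)) (theta0 : 'cV[R]_p) (alpha : R).
Hypothesis cb : strictly_convex b.
Hypothesis alpha01 : 0 < alpha < 1.

Definition pred_diff q (XS : 'M[R]_(n, q)) t i := linpred XS t i - linpred X theta0 i.

(** The likelihood ratio, against the truth, of the model tilted to the linear
    predictor [eta0 + alpha * (eta - eta0)]. *)
Definition tilt q (XS : 'M[R]_(n, q)) (y : 'I_n -> R) t :=
  expR (\sum_i (alpha * pred_diff XS t i * y i) -
        \sum_i (b (linpred X theta0 i + alpha * pred_diff XS t i) - b (linpred X theta0 i))).

(** The tilt carries the randomness of the likelihood ratio to the power [alpha],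
    and the Jensen gaps its decay. *)
Lemma loglik_tilt (S : {set 'I_p}) y t :
  expR (alpha * loglik b k X y (extend t)) =
  expR (alpha * loglik b k X y theta0) * tilt (subcols S X) y t *
    expR (- \sum_i jensen_gap b alpha (linpred X theta0 i) (pred_diff (subcols S X) t i)).
Proof.
rewrite loglik_extend /tilt -!expRD; congr expR; rewrite /loglik !mulr_sumr -!sumrB -sumrN.
rewrite -!big_split/=; apply: eq_bigr => i _; rewrite /jensen_gap /pred_diff.
rewrite [linpred X theta0 i + (_ - _)]addrC subrK; ring.
Qed.

Variable mu : {measure set R -> \bar R}.
Hypothesis mk : measurable_fun setT k.
Hypothesis dens1 : forall eta : R, (\int[mu]_y (glm_density b k eta y)%:E = 1)%E.

Lemma far_loglik_le (S : {set 'I_p}) y t (r : R) : 0 <= r -> (0 < n)%N ->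
  \1_[set th | r < hellinger mu b k X th theta0] (extend t) *
    expR (alpha * loglik b k X y (extend t)) <=
  expR (alpha * loglik b k X y theta0 - Num.min alpha (1 - alpha) * (n%:R * r ^+ 2)) *
    tilt (subcols S X) y t.
Proof.
move=> r0 n0; rewrite indicE; case: (boolP (_ \in _)) => [|_]; last first.
  by rewrite mul0r mulr_ge0 ?expR_ge0.
rewrite inE/= => far; rewrite mul1r loglik_tilt expRD mulrAC ler_wpM2r ?expR_ge0//.
rewrite ler_wpM2l ?expR_ge0// ler_expR lerN2.
have m0 : 0 <= Num.min alpha (1 - alpha).
  by rewrite le_min; move: alpha01 => /andP[a0 a1]; rewrite ltW//= subr_ge0 ltW.
have h2 : r ^+ 2 <= hellinger mu b k X (extend t) theta0 ^+ 2.
  by rewrite ler_sqr ?nnegrE ?sqrtr_ge0// ltW.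
have {h2} := le_trans h2 (hellinger_sq_le X (extend t) theta0 mk dens1).
rewrite [X in _ <= X -> _]mulrC ler_pdivlMr ?ltr0n// [X in X <= _ -> _]mulrC => h.
apply: le_trans (ler_wpM2l m0 h) _; rewrite mulr_sumr; apply: ler_sum => i _.
rewrite linpred_extend -/(pred_diff _ _ _) mulrA [_ * 2]mulrC.
exact: jensen_gap_ge.
Qed.

Local Notation RB := (measurableTypeR R).

Lemma measurable_linpred q (XS : 'M[R]_(n, q)) i :
  measurable_fun setT (fun t : q.-tuple RB => linpred XS (vec_of_tuple t) i).
Proof.
rewrite /linpred; under [X in measurable_fun _ X]eq_fun do rewrite mxE.
apply: measurable_sum => j; apply: measurable_funM; first exact: measurable_cst.
exact: measurable_vec_coord.
Qed.

Hypothesis mb : measurable_fun setT b.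

Lemma measurable_tilt_joint d (T : measurableType d) (Y : 'I_n -> T -> R) q (XS : 'M[R]_(n, q)) :
  (forall i, measurable_fun setT (Y i)) ->
  measurable_fun setT (fun z : T * q.-tuple RB => tilt XS (Y ^~ z.1) (vec_of_tuple z.2)).
Proof.
move=> mY; apply: measurableT_comp => //.
have ml i : measurable_fun setT
    (fun z : T * q.-tuple RB => alpha * pred_diff XS (vec_of_tuple z.2) i).
  apply: measurable_funM; first exact: measurable_cst.
  apply: measurable_funB; last exact: measurable_cst.
  by apply: (measurableT_comp (measurable_linpred XS i)).
apply: measurable_funB.
  apply: measurable_sum => i; apply: measurable_funM => //.
  exact: (measurableT_comp (mY i)).
apply: measurable_sum => i; apply: measurable_funB; last exact: measurable_cst.
apply: measurableT_comp => //; apply: measurable_funD => //; exact: measurable_cst.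
Qed.

Lemma measurable_tilt q (XS : 'M[R]_(n, q)) (y : 'I_n -> R) :
  measurable_fun setT (fun t : q.-tuple RB => tilt XS y (vec_of_tuple t)).
Proof.
have := @measurable_tilt_joint _ RB (fun i _ => y i) q XS (fun i => measurable_cst _).
by move=> /measurable_fun_pair2 => /(_ 0).
Qed.

End Tilting.

Section TiltExpectation.
Context {R : realType} {d : measure_display} {T : measurableType d} {n p : nat}.
Variables (mu : {measure set R -> \bar R}) (b k : R -> R) (X : 'M[R]_(n, p))
  (theta0 : 'cV[R]_p) (alpha : R).
Hypothesis mk : measurable_fun setT k.
Hypothesis mb : measurable_fun setT b.
Hypothesis dens1 : forall eta : R, (\int[mu]_y (glm_density b k eta y)%:E = 1)%E.
Variables (P : probability T R) (Y : 'I_n -> {RV P >-> R}).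
Hypothesis law : forall (i : 'I_n) (B : set R), measurable B ->
  distribution P (Y i) B =
  (\int[mu]_(y in B) (glm_density b k (linpred X theta0 i) y)%:E)%E.
Hypothesis indep : mutually_independent P (fun i => Y i : T -> R).
Local Notation RB := (measurableTypeR R).

Lemma integral_tilt q (XS : 'M[R]_(n, q)) t :
  (\int[P]_om (tilt b X theta0 alpha XS (Y ^~ om) t)%:E = 1)%E.
Proof.
rewrite /tilt; under eq_integral do rewrite expRD mulrC EFinM.
rewrite ge0_integralZl//=; last first.
  apply/measurable_EFinP; apply: measurableT_comp => //.
  by apply: measurable_sum => i; apply: measurable_funM => //; exact: measurable_Y.
by rewrite (glm_joint_mgf mk dens1 law indep) -EFinM -expRD addNr expR0.
Qed.

Variables (q : nat) (XS : 'M[R]_(n, q)) (g : 'cV[R]_q -> R).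
Hypothesis g0 : forall t, 0 <= g t.
Hypothesis mg : measurable_fun setT (fun t : q.-tuple RB => g (vec_of_tuple t)).

Let f (z : T * q.-tuple RB) :=
  (tilt b X theta0 alpha XS (Y ^~ z.1) (vec_of_tuple z.2) * g (vec_of_tuple z.2))%:E.

Let mf : measurable_fun setT f.
Proof.
apply/measurable_EFinP; apply: measurable_funM.
  exact: (measurable_tilt_joint X theta0 alpha mb XS (measurable_Y Y)).
exact: (measurableT_comp mg).
Qed.

Let f0 z : (0 <= f z)%E. Proof. by rewrite lee_fin mulr_ge0 ?expR_ge0. Qed.

Lemma measurable_marginal_tilt : measurable_fun setT
  (fun om => lebesgue_int (fun t => (tilt b X theta0 alpha XS (Y ^~ om) t * g t)%:E)).
Proof. exact: (@measurable_fun_fubini_tonelli_F _ _ _ _ R (lebesgue_tuple q) f mf f0). Qed.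

Lemma integral_marginal_tilt :
  (\int[P]_om lebesgue_int (fun t => (tilt b X theta0 alpha XS (Y ^~ om) t * g t)%:E) =
   lebesgue_int (fun t => (g t)%:E))%E.
Proof.
have := @fubini_tonelli _ _ _ _ R P (lebesgue_tuple q) f mf f0.
move=> ->; apply: eq_integral => t _; rewrite /f/=.
under eq_integral do rewrite mulrC EFinM.
rewrite ge0_integralZl//=.
- by rewrite integral_tilt mule1.
- apply/measurable_EFinP.
  have := measurable_tilt_joint X theta0 alpha mb XS (measurable_Y Y).
  by move=> /measurable_fun_pair1 => /(_ t).
- by move=> om _; rewrite lee_fin expR_ge0.
- by rewrite lee_fin.
Qed.

End TiltExpectation.

(** * Posterior mass on good data *)

Section EmpiricalPrior.
Context {R : realType} {n p : nat}.
Variables (mu : {measure set R -> \bar R}) (b b1 b2 k : R -> R) (C : R).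
Hypothesis mk : measurable_fun setT k.
Hypothesis dens1 : forall eta : R, (\int[mu]_y (glm_density b k eta y)%:E = 1)%E.
Hypothesis db : forall x : R, is_derive x 1 b (b1 x).
Hypothesis db1 : forall x : R, is_derive x 1 b1 (b2 x).
Hypothesis b2E : derive1n 2 b = b2.
Hypothesis bC : forall x y : R, `|y| <= 2^-1 -> b2 (x + y) <= C * b2 x.
Hypothesis cb : strictly_convex b.
Hypothesis C1 : 1 <= C.
Variables (X : 'M[R]_(n, p)) (theta0 : 'cV[R]_p) (y : 'I_n -> R).
Variables (smax : nat) (w : nat -> R) (lam alpha D logp : R).
Hypothesis w0 : forall s, (s <= smax)%N -> 0 <= w s.
Hypothesis lam0 : 0 < lam.
Hypothesis alpha01 : 0 < alpha < 1.
Hypothesis D0 : 0 < D.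
Variable thetabar : forall S : {set 'I_p}, 'cV[R]_#|S|.

Let Fbar S := fisher b (subcols S X) (thetabar S).
Let thetahat S := mle b k X y S.
Let Fhat S := fisher b (subcols S X) (thetahat S).

Hypothesis Fbar_unit : forall S : {set 'I_p}, (#|S| <= smax)%N -> Fbar S \in unitmx.

(** The behaviour of the maximum likelihood estimators that makes the
    data-dependent slabs comparable with fixed ones. *)
Definition good_data := forall S : {set 'I_p}, (#|S| <= smax)%N ->
  [/\ mle_set b k X y S !=set0,
      loewner_le (D^-1 *: Fbar S) (Fhat S),
      loewner_le (Fhat S) (D *: Fbar S) &
      norm2 (sqrtmx (Fbar S) *m (thetahat S - thetabar S)) ^+ 2 <= D * #|S|%:R * logp].

Hypothesis good : good_data.

Let C0 : 0 < C. Proof. exact: lt_le_trans C1. Qed.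
Let b2_nonneg x : 0 <= derive1n 2 b x.
Proof. by rewrite b2E; exact: b2_ge0 db db1 bC cb C1 x. Qed.
Let psdF (S : {set 'I_p}) t : psdmx (fisher b (subcols S X) t). Proof. exact: psdmx_fisher. Qed.

Let mb : measurable_fun setT b.
Proof.
by apply: continuous_measurable_fun; exact: is_derive_continuous db.
Qed.

Lemma thetahat_max (S : {set 'I_p}) : (#|S| <= smax)%N ->
  forall t, loglik b k (subcols S X) y t <= loglik b k (subcols S X) y (thetahat S).
Proof.
move=> hS; have [ne _ _ _] := good hS; have [t0 ht0] := ne.
exact: (@xgetPex _ 0 _ (ex_intro _ t0 ht0)).
Qed.

Lemma Fhat_ge (S : {set 'I_p}) v : (#|S| <= smax)%N ->
  D^-1 * quadform (Fbar S) v <= quadform (Fhat S) v.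
Proof.
by move=> hS; have [_ h _ _] := good hS; rewrite -quadform_scale; exact: loewner_quadform.
Qed.

Lemma Fhat_le (S : {set 'I_p}) v : (#|S| <= smax)%N ->
  quadform (Fhat S) v <= D * quadform (Fbar S) v.
Proof.
by move=> hS; have [_ _ h _] := good hS; rewrite -quadform_scale; exact: loewner_quadform.
Qed.

Lemma Fhat_unit (S : {set 'I_p}) : (#|S| <= smax)%N -> Fhat S \in unitmx.
Proof.
move=> hS; apply: pd_unitmx => v v0; apply: lt_le_trans (Fhat_ge v hS).
apply: mulr_gt0; first by rewrite invr_gt0.
by apply: quadform_gt0 => //; [exact: psdF|exact: Fbar_unit].
Qed.

(** The fixed Gaussian density that dominates the slab on good data. *)
Definition slab_envelope (S : {set 'I_p}) : 'cV[R]_#|S| -> R :=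
  normal_density (thetabar S) (invmx ((lam / (2 * D)) *: Fbar S)).

Let prec0 : 0 < lam / (2 * D). Proof. by rewrite divr_gt0 ?mulr_gt0. Qed.

Lemma slab_le_envelope (S : {set 'I_p}) t : (#|S| <= smax)%N ->
  slab b k X y lam S t <=
  (Num.sqrt 2 * D * expR (lam * logp / 2)) ^+ #|S| * slab_envelope t.
Proof.
move=> hS; have [_ _ _ h] := good hS.
have := @normal_density_dominated R #|S| (Fhat S) (Fbar S) D lam (#|S|%:R * logp)
  (thetahat S) (thetabar S) t (psdF _) (Fhat_unit hS) (psdF _) (Fbar_unit hS) D0 lam0
  (fun v => Fhat_ge v hS) (fun v => Fhat_le v hS).
rewrite -norm2_sqrtmx; last exact: psdF.
rewrite mulrA => /(_ h).
have -> : lam * (#|S|%:R * logp) / 2 = #|S|%:R * (lam * logp / 2) by ring.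
by rewrite expRM_natl -exprMn.
Qed.

(** The data enter through the tilts alone, so that the expectation can be taken
    under the integral. *)
Definition numerator_envelope : \bar R :=
  (\sum_(S : {set 'I_p} | (#|S| <= smax)%N)
    (model_prior w S * (Num.sqrt 2 * D * expR (lam * logp / 2)) ^+ #|S|)%:E *
    lebesgue_int (fun t => (tilt b X theta0 alpha (subcols S X) y t * slab_envelope t)%:E))%E.

Local Notation RB := (measurableTypeR R).

Lemma measurable_envelope (S : {set 'I_p}) : (#|S| <= smax)%N ->
  measurable_fun setT (fun t : #|S|.-tuple RB => slab_envelope (vec_of_tuple t)).
Proof.
move=> hS; apply: measurable_normal_density; apply: scale_unitmx; first exact: lt0r_neq0.
exact: Fbar_unit.
Qed.

Lemma envelope_ge0 (S : {set 'I_p}) (t : 'cV[R]_#|S|) : 0 <= slab_envelope t.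
Proof. exact: normal_density_ge0. Qed.

Lemma numerator_le (r : R) : 0 <= r -> (0 < n)%N ->
  (prior_int b k X y smax w lam (fun t =>
     (\1_[set th | r < hellinger mu b k X th theta0] t * expR (alpha * loglik b k X y t))%:E) <=
   (expR (alpha * loglik b k X y theta0 - Num.min alpha (1 - alpha) * (n%:R * r ^+ 2)))%:E *
     numerator_envelope)%E.
Proof.
move=> r0 n0; set E := expR (_ - _); pose kap := Num.sqrt 2 * D * expR (lam * logp / 2).
have E0 : 0 <= E by exact: expR_ge0.
have kap0 : 0 <= kap by rewrite !mulr_ge0 ?expR_ge0 ?sqrtr_ge0 ?ltW.
have pS0 (S : {set 'I_p}) : (#|S| <= smax)%N -> 0 <= model_prior w S by exact: (model_prior_ge0 w0).
have i0 (S : {set 'I_p}) : (0 <= lebesgue_int (fun t =>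
    (tilt b X theta0 alpha (subcols S X) y t * slab_envelope t)%:E))%E.
  by apply: lebesgue_int_ge0 => t; rewrite lee_fin mulr_ge0 ?expR_ge0 ?envelope_ge0.
rewrite /numerator_envelope -/kap ge0_sume_distrr; last first.
  by move=> S hS; rewrite mule_ge0// lee_fin mulr_ge0 ?exprn_ge0 ?pS0.
apply: lee_sum => S hS; rewrite [leRHS]muleA -EFinM mulrCA [X in (_ <= X * _)%E]EFinM -[leRHS]muleA.
apply: lee_wpmul2l; first by rewrite lee_fin pS0.
rewrite !lebesgue_intE -ge0_integralZl//=; last first.
- by rewrite lee_fin mulr_ge0 ?exprn_ge0.
- by move=> t _; rewrite lee_fin mulr_ge0 ?expR_ge0 ?envelope_ge0.
- apply/measurable_EFinP; apply: measurable_funM; last exact: measurable_envelope.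
  exact: measurable_tilt.
apply: le_lower_integral => t.
  by rewrite -EFinM lee_fin !mulr_ge0 ?slab_ge0 ?expR_ge0.
rewrite -!EFinM lee_fin.
have := far_loglik_le X theta0 cb alpha01 mk dens1 y (vec_of_tuple t) r0 n0.
have := slab_le_envelope (vec_of_tuple t) hS; rewrite -/kap -/E => h1 h2.
rewrite [leRHS]mulrACA; apply: ler_pM => //; exact: slab_ge0.
Qed.

Let S0 := supp theta0.
Let X0 := subcols S0 X.
Let t0 := restrict S0 theta0.
Let F0 := fisher b X0 t0.

Variables (z a r1 : R).
Hypothesis S0_smax : (#|S0| <= smax)%N.
Hypothesis S0_gt0 : (0 < #|S0|)%N.
Hypothesis F0_unit : F0 \in unitmx.
Hypothesis lev : forall v i, linpred X0 v i ^+ 2 <= z ^+ 2 * quadform F0 v.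
Hypothesis z0 : 0 <= z.
Hypothesis a0 : 0 <= a.
Hypothesis r10 : 0 < r1.
Hypothesis zr1 : z * r1 <= 2^-1.
Hypothesis ar1 : 2 * C * (a * Num.sqrt #|S0|%:R) < r1.
Hypothesis z_small : 16 * z ^+ 2 * #|S0|%:R <= alpha.
Hypothesis score_small : forall j, `|score b1 X0 y t0 (fisher_frame b X0 t0 j)| <= a.

(** The leverages [z] keep the ellipsoid of radius [r1] within the region where the
    quadratic bounds hold. *)
Lemma mle_close : quadform F0 (thetahat S0 - t0) <= r1 ^+ 2.
Proof.
apply: (@mle_in_ellipsoid R n #|S0| b b1 b2 k C db db1 b2E bC cb C1 X0 y t0
  (thetahat S0 - t0) z (a * Num.sqrt #|S0|%:R)) => //.
  by rewrite addrC subrK; exact: thetahat_max.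
by apply: (score_le_frame db db1 b2E bC cb C1).
Qed.

Lemma fisher_mle_ge v : quadform F0 v <= C * quadform (Fhat S0) v.
Proof.
have := @fisher_comparable R n #|S0| b b2 C b2E bC X0 t0 (thetahat S0 - t0) v.
rewrite [t0 + _]addrC subrK; apply => i.
apply: le_trans zr1; rewrite -ler_sqr ?nnegrE ?mulr_ge0 ?(ltW r10)//.
rewrite real_normK ?num_real// exprMn; apply: le_trans (lev _ _) _.
by rewrite ler_wpM2l ?sqr_ge0// mle_close.
Qed.

Lemma loglik_at_true : loglik b k X y theta0 <= loglik b k X0 y (thetahat S0).
Proof.
rewrite -[in leLHS](extend_restrict theta0) loglik_extend; exact: thetahat_max.
Qed.

(** The truth is compared with the estimator, which has a larger likelihood, and the
    estimator with the points around it. *)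
Lemma loglik_ellipsoid t :
  quadform (Fhat S0) (t - thetahat S0) <= 4 * #|S0|%:R / (alpha * C) ->
  alpha * loglik b k X y theta0 - alpha * C * quadform (Fhat S0) (t - thetahat S0) <=
  alpha * loglik b k X0 y t.
Proof.
move=> hq; have /andP[al0 _] := alpha01.
have hl i : `|linpred X0 (t - thetahat S0) i| <= 2^-1.
  rewrite -ler_sqr ?nnegrE// real_normK ?num_real//.
  apply: le_trans (lev _ _) _.
  apply: (@le_trans _ _ (z ^+ 2 * (C * (4 * #|S0|%:R / (alpha * C))))).
    rewrite ler_wpM2l ?sqr_ge0//; apply: le_trans (fisher_mle_ge _) _.
    by rewrite ler_pM2l.
  have -> : z ^+ 2 * (C * (4 * #|S0|%:R / (alpha * C))) = 4^-1 * (16 * z ^+ 2 * #|S0|%:R) / alpha.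
    by field; rewrite !gt_eqF.
  rewrite ler_pdivrMr//; apply: le_trans (ler_wpM2l _ z_small) _; first by rewrite invr_ge0.
  by rewrite expr2 -invfM -natrM.
have h2 : loglik b k X0 y (thetahat S0) - C * quadform (Fhat S0) (t - thetahat S0) <=
    loglik b k X0 y (thetahat S0 + (t - thetahat S0)).
  by apply: (loglik_near_mle db db1 b2E bC) hl; exact: thetahat_max.
move: h2; rewrite [thetahat S0 + _]addrC subrK.
have := loglik_at_true; move: (quadform _ _) => q h1 h2.
rewrite -mulrA -mulrBr ler_pM2l//; apply: le_trans h2.
by rewrite lerD2r.
Qed.

(** The mass left by [restricted_gaussian_mass] for [beta := alpha * C], with the
    prior weight of the true support. *)
Definition denominator_const :=
  model_prior w S0 * (2^-1 * Num.sqrt ((lam / (lam + 2 * (alpha * C))) ^+ #|S0|)).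

(** Keep only the true support, and there only the ellipsoid of
    [loglik_ellipsoid]. *)
Lemma denominator_ge :
  ((expR (alpha * loglik b k X y theta0) * denominator_const)%:E <=
   prior_int b k X y smax w lam (fun t => (expR (alpha * loglik b k X y t))%:E))%E.
Proof.
have /andP[al0 _] := alpha01; have aC0 : 0 < alpha * C by rewrite mulr_gt0.
set L0 := expR _.
pose f (S : {set 'I_p}) := ((model_prior w S)%:E * lebesgue_int (fun t =>
   (expR (alpha * loglik b k X y (extend t)))%:E *
   (slab b k X y lam S t)%:E))%E.
have f0 (S : {set 'I_p}) : (#|S| <= smax)%N -> (0 <= f S)%E.
  move=> hS; rewrite mule_ge0// ?lee_fin ?(model_prior_ge0 w0)//.
  by apply: lebesgue_int_ge0 => t; rewrite mule_ge0 ?lee_fin ?expR_ge0 ?slab_ge0.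
rewrite /prior_int (bigD1 S0)//=.
apply: (@le_trans _ _ (f S0)); last first.
  by rewrite leeDl// sume_ge0// => S /andP[hS _]; exact: f0.
rewrite /denominator_const mulrCA EFinM; apply: lee_wpmul2l.
  by rewrite lee_fin (model_prior_ge0 w0).
rewrite EFinM.
have L00 : 0 <= L0 by exact: expR_ge0.
have := restricted_gaussian_mass (thetahat S0) (psdF (thetahat S0)) (Fhat_unit S0_smax)
  S0_gt0 lam0 aC0.
set g := (X in lebesgue_int X) => h.
apply: (@le_trans _ _ (L0%:E * lebesgue_int g)%E).
  by rewrite lee_wpmul2l// lee_fin.
have g0 t : (0 <= g t)%E.
  by rewrite lee_fin mulr_ge0 ?normal_density_ge0//; case: ifP => // _; exact: expR_ge0.
apply: (@le_trans _ _ (lebesgue_int (fun t => L0%:E * g t)%E)).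
  rewrite !lebesgue_intE ge0_integralZl//.
  apply/measurable_EFinP; apply: measurable_funM.
    by apply: measurable_normal_density; apply: scale_unitmx (Fhat_unit S0_smax); exact: lt0r_neq0.
  apply: measurable_fun_ifT => //; last exact: measurable_exp_quadform.
  by apply: measurable_fun_ler => //; exact: measurable_quadform.
apply: le_lebesgue_int => t; first by rewrite mule_ge0// lee_fin.
rewrite /g -!EFinM lee_fin /slab -/(thetahat S0) -/X0 -/(Fhat S0).
rewrite mulrCA [leRHS]mulrC; apply: ler_wpM2l; first exact: normal_density_ge0.
case: ifP => hq; last by rewrite mulr0 expR_ge0.
by rewrite /L0 -expRD ler_expR loglik_extend; exact: loglik_ellipsoid.
Qed.

Lemma posterior_mass_le (r : R) : 0 <= r -> (0 < n)%N -> 0 < denominator_const ->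
  ((frac_posterior b k X y smax w lam alpha [set th | (r < hellinger mu b k X th theta0)%R])%:E <=
   (expR (- (Num.min alpha (1 - alpha) * (n%:R * r ^+ 2))) / denominator_const)%:E *
     numerator_envelope)%E.
Proof.
move=> r0 n0 dc0.
have L0 : 0 < expR (alpha * loglik b k X y theta0) by exact: expR_gt0.
apply: le_trans (frac_posterior_le w0 _ (numerator_le r0 n0) denominator_ge) _.
  exact: mulr_gt0.
rewrite muleA -EFinM le_eqVlt; apply/orP; left; apply/eqP; congr (_%:E * _)%E.
by rewrite expRD invfM; field; rewrite !gt_eqF.
Qed.

End EmpiricalPrior.

(** * Expected posterior mass *)

Section FiniteSample.
Context {R : realType} {d : measure_display} {T : measurableType d} {n p : nat}.
Variables (mu : {measure set R -> \bar R}) (b b1 b2 k : R -> R) (C : R).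
Hypothesis mk : measurable_fun setT k.
Hypothesis dens1 : forall eta : R, (\int[mu]_y (glm_density b k eta y)%:E = 1)%E.
Hypothesis db : forall x : R, is_derive x 1 b (b1 x).
Hypothesis db1 : forall x : R, is_derive x 1 b1 (b2 x).
Hypothesis b2E : derive1n 2 b = b2.
Hypothesis bC : forall x y : R, `|y| <= 2^-1 -> b2 (x + y) <= C * b2 x.
Hypothesis cb : strictly_convex b.
Hypothesis C1 : 1 <= C.
Variables (X : 'M[R]_(n, p)) (theta0 : 'cV[R]_p).
Variables (P : probability T R) (Y : 'I_n -> {RV P >-> R}).
Hypothesis law : forall (i : 'I_n) (B : set R), measurable B ->
  distribution P (Y i) B =
  (\int[mu]_(y in B) (glm_density b k (linpred X theta0 i) y)%:E)%E.
Hypothesis indep : mutually_independent P (fun i => Y i : T -> R).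

Let S0 := supp theta0.
Let X0 := subcols S0 X.
Let t0 := restrict S0 theta0.
Let F0 := fisher b X0 t0.

Variables (z a tau : R).
Hypothesis F0_unit : F0 \in unitmx.
Hypothesis lev : forall v i, linpred X0 v i ^+ 2 <= z ^+ 2 * quadform F0 v.
Hypothesis z0 : 0 <= z.
Hypothesis tau0 : 0 < tau.
Hypothesis tauz : tau * z <= 2^-1.

(** A union bound over the two orientations of each direction of the frame. *)
Lemma score_event : exists U : set T, [/\ measurable U,
  (P U <= ((2 * #|S0|)%:R * expR (C * tau ^+ 2 / 2 - tau * a))%:E)%E &
  forall om, ~ U om ->
    forall j, `|score b1 X0 (Y ^~ om) t0 (fisher_frame b X0 t0 j)| <= a].
Proof.
(* the boolean is the orientation: -1 when it is true *)
pose v (js : 'I_#|S0| * bool) i := (-1) ^+ js.2 * linpred X0 (fisher_frame b X0 t0 js.1) i.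
pose A js := [set om | a <= \sum_i v js i * (Y i om - b1 (linpred X theta0 i))].
have mY i := measurable_Y Y i.
have mA js : measurable (A js).
  rewrite -[A js]setTI; apply: measurable_fun_le => //.
  apply: measurable_sum => i; apply: measurable_funM; first exact: measurable_cst.
  by apply: measurable_funB => //.
have PA js : (P (A js) <= (expR (C * tau ^+ 2 / 2 - tau * a))%:E)%E.
  have qf := quadform_frame db db1 b2E bC cb C1 (X := X0) js.1 F0_unit.
  apply: (chernoff_score mk dens1 db db1 bC law indep) => //.
  - move=> i; rewrite /v; apply: le_trans tauz.
    rewrite normrM (gtr0_norm tau0) ler_pM2l// normrM normrX normrN1 expr1n mul1r.
    rewrite -ler_sqr ?nnegrE// real_normK ?num_real//.
    by apply: le_trans (lev _ _) _; rewrite qf mulr1.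
  - rewrite -[RHS]qf (quadform_fisherE b2E); apply: eq_bigr => i _.
    by rewrite /v exprMn sqrr_sign mul1r linpred_restrict.
exists (\big[setU/set0]_(js <- enum {: 'I_#|S0| * bool}) A js); split.
- exact: bigsetU_measurable.
- have := probability_bigU (P := P) (enum {: 'I_#|S0| * bool}) mA PA.
  by rewrite -cardE card_prod card_ord card_bool [(2 * _)%N]mulnC.
- move=> om nU j.
  have nA js : ~ A js om.
    move=> Ajs; apply: nU; rewrite -bigcup_seq; exists js => //=.
    by rewrite mem_enum.
  have sE : score b1 X0 (Y ^~ om) t0 (fisher_frame b X0 t0 j) =
      \sum_i linpred X0 (fisher_frame b X0 t0 j) i * (Y i om - b1 (linpred X theta0 i)).
    by apply: eq_bigr => i _; rewrite mulrC linpred_restrict.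
  have h s := nA (j, s); rewrite /A /v/= in h.
  rewrite ler_norml sE; apply/andP; split.
    rewrite lerNl -sumrN; rewrite leNgt; apply/negP => hs; apply: (h true).
    apply/ltW; apply: lt_le_trans hs _; rewrite le_eqVlt; apply/orP; left; apply/eqP.
    by apply: eq_bigr => i _; rewrite expr1 mulN1r mulNr.
  rewrite leNgt; apply/negP => hs; apply: (h false).
  apply/ltW; apply: lt_le_trans hs _; rewrite le_eqVlt; apply/orP; left; apply/eqP.
  by apply: eq_bigr => i _; rewrite expr0 mul1r.
Qed.

Variables (smax : nat) (w : nat -> R) (lam alpha D logp rho r1 e0 r : R).
Hypothesis w0 : forall s, (s <= smax)%N -> 0 <= w s.
Hypothesis lam0 : 0 < lam.
Hypothesis alpha01 : 0 < alpha < 1.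
Hypothesis D0 : 0 < D.
Variable thetabar : forall S : {set 'I_p}, 'cV[R]_#|S|.
Hypothesis Fbar_unit : forall S : {set 'I_p}, (#|S| <= smax)%N ->
  fisher b (subcols S X) (thetabar S) \in unitmx.
Let kap := Num.sqrt 2 * D * expR (lam * logp / 2).
Hypothesis rho0 : 0 <= rho.
Hypothesis rhokap : rho * kap <= 2^-1.
Hypothesis wr : forall s, (1 <= s <= smax)%N -> w s <= rho * w s.-1.
Variable G : set T.
Hypothesis mG : measurable G.
Hypothesis PG : (P G >= (1 - e0)%:E)%E.
Hypothesis goodG : forall om, G om ->
  good_data b k X (Y ^~ om) smax D logp thetabar.
Hypothesis S0_smax : (#|S0| <= smax)%N.
Hypothesis S0_gt0 : (0 < #|S0|)%N.
Hypothesis a0 : 0 <= a.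
Hypothesis r10 : 0 < r1.
Hypothesis zr1 : z * r1 <= 2^-1.
Hypothesis ar1 : 2 * C * (a * Num.sqrt #|S0|%:R) < r1.
Hypothesis z_small : 16 * z ^+ 2 * #|S0|%:R <= alpha.
Hypothesis r0 : 0 <= r.
Hypothesis n0 : (0 < n)%N.
Let dc := denominator_const C theta0 w lam alpha.
Hypothesis dc0 : 0 < dc.

Let kap0 : 0 <= kap.
Proof. by rewrite /kap !mulr_ge0 ?expR_ge0 ?sqrtr_ge0 ?ltW. Qed.

Let env om := numerator_envelope b X theta0 (Y ^~ om) smax w lam alpha D logp thetabar.

Let mb : measurable_fun setT b.
Proof.
by apply: continuous_measurable_fun; exact: is_derive_continuous db.
Qed.

Let b2_nonneg x : 0 <= derive1n 2 b x.
Proof. by rewrite b2E; exact: b2_ge0 db db1 bC cb C1 x. Qed.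

Let integrand (S : {set 'I_p}) om := lebesgue_int (fun t =>
  (tilt b X theta0 alpha (subcols S X) (Y ^~ om) t *
   slab_envelope b X lam D thetabar t)%:E).

Let m_integrand (S : {set 'I_p}) : (#|S| <= smax)%N -> measurable_fun setT (integrand S).
Proof.
move=> hS; apply: measurable_marginal_tilt => //.
  by move=> t; exact: envelope_ge0.
exact: (measurable_envelope lam0 D0 Fbar_unit).
Qed.

Let integrand0 (S : {set 'I_p}) om : (0 <= integrand S om)%E.
Proof.
by apply: lebesgue_int_ge0 => t; rewrite lee_fin mulr_ge0 ?expR_ge0 ?envelope_ge0.
Qed.

Let env_E om : env om = (\sum_(S : {set 'I_p}) if (#|S| <= smax)%N then
  (model_prior w S * kap ^+ #|S|)%:E * integrand S om else 0)%E.
Proof. by rewrite /env /numerator_envelope big_mkcond. Qed.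

Let coef0 (S : {set 'I_p}) : (#|S| <= smax)%N -> 0 <= model_prior w S * kap ^+ #|S|.
Proof. by move=> hS; rewrite mulr_ge0 ?exprn_ge0//; exact: (model_prior_ge0 w0). Qed.

Let term0 (S : {set 'I_p}) om : (0 <= if (#|S| <= smax)%N then
  (model_prior w S * kap ^+ #|S|)%:E * integrand S om else 0)%E.
Proof. by case: ifP => // hS; rewrite mule_ge0// lee_fin coef0. Qed.

Let m_term (S : {set 'I_p}) : measurable_fun setT (fun om => if (#|S| <= smax)%N then
  (model_prior w S * kap ^+ #|S|)%:E * integrand S om else 0)%E.
Proof.
by case: (boolP (#|S| <= smax)%N) => // hS; apply: measurable_funeM; exact: m_integrand.
Qed.

Lemma measurable_env : measurable_fun setT env.
Proof.
rewrite (funext env_E).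
exact: emeasurable_sum.
Qed.

Lemma env_ge0 om : (0 <= env om)%E.
Proof. by rewrite env_E; apply: sume_ge0 => S _; exact: term0. Qed.

(** By Tonelli each tilt integrates to one, and so does each envelope. *)
Lemma integral_env : (\int[P]_om env om <= (2 * w 0)%:E)%E.
Proof.
under eq_integral do rewrite env_E.
rewrite ge0_integral_sum//.
apply: (@le_trans _ _ (\sum_(S : {set 'I_p} | (#|S| <= smax)%N)
    model_prior w S * kap ^+ #|S|)%:E); last first.
  by rewrite lee_fin; exact: (sum_model_prior w0 rho0 kap0 rhokap wr).
rewrite -sumEFin [leRHS]big_mkcond/=; apply: lee_sum => S _; case: ifP => hS; last first.
  by rewrite integral0.
rewrite ge0_integralZl//; [|exact: m_integrand|by rewrite lee_fin coef0].
rewrite /integrand (integral_marginal_tilt alpha mk mb dens1 law indep); last 2 first.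
- by move=> t; exact: envelope_ge0.
- exact: (measurable_envelope lam0 D0 Fbar_unit).
rewrite /slab_envelope lebesgue_int_normal_density ?mule1//.
  by apply: psdmx_scale; [rewrite divr_ge0 ?mulr_ge0 ?ltW|exact: psdmx_fisher].
apply: scale_unitmx; last exact: Fbar_unit.
by rewrite lt0r_neq0// divr_gt0 ?mulr_gt0.
Qed.

(** The three terms are the probability that the estimators misbehave, the
    probability that the score is large, and the expectation of the numerator
    over the lower bound of the denominator. *)
Theorem expected_posterior_mass :
  ('E_P[fun om => frac_posterior b k X (Y ^~ om) smax w lam alpha
     [set th | r < hellinger mu b k X th theta0]%R] <=
   (e0 + (2 * #|S0|)%:R * expR (C * tau ^+ 2 / 2 - tau * a) +
    expR (- (Num.min alpha (1 - alpha) * (n%:R * r ^+ 2))) / dc * (2 * w 0))%:E)%E.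
Proof.
have [U [mU PU goodU]] := score_event.
set f := fun om => frac_posterior _ _ _ _ _ _ _ _ _.
set c := expR _ / dc.
have c0 : 0 <= c by rewrite divr_ge0 ?expR_ge0 ?ltW.
have PnG : (P (~` G) <= e0%:E)%E.
  have fG : P G \is a fin_num by exact: fin_num_measure.
  rewrite probability_setC//; move: PG; rewrite -(fineK fG) -EFinB !lee_fin; lra.
rewrite unlock.
apply: (@le_trans _ _ (\int[P]_om ((\1_(~` G) om)%:E + (\1_U om)%:E + c%:E * env om))%E).
  apply: le_lower_integral => om; first by rewrite lee_fin frac_posterior_ge0.
  have e_ge0 : (0 <= c%:E * env om)%E by rewrite mule_ge0 ?lee_fin ?env_ge0.
  have [Gom|nG] := pselect (G om); last first.
    rewrite [\1_(~` G) om]indicE mem_set//.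
    apply: (@le_trans _ _ 1%:E); first by rewrite lee_fin frac_posterior_le1.
    by rewrite -addeA leeDl// adde_ge0// lee_fin.
  have [Uom|nU] := pselect (U om).
    rewrite [\1_U om]indicE mem_set//.
    apply: (@le_trans _ _ 1%:E); first by rewrite lee_fin frac_posterior_le1.
    by rewrite addeAC leeDr// adde_ge0// lee_fin.
  rewrite !indicE !memNset//= add0e add0e.
  by apply: (posterior_mass_le mk dens1 db db1 b2E bC cb C1 w0 lam0 alpha01 D0 Fbar_unit
    (goodG Gom) S0_smax S0_gt0 F0_unit lev z0 a0 r10 zr1 ar1 z_small (goodU _ nU) r0 n0 dc0).
have mI (A : set T) : measurable A -> measurable_fun setT (fun om => (\1_A om)%:E : \bar R).
  by move=> mA; apply/measurable_EFinP; exact: measurable_indic.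
rewrite ge0_integralD//; last 4 first.
- by move=> om _; rewrite adde_ge0// lee_fin.
- by apply: emeasurable_funD; apply: mI => //; exact: measurableC.
- by move=> om _; rewrite mule_ge0 ?lee_fin ?env_ge0.
- by apply: measurable_funeM; exact: measurable_env.
rewrite ge0_integralD//; last 2 first.
- by apply: mI; exact: measurableC.
- exact: mI.
rewrite !integral_indic ?setIT//; last exact: measurableC.
rewrite EFinD EFinD; apply: leeD; [apply: leeD => //; exact: PnG|].
rewrite ge0_integralZl//; last 2 first.
- exact: measurable_env.
- by move=> om _; exact: env_ge0.
- by rewrite [leRHS]EFinM; apply: lee_wpmul2l; [rewrite lee_fin|exact: integral_env].
Qed.

End FiniteSample.

(** * Rates *)

Section Rates.
Context {R : realType}.

Lemma sqrtrX (x : R) s : 0 <= x -> Num.sqrt (x ^+ s) = Num.sqrt x ^+ s.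
Proof.
move=> x0; elim: s => [|s IH]; first by rewrite !expr0 sqrtr1.
by rewrite !exprS sqrtrM// IH.
Qed.

Lemma exprn_le (x y : R) s : 0 <= x -> x <= y -> x ^+ s <= y ^+ s.
Proof.
by move=> x0 xy; rewrite lerXn2r ?nnegrE// (le_trans x0).
Qed.

Lemma powR_expR_ln (x r : R) : 0 < x -> x `^ r = expR (r * ln x).
Proof. by move=> x0; rewrite /powR gt_eqF. Qed.

Lemma binomial_le_exp p s : ('C(p, s) <= p ^ s)%N.
Proof.
elim: s => [|s IH]; first by rewrite bin0.
have h := mul_bin_left p s.
have : ('C(p, s.+1) * 1 <= s.+1 * 'C(p, s.+1))%N by rewrite muln1 leq_pmull.
rewrite muln1 h => /leq_trans; apply; rewrite expnS.
by rewrite leq_mul// leq_subr.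
Qed.

(** Per element of the true support, the model weight costs [A1 * p ^ (- A3)], the
    number of models of that size [p ^ (- 1)] and the Gaussian mass
    [p ^ (- A5 / 2)]; the last unit in the exponent absorbs the constants. *)
Lemma denominator_const_ge (p n : nat) (theta0 : 'cV[R]_p) (w : nat -> R)
    (C lam alpha A1 A3 A5 A6 : R) :
    let s0 := #|supp theta0| in let L : R := ln p%:R in
    (0 < p)%N -> (s0 <= p)%N -> 1 <= C -> 0 < alpha < 1 -> 0 < A1 -> 0 < A6 ->
    0 < w 0 -> (A1 * expR (- A3 * L)) ^+ s0 * w 0 <= w s0 ->
    expR (- A5 * L) <= lam -> lam <= A6 ->
    Num.sqrt (A6 + 2 * C) <= A1 * expR L ->
  w 0 / 2 * expR (- ((A3 + 1 + A5 / 2 + 1) * L)) ^+ s0 <=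
    denominator_const C theta0 w lam alpha.
Proof.
move=> s0 L p0 s0p C1 /andP[al0 al1] A10 A60 w0 ws lam1 lam2 QA.
have lam0 : 0 < lam by apply: lt_le_trans lam1; exact: expR_gt0.
have C0 : 0 < C by lra.
have eL : expR L = p%:R by rewrite /L lnK// posrE ltr0n.
pose Q := A6 + 2 * C.
have Q0 : 0 < Q by rewrite /Q; lra.
have sQ0 : 0 < Num.sqrt Q by rewrite sqrtr_gt0.
have aC : alpha * C <= C by rewrite ler_piMl ?ltW.
have aC0 : 0 < alpha * C by rewrite mulr_gt0.
rewrite /denominator_const /model_prior -/s0.
have cb0 : (0 < 'C(p, s0))%N by rewrite bin_gt0.
have h1 : (A1 * expR (- A3 * L) * expR (- L)) ^+ s0 * w 0 <= w s0 / 'C(p, s0)%:R.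
  rewrite exprMn mulrAC; apply: ler_pM => //.
  - by rewrite mulr_ge0 ?exprn_ge0 ?mulr_ge0 ?expR_ge0 ?ltW.
  - rewrite expRN exprVn eL lef_pV2 ?posrE ?exprn_gt0 ?ltr0n//.
    by rewrite -natrX ler_nat binomial_le_exp.
have h2 : (expR (- A5 / 2 * L) / Num.sqrt Q) ^+ s0 <=
    Num.sqrt ((lam / (lam + 2 * (alpha * C))) ^+ s0).
  have den0 : 0 < lam + 2 * (alpha * C) by lra.
  rewrite [leRHS]sqrtrX; last by rewrite divr_ge0 ?ltW.
  apply: exprn_le; first by rewrite divr_ge0 ?expR_ge0 ?sqrtr_ge0.
  rewrite (sqrtrM _ (ltW lam0)) (sqrtrV (ltW den0)).
  apply: ler_pM; rewrite ?expR_ge0 ?invr_ge0 ?sqrtr_ge0//.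
    have -> : expR (- A5 / 2 * L) = Num.sqrt (expR (- A5 * L)).
      by rewrite sqrt_expR; congr expR; ring.
    by rewrite (ler_sqrt _ (ltW lam0)).
  rewrite lef_pV2 ?posrE ?sqrtr_gt0// (ler_sqrt _ (ltW Q0)) /Q; lra.
have h3 : expR (- ((A3 + 1 + A5 / 2 + 1) * L)) <=
    A1 * expR (- A3 * L) * expR (- L) * (expR (- A5 / 2 * L) / Num.sqrt Q).
  have -> : expR (- ((A3 + 1 + A5 / 2 + 1) * L)) =
      expR (- A3 * L) * expR (- L) * expR (- A5 / 2 * L) * expR (- L).
    by rewrite -!expRD; congr expR; ring.
  have -> : A1 * expR (- A3 * L) * expR (- L) * (expR (- A5 / 2 * L) / Num.sqrt Q) =
      expR (- A3 * L) * expR (- L) * expR (- A5 / 2 * L) * (A1 / Num.sqrt Q) by ring.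
  rewrite ler_wpM2l ?mulr_ge0 ?expR_ge0// ler_pdivlMr// expRN ler_pdivrMl ?expR_gt0//.
  by rewrite mulrC.
apply: (@le_trans _ _ ((A1 * expR (- A3 * L) * expR (- L)) ^+ s0 * w 0 *
    (2^-1 * (expR (- A5 / 2 * L) / Num.sqrt Q) ^+ s0))).
  have -> : (A1 * expR (- A3 * L) * expR (- L)) ^+ s0 * w 0 *
    (2^-1 * (expR (- A5 / 2 * L) / Num.sqrt Q) ^+ s0) =
    w 0 / 2 * (A1 * expR (- A3 * L) * expR (- L) * (expR (- A5 / 2 * L) / Num.sqrt Q)) ^+ s0.
    by rewrite [in RHS]exprMn; ring.
  rewrite ler_wpM2l ?divr_ge0 ?(ltW w0)//; apply: exprn_le h3; exact: expR_ge0.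
apply: ler_pM => //.
- by rewrite mulr_ge0 ?(ltW w0)// exprn_ge0// !mulr_ge0 ?expR_ge0 ?ltW.
- by rewrite ler_pM2l// invr_gt0.
Qed.

(** Otherwise the upper bound on the ratios would make all the weights vanish. *)
Lemma weight0_gt0 (smax : nat) (w : nat -> R) (rho : R) :
    0 <= rho -> (forall s, (s <= smax)%N -> 0 <= w s) ->
    \sum_(s < smax.+1) w s = 1 ->
    (forall s, (1 <= s <= smax)%N -> w s <= rho * w s.-1) ->
  0 < w 0.
Proof.
move=> rho0 w0 w1 wr; rewrite lt_def w0// andbT; apply/eqP => w00.
have h s : (s <= smax)%N -> w s = 0.
  elim: s => [//|s IH] hs; apply/eqP; rewrite eq_le w0// andbT.
  by apply: le_trans (wr s.+1 hs) _; rewrite /= IH ?mulr0// ltnW.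
move: w1; rewrite big1 => [/eqP|s _]; first by rewrite eq_sym oner_eq0.
by apply: h; rewrite -ltnS.
Qed.

Lemma weight_ge (smax : nat) (w : nat -> R) (rho : R) s :
    0 <= rho -> (s <= smax)%N -> (forall s, (s <= smax)%N -> 0 <= w s) ->
    (forall s, (1 <= s <= smax)%N -> rho * w s.-1 <= w s) ->
  rho ^+ s * w 0 <= w s.
Proof.
move=> rho0 + w0 wr; elim: s => [|s IH] hs; first by rewrite expr0 mul1r.
apply: le_trans (wr s.+1 hs); rewrite exprS -mulrA ler_wpM2l//.
exact/IH/ltnW.
Qed.

Lemma ln_large (p : nat -> nat) (c M : R) : 0 < c ->
  (\forall n \near \oo, n%:R `^ c <= (p n)%:R :> R) ->
  \forall n \near \oo, M <= ln (p n)%:R.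
Proof.
move=> c0 hp; near=> n.
have n0 : (0 < n%:R :> R).
  apply: (@lt_le_trans _ _ (expR (M / c))); first exact: expR_gt0.
  by near: n; exact: nbhs_infty_ger.
have pn : n%:R `^ c <= (p n)%:R :> R by near: n.
have h : M / c <= ln n%:R.
  by rewrite -ler_expR lnK ?posrE//; near: n; exact: nbhs_infty_ger.
apply: (@le_trans _ _ (ln (n%:R `^ c))).
  by rewrite ln_powR mulrC -ler_pdivrMr.
by rewrite ler_ln ?posrE ?powR_gt0// (lt_le_trans _ pn)// powR_gt0.
Unshelve. all: by end_near. Qed.

End Rates.

Section RateBounds.
Context {R : realType}.

Lemma expR_ge4 (x : R) : 3 <= x -> 4 <= expR x.
Proof. by move=> x3; apply: le_trans (expR_ge1Dx x); lra. Qed.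

(** With [tau = Num.sqrt L] and [a = (C / 2 + 3) * Num.sqrt L] the exponent is
    [- 3 * L]: one power of [p] pays for the number of directions and one for
    the factor 2. *)
Lemma score_term_le (C L : R) (s p : nat) : 0 < C -> 3 <= L -> expR L = p%:R ->
    (s <= p)%N ->
  (2 * s)%:R * expR (C * Num.sqrt L ^+ 2 / 2 - Num.sqrt L * ((C / 2 + 3) * Num.sqrt L))
    <= p%:R^-1.
Proof.
move=> C0 L3 eL sp; have L0 : 0 <= L by lra.
have -> : C * Num.sqrt L ^+ 2 / 2 - Num.sqrt L * ((C / 2 + 3) * Num.sqrt L) =
    - (3 * L).
  have := sqr_sqrtr L0; rewrite expr2 => h.
  have -> : Num.sqrt L * ((C / 2 + 3) * Num.sqrt L) =
    (C / 2 + 3) * (Num.sqrt L * Num.sqrt L) by ring.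
  by rewrite h; field.
have E : expR (- (3 * L)) = p%:R^-1 ^+ 3.
  by rewrite -eL -expRN -expRM_natl; congr expR; ring.
have p4 : 4 <= p%:R :> R by rewrite -eL; exact: expR_ge4.
have sp' : s%:R <= p%:R :> R by rewrite ler_nat.
have p0 : 0 < p%:R^-1 :> R by rewrite invr_gt0; lra.
rewrite E natrM exprS mulrCA ger_pMr// expr2 mulrA ler_pdivrMr ?mul1r; last lra.
rewrite ler_pdivrMr; last lra.
have : 2 * p%:R <= p%:R * p%:R :> R by rewrite ler_pM2r; lra.
lra.
Qed.

(** The multiple [(c0 + 2) / m] pays for the denominator, [c0], and leaves
    [expR (- 2 * s * L)], which absorbs the factor 4. *)
Lemma far_term_le (m c0 dc w0 L x : R) (s p : nat) : 0 < m -> 0 < w0 -> 3 <= L ->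
    expR L = p%:R -> (0 < s)%N -> w0 / 2 * expR (- (c0 * L)) ^+ s <= dc ->
    x = (c0 + 2) / m * (s%:R * L) ->
  expR (- (m * x)) / dc * (2 * w0) <= p%:R^-1.
Proof.
move=> m0 w00 L3 eL s0 dcge ->.
have s1 : 1 <= s%:R :> R by rewrite ler1n.
have dc0 : 0 < dc.
  apply: lt_le_trans dcge; rewrite mulr_gt0 ?exprn_gt0 ?expR_gt0//; lra.
have -> : expR (- (m * ((c0 + 2) / m * (s%:R * L)))) =
    expR (- (c0 * L)) ^+ s * expR (- (2 * (s%:R * L))).
  rewrite -expRM_natl -expRD; congr expR; field; exact: lt0r_neq0.
have h : expR (- (c0 * L)) ^+ s * (w0 / 2) <= dc by rewrite mulrC.
rewrite -mulrA mulrAC mulrA -mulrA.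
apply: (@le_trans _ _ (4 * expR (- (2 * (s%:R * L))))).
  rewrite [leLHS](_ : _ = 4 * expR (- (2 * (s%:R * L))) *
      ((expR (- (c0 * L)) ^+ s * (w0 / 2)) / dc)); last by field; exact: lt0r_neq0.
  by rewrite ger_pMr ?mulr_gt0 ?expR_gt0// ler_pdivrMr// mul1r.
rewrite -eL -expRN.
have sL : L <= s%:R * L by rewrite ler_peMl//; lra.
apply: (@le_trans _ _ (expR L * expR (- (2 * L)))).
  apply: ler_pM => //; first by rewrite expR_ge4.
  by rewrite ler_expR; lra.
by rewrite -expRD ler_expR; lra.
Qed.

(** The exponent [- A4 * L] of the weight ratio is compensated by at most a half
    through [lam] and at most a quarter through [D]. *)
Lemma penalised_weight_ratio_le (A2 A4 L lam D : R) :
    0 < A4 -> 0 < A2 -> 0 <= L -> lam <= A4 -> 0 < D -> ln D <= A4 / 4 * L -> A2 * Num.sqrt 2 * 2 <= expR (A4 / 4 * L) ->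
  A2 * expR (- A4 * L) * (Num.sqrt 2 * D * expR (lam * L / 2)) <= 2^-1.
Proof.
move=> A40 A20 L0 lamA D0 lnD big.
have -> : A2 * expR (- A4 * L) * (Num.sqrt 2 * D * expR (lam * L / 2)) =
   A2 * Num.sqrt 2 * expR (- A4 * L + ln D + lam * L / 2).
  by rewrite !expRD lnK ?posrE//; ring.
apply: (@le_trans _ _ (A2 * Num.sqrt 2 * expR (- (A4 / 4 * L)))).
  rewrite ler_wpM2l ?mulr_ge0 ?sqrtr_ge0 ?(ltW A20)// ler_expR.
  have : lam * L <= A4 * L by rewrite ler_wpM2r.
  lra.
rewrite expRN ler_pdivrMr ?expR_gt0//; lra.
Qed.

Lemma le_half_sq (x : R) : 0 <= x -> x ^+ 2 <= 4^-1 -> x <= 2^-1.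
Proof. by move=> x0 h; rewrite -ler_sqr ?nnegrE// (_ : 2^-1 ^+ 2 = 4^-1 :> R)//; field. Qed.

Lemma eq_fisher n q (b : R -> R) (X : 'M[R]_(n, q)) (t t' : 'cV[R]_q) :
  (forall i, linpred X t i = linpred X t' i) -> fisher b X t = fisher b X t'.
Proof. by move=> h; rewrite /fisher; apply: eq_bigr => i _; rewrite h. Qed.

Lemma zeta_ge0 n q (b : R -> R) (X : 'M[R]_(n, q)) (t : 'cV[R]_q) : 0 <= zeta b X t.
Proof.
by rewrite /zeta; elim/big_ind: _ => // [x y x0 y0|j _]; rewrite ?le_max ?x0// sqrtr_ge0.
Qed.

(** What the leverages are for: they turn bounds in the Fisher norm into bounds on
    every linear predictor. *)
Lemma zeta_leverage n q (b : R -> R) (X : 'M[R]_(n, q)) (t v : 'cV[R]_q) i :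
    psdmx (fisher b X t) -> fisher b X t \in unitmx ->
  linpred X v i ^+ 2 <= zeta b X t ^+ 2 * quadform (fisher b X t) v.
Proof.
move=> pF uF; rewrite linpred_row; apply: le_trans (dot_le_leverage _ _ pF uF) _.
have [_ q0] := pF; rewrite ler_wpM2r// ler_sqr ?nnegrE ?sqrtr_ge0 ?zeta_ge0//.
pose lev j := norm2 (invmx (sqrtmx (fisher b X t)) *m (row j X)^T).
by rewrite /zeta; apply: (le_bigmax _ lev).
Qed.

Lemma supp_gt0 q (t : 'cV[R]_q) : t != 0 -> (0 < #|supp t|)%N.
Proof.
move=> t0; rewrite card_gt0; apply: contra_neq t0 => S0.
apply/matrixP => j o; rewrite ord1 mxE.
apply/eqP; apply: contraT => tj.
have : j \in supp t by rewrite finset.in_set.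
by rewrite S0 finset.in_set0.
Qed.
End RateBounds.

(** How small the squared leverage times [s0 * ln p] has to be for the local
    quadratic bounds to hold on all the ellipsoids involved.  The first term
    corresponds to the radius within which the estimator is located, the second
    to the exponent of the Chernoff bound and the third to the ellipsoid around
    the estimator. *)
Definition leverage_bound {R : realType} (C alpha : R) : R :=
  Num.min (4 * (2 * C * (C / 2 + 3) + 1) ^+ 2)^-1 (Num.min 4^-1 (alpha / 16)).

(** [A3 + 1 + A5 / 2 + 1] is the exponent of [p ^ (- s0)] in the lower bound on the
    denominator, and 2 the margin by which the numerator is smaller. *)
Definition hellinger_radius {R : realType} (alpha A3 A5 : R) : R :=
  Num.sqrt ((A3 + 1 + A5 / 2 + 1 + 2) / Num.min alpha (1 - alpha)).

Lemma leverage_bound_gt0 {R : realType} (C alpha : R) :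
  1 <= C -> 0 < alpha < 1 -> 0 < leverage_bound C alpha.
Proof.
move=> C1 /andP[al0 _]; have C0 : 0 < C := lt_le_trans ltr01 C1.
rewrite !lt_min invr_gt0 divr_gt0// invr_gt0 ltr0n !andbT mulr_gt0// exprn_gt0//.
by rewrite ltr_wpDl// !mulr_ge0 ?ltW// addr_gt0// divr_gt0.
Qed.

Lemma hellinger_radius_gt0 {R : realType} (alpha A3 A5 : R) :
  0 < alpha < 1 -> 0 < A3 -> 0 < A5 -> 0 < hellinger_radius alpha A3 A5.
Proof.
move=> /andP[al0 al1] A30 A50; rewrite sqrtr_gt0 divr_gt0//.
  by rewrite !addr_gt0// divr_gt0.
by rewrite lt_min al0 subr_gt0.
Qed.

Lemma leverage_consequences {R : realType} (C alpha z L : R) (s : nat) :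
    let B := C / 2 + 3 in let K := 2 * C * B + 1 in
    1 <= C -> 0 <= z -> (0 < s)%N -> 3 <= L ->
    z ^+ 2 * s%:R * L <= leverage_bound C alpha ->
  [/\ 16 * z ^+ 2 * s%:R <= alpha, Num.sqrt L * z <= 2^-1,
      z * (K * Num.sqrt (s%:R * L)) <= 2^-1 &
      2 * C * (B * Num.sqrt L * Num.sqrt s%:R) < K * Num.sqrt (s%:R * L)].
Proof.
move=> B K C1 z0 s0 L3 zs.
have s1 : 1 <= s%:R :> R by rewrite ler1n.
have L0 : 0 <= L by lra.
have z20 : 0 <= z ^+ 2 by exact: sqr_ge0.
have B0 : 0 < B by rewrite /B; lra.
have CB0 : 0 <= 2 * C * B by rewrite mulr_ge0 ?(ltW B0)//; lra.
have K0 : 0 < K by rewrite ltr_wpDl.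
rewrite -mulrA in zs.
move: zs; rewrite !le_min => /and3P[zK z4 zalpha].
have sL0 : 0 <= s%:R * L by rewrite mulr_ge0.
split.
- rewrite -mulrA mulrC -ler_pdivlMr//; apply: le_trans zalpha.
  by rewrite mulrA ler_peMr ?mulr_ge0//; lra.
- apply: le_half_sq; first by rewrite mulr_ge0 ?sqrtr_ge0.
  rewrite exprMn sqr_sqrtr// mulrC; apply: le_trans z4.
  by rewrite ler_wpM2l// ler_peMl.
- apply: le_half_sq; first by rewrite !mulr_ge0 ?sqrtr_ge0// ltW.
  rewrite !exprMn sqr_sqrtr// mulrCA.
  apply: (@le_trans _ _ (K ^+ 2 * (4 * K ^+ 2)^-1)).
    by rewrite ler_wpM2l ?sqr_ge0.
  by rewrite invfM mulrCA divff ?mulr1// expf_neq0// lt0r_neq0.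
- rewrite sqrtrM//.
  rewrite [ltLHS](_ : _ = 2 * C * B * (Num.sqrt s%:R * Num.sqrt L)); last by ring.
  by rewrite ltr_pM2r ?ltrDl// mulr_gt0// sqrtr_gt0; lra.
Qed.

Lemma mul_sqrt_rate {R : realType} (K x : R) (n : nat) :
  0 <= K -> 0 <= x -> (0 < n)%N ->
  n%:R * (Num.sqrt K * Num.sqrt (x / n%:R)) ^+ 2 = K * x.
Proof.
move=> K0 x0 n0; rewrite exprMn !sqr_sqrtr ?divr_ge0// mulrCA.
by congr (_ * _); rewrite mulrC divfK// pnatr_eq0 -lt0n.
Qed.

Lemma bound_collect {R : realType} (x q u v s f : R) : s <= q -> f <= q ->
  0 <= q -> 0 <= u -> 0 <= v -> x = q + s + f -> x <= u + 4 * q + v.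
Proof. by move=> *; lra. Qed.

Section Rate.
Context {R : realType} {d : measure_display} {T : measurableType d} {n p : nat}.
Variables (mu : {measure set R -> \bar R}) (b b1 b2 k : R -> R) (C : R).
Hypothesis mk : measurable_fun setT k.
Hypothesis dens1 : forall eta : R, (\int[mu]_y (glm_density b k eta y)%:E = 1)%E.
Hypothesis db : forall x : R, is_derive x (1 : R) b (b1 x).
Hypothesis db1 : forall x : R, is_derive x (1 : R) b1 (b2 x).
Hypothesis b2E : derive1n 2 b = b2.
Hypothesis bC : forall x y : R, `|y| <= 2^-1 -> b2 (x + y) <= C * b2 x.
Hypothesis cb : strictly_convex b.
Hypothesis C1 : 1 <= C.
Variables (X : 'M[R]_(n, p)) (theta0 : 'cV[R]_p).
Variables (P : probability T R) (Y : 'I_n -> {RV P >-> R}).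
Hypothesis law : forall (i : 'I_n) (B : set R), measurable B ->
  distribution P (Y i) B =
  (\int[mu]_(y in B) (glm_density b k (linpred X theta0 i) y)%:E)%E.
Hypothesis indep : mutually_independent P (fun i => Y i : T -> R).
Hypothesis intk : forall i : 'I_n, P.-integrable setT (fun om => (k (Y i om))%:E).
Hypothesis n0 : (0 < n)%N.
Hypothesis theta0_neq0 : theta0 != 0.

Let S0 := supp theta0.
Let s0 := #|S0|.
Let X0 := subcols S0 X.
Let L : R := ln p%:R.
Let thetastar := expected_mle P (fun i => Y i : T -> R) b k X S0.
Let z := zeta b X0 thetastar.

Variables (smax : nat) (w : nat -> R) (lam alpha D A1 A2 A3 A4 A5 A6 : R).
Hypothesis w0 : forall s, (s <= smax)%N -> 0 <= w s.
Hypothesis w1 : \sum_(s < smax.+1) w s = 1.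
Hypothesis w_le : forall s, (1 <= s <= smax)%N -> w s <= A2 * p%:R `^ (- A4) * w s.-1.
Hypothesis w_ge : forall s, (1 <= s <= smax)%N -> A1 * p%:R `^ (- A3) * w s.-1 <= w s.
Hypothesis A1_gt0 : 0 < A1.
Hypothesis A2_gt0 : 0 < A2.
Hypothesis A3_gt0 : 0 < A3.
Hypothesis A4_gt0 : 0 < A4.
Hypothesis A5_gt0 : 0 < A5.
Hypothesis A6_gt0 : 0 < A6.
Hypothesis alpha01 : 0 < alpha < 1.
Hypothesis lam_ge : p%:R `^ (- A5) <= lam.
Hypothesis lam_le4 : lam <= A4.
Hypothesis lam_le6 : lam <= A6.
Hypothesis s0_max : (s0 <= smax)%N.
Hypothesis D_gt0 : 0 < D.
Hypothesis D_le : ln D <= A4 / 4 * L.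
Variable thetabar : forall S : {set 'I_p}, 'cV[R]_#|S|.
Hypothesis Fbar_unit : forall S : {set 'I_p}, (#|S| <= smax)%N ->
  fisher b (subcols S X) (thetabar S) \in unitmx.
Variable G : set T.
Hypothesis mG : measurable G.
Hypothesis PG : (P G >= (1 - p%:R^-1)%:E)%E.
Hypothesis goodG : forall om, G om ->
  good_data b k X (Y ^~ om) smax D L thetabar.
Hypothesis Fstar_unit : fisher b X0 thetastar \in unitmx.
Hypothesis z_small : z ^+ 2 * s0%:R * L <= leverage_bound C alpha.
Hypothesis L3 : 3 <= L.
Hypothesis L_A4 : 4 / A4 * (A2 * Num.sqrt 2 * 2) <= L.
Hypothesis L_A6 : A1^-1 * Num.sqrt (A6 + 2 * C) <= L.

Let c0 := A3 + 1 + A5 / 2 + 1.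
Let m := Num.min alpha (1 - alpha).

(** The result at a single sample size: the asymptotic assumptions enter as explicit
    lower bounds on [L] and upper bounds on [ln D] and on the leverages. *)
Theorem posterior_contraction :
  ('E_P[fun om => frac_posterior b k X (Y ^~ om) smax w lam alpha
     [set th | hellinger_radius alpha A3 A5 * Num.sqrt (s0%:R * L / n%:R) <
       hellinger mu b k X th theta0]%R] <=
   (2 * (s0%:R * L)^-1 + 4 * p%:R^-1 + 2 * (p%:R ^+ s0)^-1)%:E)%E.
Proof.
have [al0 al1] := andP alpha01.
have m0 : 0 < m by rewrite lt_min al0 subr_gt0.
have c00 : 0 < c0 by rewrite /c0 !addr_gt0// divr_gt0.
pose B := C / 2 + 3.
have C0 : 0 < C := lt_le_trans ltr01 C1.
have B0 : 0 < B by rewrite addr_gt0// divr_gt0.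
have K10 : 0 < 2 * C * B + 1 by rewrite ltr_wpDl// !mulr_ge0// ltW.
have K0 : 0 < (c0 + 2) / m by rewrite divr_gt0// addr_gt0.
have L0 : 0 < L by apply: lt_le_trans L3.
have p0 : (0 < p)%N.
  by rewrite lt0n; apply/negP => /eqP pn0; move: L0; rewrite /L pn0 ln0// ltxx.
have eL : expR L = p%:R by rewrite /L lnK// posrE ltr0n.
have pE r : p%:R `^ r = expR (r * L) :> R by rewrite powR_expR_ln// ltr0n.
have s00 : (0 < s0)%N := supp_gt0 theta0_neq0.
have s01 : 1 <= s0%:R :> R by rewrite ler1n.
have sL0 : 0 < s0%:R * L := mulr_gt0 (lt_le_trans ltr01 s01) L0.
have s0p : (s0 <= p)%N by rewrite -[leqRHS]card_ord max_card.
have lam1 : expR (- A5 * L) <= lam by rewrite -pE.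
have lam0 : 0 < lam := lt_le_trans (expR_gt0 _) lam1.
pose rho := A2 * expR (- A4 * L).
have rho0 : 0 <= rho by rewrite mulr_ge0 ?expR_ge0 ?ltW.
have rhokap : rho * (Num.sqrt 2 * D * expR (lam * L / 2)) <= 2^-1.
  apply: penalised_weight_ratio_le => //; first exact: ltW.
  apply: le_trans (expR_ge1Dx _); rewrite ler_wpDl//.
  by rewrite -ler_pdivrMl ?divr_gt0// invf_div.
have wup s : (1 <= s <= smax)%N -> w s <= rho * w s.-1.
  by move=> /w_le; rewrite pE.
have wn0 : 0 < w 0 := weight0_gt0 rho0 w0 w1 wup.
have wlow : (A1 * expR (- A3 * L)) ^+ s0 * w 0 <= w s0.
  apply: (weight_ge _ s0_max w0); first by rewrite mulr_ge0 ?expR_ge0 ?ltW.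
  by move=> s /w_ge; rewrite pE.
have QA : Num.sqrt (A6 + 2 * C) <= A1 * expR L.
  rewrite -ler_pdivrMl//; apply: le_trans L_A6 _.
  by apply: le_trans (expR_ge1Dx _); rewrite ler_wpDl.
have dcge := denominator_const_ge n p0 s0p C1 alpha01 A1_gt0 A6_gt0 wn0 wlow lam1 lam_le6 QA.
set dc := denominator_const _ _ _ _ _ in dcge.
have dc0 : 0 < dc.
  by apply: lt_le_trans dcge; rewrite mulr_gt0 ?divr_gt0// exprn_gt0// expR_gt0.
(* the two parameters may differ, but they have the same linear predictors *)
have FE : fisher b X0 thetastar = fisher b X0 (restrict S0 theta0).
  apply: eq_fisher => i; rewrite linpred_restrict.
  exact: (expected_mle_linpred mk dens1 cb law intk (fun i => erefl)).
have F0u : fisher b X0 (restrict S0 theta0) \in unitmx by rewrite -FE.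
have z0 : 0 <= z by exact: zeta_ge0.
have lev v i : linpred X0 v i ^+ 2 <=
    z ^+ 2 * quadform (fisher b X0 (restrict S0 theta0)) v.
  rewrite -FE; apply: zeta_leverage; last by rewrite FE.
  exact: (fisher_psd db db1 b2E bC cb C1).
have [z_s tauz zr1 ar1] := leverage_consequences C1 z0 s00 L3 z_small.
pose r1 := (2 * C * B + 1) * Num.sqrt (s0%:R * L).
have r10 : 0 < r1.
  by apply: mulr_gt0 K10 _; rewrite sqrtr_gt0; exact: sL0.
set eps := Num.sqrt (_ / _).
have eps0 : 0 <= eps by exact: sqrtr_ge0.
have a0 : 0 <= B * Num.sqrt L := mulr_ge0 (ltW B0) (sqrtr_ge0 L).
have tau0 : 0 < Num.sqrt L by rewrite sqrtr_gt0; exact: L0.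
have r0 : 0 <= hellinger_radius alpha A3 A5 * eps := mulr_ge0 (sqrtr_ge0 _) eps0.
have := expected_posterior_mass mk dens1 db db1 b2E bC cb C1 law indep
  F0u lev z0 tau0 tauz w0 lam0 alpha01 D_gt0 Fbar_unit rho0 rhokap wup mG PG goodG
  s0_max s00 a0 r10 zr1 ar1 z_s r0 n0 dc0.
move=> /le_trans; apply; rewrite lee_fin.
have x0 : n%:R * (hellinger_radius alpha A3 A5 * eps) ^+ 2 = (c0 + 2) / m * (s0%:R * L).
  exact: (mul_sqrt_rate (ltW K0) (ltW sL0) n0).
have t1 := score_term_le C0 L3 eL s0p.
have t2 := far_term_le m0 wn0 L3 eL s00 dcge x0.
apply: (bound_collect t1 t2 _ _ _ erefl).
- by rewrite invr_ge0 ler0n.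
- by apply: (mulr_ge0 (ler0n _ 2)); rewrite invr_ge0; exact: (ltW sL0).
- by apply: (mulr_ge0 (ler0n _ 2)); rewrite invr_ge0; exact: (exprn_ge0 _ (ler0n _ p)).
Qed.

End Rate.

Theorem theorem4p3 (R : realType)
  (* exponential family *)
  (mu : {measure set R -> \bar R}) (b k : R -> R) (Cdev : R)
  (hk : measurable_fun setT k)
  (hdens : forall eta : R, (\int[mu]_y (glm_density b k eta y)%:E = 1)%E)
  (hconv : strictly_convex b)
  (hdiff : forall j : nat, (j < 3)%N ->
     forall x : R, derivable (derive1n j b) x 1)
  (hCdev : 1 <= Cdev)
  (hdev : forall x y : R, `|y| <= 2^-1 ->
     derive1n 2 b (x + y) <= Cdev * derive1n 2 b x)
  (* design, true parameter and data *)
  (p : nat -> nat) (X : forall n, 'M[R]_(n, p n))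
  (theta0 : forall n, 'cV[R]_(p n))
  (d : nat -> measure_display) (Omega : forall n, measurableType (d n))
  (P : forall n, probability (Omega n) R)
  (Y : forall n, 'I_n -> {RV (P n) >-> R})
  (c : R) (hc : 0 < c)
  (hp : \forall n \near \oo, n%:R `^ c <= (p n)%:R :> R)
  (htheta0 : \forall n \near \oo, theta0 n != 0)
  (hindep : \forall n \near \oo,
     mutually_independent (P n) (fun i => Y n i : Omega n -> R))
  (hlaw : \forall n \near \oo, forall (i : 'I_n) (B : set R), measurable B ->
     distribution (P n) (Y n i) B =
     (\int[mu]_(y in B)
        (glm_density b k (linpred (X n) (theta0 n) i) y)%:E)%E)
  (* finiteness of the expected log-likelihood *)
  (hintk : \forall n \near \oo, forall i : 'I_n,
     (P n).-integrable setT (fun om => (k (Y n i om))%:E))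
  (* prior *)
  (smax : nat -> nat) (w : nat -> nat -> R) (lam : nat -> R)
  (A1 A2 A3 A4 : R)
  (hA1 : 0 < A1) (hA2 : 0 < A2) (hA3 : 0 < A3) (hA4 : 0 < A4)
  (hsmax : \forall n \near \oo,
     (#|supp (theta0 n)| <= smax n <= \rank (X n))%N)
  (hw : \forall n \near \oo, (forall s, (s <= smax n)%N -> 0 <= w n s) /\
     \sum_(s < (smax n).+1) w n s = 1)
  (hwratio : \forall n \near \oo, forall s, (1 <= s <= smax n)%N ->
     A1 * (p n)%:R `^ (- A3) * w n s.-1 <= w n s /\
     w n s <= A2 * (p n)%:R `^ (- A4) * w n s.-1)
  (hlam0 : \forall n \near \oo, 0 < lam n)
  (* behaviour of the maximum likelihood estimators *)
  (D : nat -> R)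
  (thetabar : forall n (S : {set 'I_(p n)}), 'cV[R]_#|S|)
  (hD : \forall n \near \oo, Num.sqrt 2 < D n)
  (hbar : \forall n \near \oo, forall S : {set 'I_(p n)}, (#|S| <= smax n)%N ->
     fisher b (subcols S (X n)) (thetabar n S) \in unitmx)
  (hevent : \forall n \near \oo, exists2 G : set (Omega n),
     measurable G /\ (P n G >= (1 - (p n)%:R^-1)%:E)%E &
     forall om, G om -> forall S : {set 'I_(p n)}, (#|S| <= smax n)%N ->
       let y := fun i => Y n i om in
       let Fhat := fisher b (subcols S (X n)) (mle b k (X n) y S) in
       let Fbar := fisher b (subcols S (X n)) (thetabar n S) in
       [/\ mle_set b k (X n) y S !=set0,
           loewner_le ((D n)^-1 *: Fbar) Fhat,
           loewner_le Fhat (D n *: Fbar) &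
           norm2 (sqrtmx Fbar *m (mle b k (X n) y S - thetabar n S)) ^+ 2 <=
             D n * #|S|%:R * ln (p n)%:R])
  (hstar : \forall n \near \oo,
     fisher b (subcols (supp (theta0 n)) (X n))
       (expected_mle (P n) (Y n) b k (X n) (supp (theta0 n))) \in unitmx)
  (hzeta : (fun n : nat =>
     zeta b (subcols (supp (theta0 n)) (X n))
       (expected_mle (P n) (Y n) b k (X n) (supp (theta0 n))) ^+ 2 *
     #|supp (theta0 n)|%:R * ln (p n)%:R) =o_\oo (fun _ : nat => 1 : R))
  (* growth conditions *)
  (A5 A6 A7 alpha : R)
  (hlog : (fun n : nat =>
     let S0 := supp (theta0 n) in
     let Fstar := fisher b (subcols S0 (X n))
       (expected_mle (P n) (Y n) b k (X n) S0) in
     ln (Num.max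
       (Num.max
         (\big[Num.max/0]_(i < n)
            derive1n 2 b (linpred (X n) (theta0 n) i))
         (mxnorm_inf (subcols S0 (X n))))
       (Num.max (eigval_min Fstar)^-1%R (eigval_max Fstar)))) =O_\oo
     (fun n : nat => ln (p n)%:R : R))
  (hs0 : (fun n : nat => #|supp (theta0 n)|%:R * ln (p n)%:R) =o_\oo
     (fun n : nat => n%:R : R))
  (hA5 : 0 < A5) (hA6 : 0 < A6) (hA7 : 0 <= A7)
  (hlam : \forall n \near \oo,
     (p n)%:R `^ (- A5) <= lam n <= A6 * (p n)%:R `^ (- A7))
  (halpha : 0 < alpha < 1)
  (hA64 : \forall n \near \oo, A6 * (p n)%:R `^ (- A7) < A4)
  (hlogD : (fun n : nat => ln (D n) / ln (p n)%:R) =o_\oo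
     (fun _ : nat => 1 : R)) :
  exists2 KHel : R, 0 < KHel &
    \forall n \near \oo,
      let s0 := #|supp (theta0 n)| in
      let eps : R := Num.sqrt (s0%:R * ln (p n)%:R / n%:R) in
      let far : set 'cV[R]_(p n) := [set theta |
        KHel * eps < hellinger mu b k (X n) theta (theta0 n)] in
      let bound : R := 2 * (s0%:R * ln (p n)%:R)^-1 + 4 * (p n)%:R^-1 +
        2 * ((p n)%:R ^+ s0)^-1 in
      ('E_(P n)[fun om => frac_posterior b k (X n) (fun i => Y n i om)
         (smax n) (w n) (lam n) alpha far] <= bound%:E)%E.
Proof.

have db x : is_derive x (1 : R) b (derive1 b x).
  by rewrite derive1E; apply: derivableP; exact: (@hdiff 0 isT x).
have db1 x : is_derive x (1 : R) (derive1 b) (derive1n 2 b x).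
  by rewrite /derive1n/= derive1E; apply: derivableP; exact: (@hdiff 1 isT x).
exists (hellinger_radius alpha A3 A5); first exact: hellinger_radius_gt0.
have hL M : \forall n \near \oo, M <= ln (p n)%:R :> R := ln_large M hc hp.
have hz : \forall n \near \oo,
    zeta b (subcols (supp (theta0 n)) (X n))
       (expected_mle (P n) (Y n) b k (X n) (supp (theta0 n))) ^+ 2 *
     #|supp (theta0 n)|%:R * ln (p n)%:R <= leverage_bound Cdev alpha.
  move: hzeta => /eqoP /(_ _ (leverage_bound_gt0 hCdev halpha)).
  apply: filterS => n.
  by rewrite normr1 mulr1; apply: le_trans; exact: ler_norm.
have hlD : \forall n \near \oo, ln (D n) / ln (p n)%:R <= A4 / 4.
  have A40 : 0 < A4 / 4 by rewrite divr_gt0.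
  move: hlogD => /eqoP /(_ _ A40); apply: filterS => n.
  by rewrite normr1 mulr1; apply: le_trans; exact: ler_norm.
near=> n.
have L3 : 3 <= ln (p n)%:R :> R by near: n; exact: hL.
have L0 : 0 < ln (p n)%:R :> R by exact: lt_le_trans L3.
have p1 : 1 <= (p n)%:R :> R.
  rewrite ler1n lt0n; apply/negP => /eqP pn0.
  by move: L0; rewrite pn0 ln0// ltxx.
have /andP[lam1 lam2] : (p n)%:R `^ (- A5) <= lam n <= A6 * (p n)%:R `^ (- A7) by near: n.
have lamA : A6 * (p n)%:R `^ (- A7) < A4 by near: n.
have pA7 : (p n)%:R `^ (- A7) <= 1 :> R.
  by rewrite -[leRHS](powRr0 (p n)%:R); apply: ler_powR => //; rewrite oppr_le0.
have [w0 w1] : (forall s, (s <= smax n)%N -> 0 <= w n s) /\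
     \sum_(s < (smax n).+1) w n s = 1 by near: n.
have wr : forall s, (1 <= s <= smax n)%N ->
     A1 * (p n)%:R `^ (- A3) * w n s.-1 <= w n s /\
     w n s <= A2 * (p n)%:R `^ (- A4) * w n s.-1 by near: n.
have [G [mG PG] goodG] : exists2 G : set (Omega n),
     measurable G /\ (P n G >= (1 - (p n)%:R^-1)%:E)%E &
     forall om, G om -> good_data b k (X n) (fun i => Y n i om) (smax n) (D n)
       (ln (p n)%:R) (thetabar n).
  by near: n.
have /andP[s0max _] : (#|supp (theta0 n)| <= smax n <= \rank (X n))%N by near: n.
apply: (posterior_contraction hk hdens db db1 erefl hdev hconv hCdev (A1 := A1)
  (A2 := A2) (A4 := A4) (A6 := A6) _ _ _ _ _ w0 w1 (fun s hs => (wr s hs).2)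
  (fun s hs => (wr s hs).1) hA1 hA2 hA3 hA4 hA5 hA6 halpha lam1 _ _ s0max _ _ _ mG PG goodG).
- by near: n.
- by near: n.
- by near: n.
- by near: n; exact: nbhs_infty_gt.
- by near: n.
- exact: le_trans lam2 (ltW lamA).
- by apply: le_trans lam2 _; rewrite ger_pMr.
- by apply: le_lt_trans (sqrtr_ge0 2) _; near: n.
- by rewrite -ler_pdivrMr//; near: n.
- by near: n.
- by near: n.
- by near: n.
- exact: L3.
- by near: n; exact: hL.
- by near: n; exact: hL.
Unshelve. all: by end_near.
Qed.
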